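(* Let $(A_1,\ldots,A_k)\in GL(d,\mathbb{R})^k$ generate a one-step cocycle $\mathcal{A}:\Sigma\to GL(d,\mathbb{R})$, where $\Sigma=\{1,\ldots,k\}^{\mathbb{Z}}$, and suppose that $\mathcal{A}$ is typical. Then $$h_{\mathrm{top}}(E(\vec{\alpha}))=\inf_{q\in\mathbb{R}^d}\left\{P(\log\psi^{q}(\mathcal{A}))-\langle q,\vec{\alpha}\rangle\right\}$$ for all $\vec{\alpha}\in\mathring{\vec{L}}$, where $\mathring{\vec{L}}$ is the interior of $\vec{L}$ in $\mathbb{R}^d$.
   Context: **Shift and one-step cocycles.** $\Sigma=\{1,\ldots,k\}^{\mathbb{Z}}$, and $T:\Sigma\to\Sigma$ is the left shift, $T(x_l)_{l\in\mathbb{Z}}=(x_{l+1})_{l\in\mathbb{Z}}$. The metric on $\Sigma$ is $d(x,y)=2^{-m}$ for $x\ne y$, where $m$ is the largest integer such that $x_i=y_i$ for all $|i|<m$ (and $d(x,x)=0$). A tuple $(A_1,\ldots,A_k)\in GL(d,\mathbb{R})^k$ generates the one-step cocycle $\mathcal{A}:\Sigma\to GL(d,\mathbb{R})$, $\mathcal{A}(x)=A_{x_0}$. For $n\ge 1$ put $\mathcal{A}^n(x)=\mathcal{A}(T^{n-1}x)\cdots\mathcal{A}(x)$ and $\mathcal{A}^{-n}(x)=\mathcal{A}(T^{-n}x)^{-1}\mathcal{A}(T^{-n+1}x)^{-1}\cdots\mathcal{A}(T^{-1}x)^{-1}$. $\mathcal{L}_n$ is the set of words of length $n$ over $\{1,\ldots,k\}$.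 For $I=i_0\ldots i_{n-1}\in\mathcal{L}_n$, $\mathcal{A}_I:=A_{i_{n-1}}\cdots A_{i_0}$. **Holonomies.** $W^s_{\mathrm{loc}}(x)=\{y: y_n=x_n\ \forall n\ge 0\}$ and $W^u_{\mathrm{loc}}(x)=\{y:y_n=x_n\ \forall n\le 0\}$. $W^s(x)$ (resp. $W^u(x)$) is the set of $y$ with $T^ny\in W^s_{\mathrm{loc}}(T^nx)$ for some $n\ge0$ (resp. $T^ny\in W^u_{\mathrm{loc}}(T^nx)$ for some $n\le 0$). The canonical holonomies are $H^s_{y\leftarrow x}=\lim_{n\to\infty}\mathcal{A}^n(y)^{-1}\mathcal{A}^n(x)$ for $y\in W^s(x)$ and $H^u_{y\leftarrow x}=\lim_{n\to-\infty}\mathcal{A}^n(y)^{-1}\mathcal{A}^n(x)$ for $y\in W^u(x)$. For one-step cocycles these limits exist (the sequences are eventually constant). **Typical cocycles.** A homoclinic point of a periodic point $p$ is a point $z\neq p$ with $z\in W^s(p)\cap W^u(p)$. The holonomy loop is $W_p^z:=H^s_{p\leftarrow z}\circ H^u_{z\leftarrow p}$. A one-step cocycle $\mathcal{B}:\Sigma\to GL(D,\mathbb{R})$ is 1-typical with respect to $(p,z)$, where $p$ is a periodic point of $T$ and $z$ is a homoclinic point of $p$, if: (i) the eigenvalues of $\mathcal{B}^{\mathrm{per}(p)}(p)$ have multiplicity $1$ and distinct absolute values; (ii) denoting by $v_1,\ldots,v_D$ the eigenvectors of $\mathcal{B}^{\mathrm{per}(p)}(p)$, for any $I,J\subset\{1,\ldots,D\}$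 with $|I|+|J|\le D$ the set of vectors $\{W_p^z(v_i):i\in I\}\cup\{v_j:j\in J\}$ is linearly independent (with $W_p^z$ formed using the holonomies of $\mathcal{B}$). The one-step cocycle $\mathcal{A}:\Sigma\to GL(d,\mathbb{R})$ is typical if there is a single pair $(p,z)$ such that the exterior power cocycle $\mathcal{A}^{\wedge t}$ (generated by $(A_1^{\wedge t},\ldots,A_k^{\wedge t})$ acting on $\wedge^t\mathbb{R}^d$) is 1-typical with respect to $(p,z)$ for all $1\le t\le d-1$. **Level sets.** $\sigma_1(A)\ge\cdots\ge\sigma_d(A)$ are the singular values of $A$. For $\vec{\alpha}=(\alpha_1,\ldots,\alpha_d)\in\mathbb{R}^d$, $$E(\vec{\alpha})=\Big\{x\in\Sigma:\lim_{n\to\infty}\tfrac1n\log\sigma_i(\mathcal{A}^n(x))=\alpha_i\text{ for }i=1,\ldots,d\Big\},\qquad \vec{L}=\{\vec{\alpha}\in\mathbb{R}^d:E(\vec{\alpha})\neq\emptyset\}.$$ **Pressure.** For $q=(q_1,\ldots,q_d)\in\mathbb{R}^d$, $\psi^q(A)=\sigma_1(A)^{q_1}\cdots\sigma_d(A)^{q_d}$, and $$P(\log\psi^q(\mathcal{A}))=\lim_{n\to\infty}\frac1n\log\sum_{I\in\mathcal{L}_n}\psi^q(\mathcal{A}_I),$$ where the limit exists when $\mathcal{A}$ is typical. **Topological entropy of a set (Bowen).** Let $d_n(x,y)=\max_{0\le j\le n-1}d(T^jx,T^jy)$ and $B_n(x,\epsilon)=\{y:d_n(x,y)<\epsilon\}$.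 For $Y\subset\Sigma$, $s\ge0$, $N\in\mathbb{N}$, $\epsilon>0$, let $S(Y,s,N,\epsilon)=\inf\sum_i e^{-sn_i}$, the infimum over all countable covers $\{B_{n_i}(y_i,\epsilon)\}_i$ of $Y$ with all $n_i\ge N$. Let $S(Y,s,\epsilon)=\lim_{N\to\infty}S(Y,s,N,\epsilon)$. Let $h_{\mathrm{top}}(T,Y,\epsilon)$ be the critical value of $s$ at which $S(Y,s,\epsilon)$ jumps from $\infty$ to $0$, and $h_{\mathrm{top}}(Y)=\lim_{\epsilon\to0}h_{\mathrm{top}}(T,Y,\epsilon)$. *)

(* Defs.v *)
From HB Require Import structures.
From mathcomp Require Import all_boot all_order all_fingroup all_algebra.
From mathcomp Require Import all_classical all_reals all_analysis.
From mathcomp Require Import complex.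

Set Implicit Arguments.
Unset Strict Implicit.
Unset Printing Implicit Defensive.

Import Order.TTheory GRing.Theory Num.Theory.
Import numFieldNormedType.Exports.

Local Open Scope classical_set_scope.
Local Open Scope ring_scope.
Local Open Scope complex_scope.

(** * The full two-sided shift *)

Definition Sigma (k : nat) : Type := int -> 'I_k.

(* [sshift n] is T^n, for n of either sign; the left shift T is [sshift 1]. *)
Definition sshift k (n : int) (x : Sigma k) : Sigma k := fun l => x (l + n).

Definition agree k (x y : Sigma k) (m : nat) : Prop :=
  forall i : int, `|i| < m%:Z -> x i = y i.

(* The default 0 of [xget] is never reached: for x <> y the set of m such that
   [agree x y m] contains 0 and is bounded. *)
Definition agreement k (x y : Sigma k) : nat :=
  xget 0%N [set m | agree x y m /\ forall m', agree x y m' -> (m' <= m)%N].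

Definition sdist (R : realType) k (x y : Sigma k) : R :=
  if pselect (x = y) then 0 else 2 ^- agreement x y.

(** * One-step cocycles *)

Section Cocycle.
Variables (R : realType) (k D : nat) (B : 'I_k -> 'M[R]_D).

Definition one_step (x : Sigma k) : 'M[R]_D := B (x 0).

Fixpoint cocycle_pos (n : nat) (x : Sigma k) : 'M[R]_D :=
  if n is m.+1 then one_step (sshift m%:Z x) *m cocycle_pos m x else 1%:M.

Fixpoint cocycle_neg (n : nat) (x : Sigma k) : 'M[R]_D :=
  if n is m.+1 then invmx (one_step (sshift (- n%:Z) x)) *m cocycle_neg m x
  else 1%:M.

Definition cocycle (n : int) (x : Sigma k) : 'M[R]_D :=
  match n with
  | Posz m => cocycle_pos m x
  | Negz m => cocycle_neg m.+1 x
  end.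

(* The factor of the last letter of the word stands leftmost. *)
Definition word_product (n : nat) (I : n.-tuple 'I_k) : 'M[R]_D :=
  foldl (fun M i => B i *m M) 1%:M I.

Definition Hs (y x : Sigma k) : 'M[R]_D :=
  limn (fun n : nat => invmx (cocycle n%:Z y) *m cocycle n%:Z x).

Definition Hu (y x : Sigma k) : 'M[R]_D :=
  limn (fun n : nat => invmx (cocycle (- n%:Z) y) *m cocycle (- n%:Z) x).

Definition holonomy_loop (p z : Sigma k) : 'M[R]_D := Hs p z *m Hu z p.

End Cocycle.

(** * Stable and unstable sets, periodic and homoclinic points *)

Section Points.
Variable k : nat.
Implicit Types x p z : Sigma k.

Definition Wsloc x : set (Sigma k) :=
  [set y | forall n : int, 0 <= n -> y n = x n].

Definition Wuloc x : set (Sigma k) :=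
  [set y | forall n : int, n <= 0 -> y n = x n].

Definition Ws x : set (Sigma k) :=
  [set y | exists2 n : int, 0 <= n & Wsloc (sshift n x) (sshift n y)].

Definition Wu x : set (Sigma k) :=
  [set y | exists2 n : int, n <= 0 & Wuloc (sshift n x) (sshift n y)].

Definition periods p : set nat := [set n | (0 < n)%N /\ sshift n%:Z p = p].

Definition periodic p : Prop := periods p !=set0.

(* The least period; meaningful only when p is periodic. *)
Definition per p : nat :=
  xget 0%N [set n | periods p n /\ forall m, periods p m -> (n <= m)%N].

Definition homoclinic p z : Prop := z <> p /\ (Ws p `&` Wu p) z.

End Points.

(** * Typical cocycles *)

Definition eigenvalues_simple_moduli (R : realType) D (M : 'M[R]_D) : Prop :=
  let chi := char_poly (map_mx (real_complex R) M) in
  (forall a : R[i], root chi a -> mup a chi = 1%N) /\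
  (forall a b : R[i], root chi a -> root chi b -> `|a| = `|b| -> a = b).

(* Non-real eigenvalues of a real matrix come in conjugate pairs, so under
   [eigenvalues_simple_moduli M] all eigenvalues are real and M has D real
   eigenlines; the independence condition does not depend on how these are
   numbered nor on the eigenvectors chosen in them.  [free] is applied to the
   concatenated family, so a coincidence W v_i = v_j counts as a dependence. *)
Definition eigenvectors_in_general_position (R : realType) D
    (M W : 'M[R]_D) : Prop :=
  exists (a : 'I_D -> R) (v : 'I_D -> 'cV[R]_D),
    [/\ injective a,
        forall i, v i != 0 /\ M *m v i = a i *: v i &
        forall I J : {set 'I_D}, (#|I| + #|J| <= D)%N ->
          free ([seq W *m v i | i <- enum I] ++ [seq v j | j <- enum J])].

Definition one_typical (R : realType) k D (B : 'I_k -> 'M[R]_D)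
    (p z : Sigma k) : Prop :=
  [/\ periodic p, homoclinic p z,
      eigenvalues_simple_moduli (cocycle B (per p)%:Z p) &
      eigenvectors_in_general_position
        (cocycle B (per p)%:Z p) (holonomy_loop B p z)].

(* The increasing t-tuples J = (j_1 < ... < j_t) index the standard basis
   e_J = e_{j_1} /\ ... /\ e_{j_t} of the exterior power of R^d. *)
Definition ext_index (t d : nat) : {set t.-tuple 'I_d} :=
  [set J : t.-tuple 'I_d | sorted ltn (map val J)].

Definition ext_dim (t d : nat) : nat := #|ext_index t d|.

(* Coordinates of v_1 /\ ... /\ v_t in the basis (e_J). *)
Definition wedge (R : realType) (t d : nat) (v : 'I_t -> 'cV[R]_d) :
    'cV[R]_(ext_dim t d) :=
  \col_I \det (\matrix_(a < t, b < t) v b (tnth (enum_val I) a) 0).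

(* Matrix of the t-th exterior power of M in the basis (e_J): its J-th column
   is M e_{j_1} /\ ... /\ M e_{j_t}. *)
Definition ext_power (R : realType) (t d : nat) (M : 'M[R]_d) :
    'M[R]_(ext_dim t d) :=
  \matrix_(I, J) wedge (fun b : 'I_t => col (tnth (enum_val J) b) M) I 0.

(* [ext_power t M] is indeed the induced map: it sends v_1 /\ ... /\ v_t to
   M v_1 /\ ... /\ M v_t, for all v_1, ..., v_t. *)
Lemma ext_power_wedge (R : realType) (t d : nat) (M : 'M[R]_d)
    (v : 'I_t -> 'cV[R]_d) :
  ext_power t M *m wedge v = wedge (fun b => M *m v b).
Proof.
apply/colP => I; rewrite !mxE.
pose f0 (J : t.-tuple 'I_d) (s : 'S_t) : {ffun 'I_t -> 'I_d} :=
  [ffun a => tnth J (s a)].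
pose G (f : {ffun 'I_t -> 'I_d}) := \det (\matrix_(a < t, b < t) v b (f a) 0).
pose P (f : {ffun 'I_t -> 'I_d}) :=
  \prod_(a < t) M (tnth (enum_val I) a) (f a).
have G0 (f : {ffun _ -> _}) : ~~ injectiveb f -> G f = 0.
  move=> /injectivePn[i [j ij fij]]; apply: (determinant_alternate ij) => b.
  by rewrite !mxE fij.
have Gs J s : G (f0 J s) = (-1) ^+ s * G [ffun a => tnth J a].
  rewrite /G -det_perm -det_mulmx -row_permE; congr (\det _).
  by apply/matrixP => a b; rewrite !mxE !ffunE.
have -> : \det (\matrix_(a < t, b < t) (M *m v b) (tnth (enum_val I) a) 0) =
    \sum_f P f * G f.
  rewrite /determinant.
  under eq_bigr => s _.
    under eq_bigr => a _ do rewrite !mxE.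
    rewrite bigA_distr_bigA big_distrr /=; over.
  rewrite exchange_big /=; apply: eq_bigr => f _.
  rewrite big_distrr; apply: eq_bigr => s _ /=.
  rewrite big_split /= mulrCA; congr (_ * (_ * _)).
  by apply: eq_bigr => a _; rewrite mxE.
rewrite (bigID (fun f : {ffun 'I_t -> 'I_d} => injectiveb f)) /=.
rewrite [X in _ = _ + X]big1 ?addr0; last by move=> f /G0 ->; rewrite mulr0.
transitivity (\sum_(J in ext_index t d) \sum_(s : 'S_t) P (f0 J s) * G (f0 J s)).
  rewrite [RHS]big_enum_val /=.
  apply: eq_bigr => J _; rewrite !mxE.
  rewrite /determinant big_distrl /=; apply: eq_bigr => s _.
  rewrite Gs mulrA [X in X * _]mulrC; congr (_ * _ * _).
    by apply: eq_bigr => a _; rewrite !mxE ffunE.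
  rewrite /G /determinant.
  apply: eq_bigr => u _; congr (_ * _).
  by apply: eq_bigr => a _; rewrite !mxE ffunE.
rewrite pair_big_dep /=.
pose le := relpre (val : 'I_d -> nat) leq.
pose srt (f : {ffun 'I_t -> 'I_d}) : t.-tuple 'I_d := sort_tuple le [tuple f a | a < t].
have sE (f : {ffun _ -> _}) x : x \in srt f = (x \in codom f) .
  rewrite mem_sort; apply/mapP/codomP => [[a _ ->]|[a ->]]; first by exists a.
  by exists a; rewrite ?mem_enum.
have leT : transitive le by move=> y x z; apply: leq_trans.
have leA : antisymmetric le by move=> x y h; apply/val_inj/anti_leq.
have leto : total le by move=> x y; apply: leq_total.
have srtP (f : {ffun _ -> _}) : injective f -> srt f \in ext_index t d.
  move=> fi; rewrite inE sorted_map.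
  rewrite (@eq_sorted _ _ [rel x y : 'I_d | (x != y) && le x y]); last first.
    by move=> x y /=; rewrite ltn_neqAle.
  have : sorted le (srt f) by exact: sort_sorted.
  have : uniq (srt f).
    by rewrite sort_uniq map_inj_uniq ?enum_uniq.
  clear -leT; case: (val (srt f)) => //= x s.
  elim: s x => //= y s IH x /andP[/[!inE] /norP[xy _] us] /andP[xly p].
  by rewrite xy xly IH.
have extU (J : t.-tuple 'I_d) : J \in ext_index t d -> uniq J.
  rewrite inE => /(sorted_uniq ltn_trans ltnn); exact: map_uniq.
have extS (J : t.-tuple 'I_d) : J \in ext_index t d -> sorted le J.
  rewrite inE sorted_map; apply: sub_sorted => x y /=; exact: ltnW.
have f0_inj J s : J \in ext_index t d -> injective (f0 J s).
  move=> JE a b; rewrite !ffunE => /(tuple_uniqP _ (extU _ JE)).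
  exact: perm_inj.
have srt_f0 J s : J \in ext_index t d -> srt (f0 J s) = J.
  move=> JE; apply/val_inj; apply: (sorted_eq leT leA); [exact: sort_sorted|exact: extS|].
  apply: uniq_perm; [by apply/extU/srtP/f0_inj|exact: extU|].
  move=> x; rewrite sE; apply/codomP/tnthP => [[a ->]|[a ->]].
    by exists (s a); rewrite ffunE.
  by exists (s^-1%g a); rewrite ffunE permKV.
pose h (u : t.-tuple 'I_d * 'S_t) := f0 u.1 u.2.
have h_inj u w : u.1 \in ext_index t d -> w.1 \in ext_index t d ->
    h u = h w -> u = w.
  case: u w => [J s] [K r] JE KE E.
  have JK : J = K by rewrite -(srt_f0 J s JE) -(srt_f0 K r KE); congr srt.
  subst K; congr pair; apply/permP => a.
  move/ffunP/(_ a): E; rewrite !ffunE /=.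
  exact: (tuple_uniqP _ (extU _ JE)).
have h_surj (f : {ffun 'I_t -> 'I_d}) : injective f ->
    exists2 u, u.1 \in ext_index t d & h u = f.
  move=> fi.
  have iE a : (index (f a) (srt f) < t)%N.
    by rewrite -[X in (_ < X)%N](size_tuple (srt f)) index_mem sE codom_f.
  have gi : injective (fun a => Ordinal (iE a)).
    move=> a b /(congr1 val) /= /(congr1 (nth (f a) (srt f))).
    by rewrite !nth_index ?sE ?codom_f //; apply: fi.
  exists (srt f, perm gi); first exact: srtP.
  apply/ffunP => a; rewrite ffunE permE (tnth_nth (f a)).
  by rewrite nth_index // sE codom_f.
have /choice[hinv hinvP] (f : {ffun 'I_t -> 'I_d}) : exists u,
    injectiveb f -> u.1 \in ext_index t d /\ h u = f.
  case: (injectiveP f) => [/h_surj[u uE uf]|_]; first by exists u.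
  by exists ([tuple f a | a < t], 1%g).
symmetry; rewrite (reindex_onto h hinv) => [|f fi]; last first.
  by case: (hinvP _ fi).
apply: eq_bigl => u; rewrite andbT.
apply/andP/idP => [[ui /eqP <-]|uE].
  by case: (hinvP _ ui).
have ui : injectiveb (h u) by apply/injectiveP/f0_inj.
split=> //; apply/eqP; case: (hinvP _ ui) => vE.
exact: h_inj.
Qed.

Definition typical (R : realType) k d (A : 'I_k -> 'M[R]_d) : Prop :=
  exists p z : Sigma k,
    [/\ periodic p, homoclinic p z &
        forall t : nat, (1 <= t <= d.-1)%N ->
          one_typical (fun i => ext_power t (A i)) p z].

(** * Singular values, level sets and pressure *)

(* sigma_1 >= ... >= sigma_d >= 0 are the square roots of the eigenvalues of
   A^T A, with multiplicity; exactly one row vector has this property. *)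
Definition is_singular_values (R : realType) d (A : 'M[R]_d) (s : 'rV[R]_d) :
    Prop :=
  [/\ forall i, 0 <= s 0 i,
      forall i j : 'I_d, (i <= j)%N -> s 0 j <= s 0 i &
      char_poly (A^T *m A) = \prod_(i < d) ('X - (s 0 i ^+ 2)%:P)].

Definition sigma (R : realType) d (A : 'M[R]_d) (i : 'I_d) : R :=
  xget 0 [set s | is_singular_values A s] 0 i.

Section LevelSets.
Variables (R : realType) (k d : nat) (A : 'I_k -> 'M[R]_d).

Definition level_set (alpha : 'rV[R]_d) : set (Sigma k) :=
  [set x | forall i : 'I_d,
    (n%:R^-1 * ln (sigma (cocycle A n%:Z x) i)) @[n --> \oo] --> alpha 0 i].

Definition spectrum : set 'rV[R]_d := [set alpha | level_set alpha !=set0].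

Definition psi (q : 'rV[R]_d) (M : 'M[R]_d) : R :=
  \prod_(i < d) sigma M i `^ q 0 i.

Definition pressure (q : 'rV[R]_d) : R :=
  limn (fun n : nat =>
    n%:R^-1 * ln (\sum_(I : n.-tuple 'I_k) psi q (word_product A I))).

End LevelSets.

Definition inner (R : realType) d (q alpha : 'rV[R]_d) : R :=
  \sum_(i < d) q 0 i * alpha 0 i.

(** * Bowen's topological entropy of a subset *)

Section Entropy.
Variables (R : realType) (k : nat).
Local Open Scope ereal_scope.

Definition bowen_dist (n : nat) (x y : Sigma k) : R :=
  \big[Num.max/0%R]_(j < n) sdist R (sshift j%:Z x) (sshift j%:Z y).

Definition bowen_ball (n : nat) (x : Sigma k) (eps : R) : set (Sigma k) :=
  [set y | (bowen_dist n x y < eps)%R].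

(* Countable covers, finite or infinite, are indexed by subsets of nat. *)
Definition is_bowen_cover (Y : set (Sigma k)) (N : nat) (eps : R)
    (I : set nat) (n : nat -> nat) (y : nat -> Sigma k) : Prop :=
  (forall i, I i -> (N <= n i)%N) /\
  Y `<=` \bigcup_(i in I) bowen_ball (n i) (y i) eps.

Definition bowen_S_N (Y : set (Sigma k)) (s : R) (N : nat) (eps : R) : \bar R :=
  ereal_inf [set v : \bar R | exists I n y, is_bowen_cover Y N eps I n y /\
     v = \esum_(i in I) (expR (- s * (n i)%:R))%:E].

Definition bowen_S (Y : set (Sigma k)) (s eps : R) : \bar R :=
  limn (fun N => bowen_S_N Y s N eps).

Definition htop_eps (Y : set (Sigma k)) (eps : R) : \bar R :=
  ereal_inf [set s%:E | s in [set s : R | (0 <= s)%R /\ bowen_S Y s eps = 0]].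

Definition htop (Y : set (Sigma k)) : \bar R :=
  lim (htop_eps Y eps @[eps --> (0 : R)^'+]).

End Entropy.

(* Main.v *)
(* Write lam(I) for the vector of the log sigma_i(A_I).  Typicality makes lam
   quasi-additive: finitely many bridge words K suffice for
   |lam(u K v) - lam u - lam v| <= C to hold for all u, v with a suitable K.
   Indeed, the bridges follow p, make the homoclinic excursion z and return to
   p; in the eigenbasis of the period matrix the loop has nonzero entries in
   every exterior power, so between given orthogonal matrices a long enough
   bridge has nonzero top minors, and compactness of the orthogonal group makes
   finitely many bridges and one lower bound enough.  A singular value
   decomposition of the outer factors turns this into quasi-additivity of the
   log (sigma_1 ... sigma_t).

   The remaining argument uses quasi-additivity only.  The bound from above is the usual
   covering by the prefixes I with lam(I) close to n alpha, weighted by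
   exp <q, lam(I)>.  From below, alpha is interior to the spectrum, so for large
   n the sum of the exp <q, lam(I) - n alpha> over words of length n has a
   minimiser q in a fixed ball.  There the weights have mean zero, and by
   Chebyshev's inequality most of the mass of a long concatenation of bridged
   words has growth close to alpha; hence there are exp(n (h - eps)) words of
   length n with |lam(I) - n alpha| <= eps n, where h is the infimum on the
   right hand side.  Concatenating such words of slowly growing lengths gives a
   tree of points of E(alpha) whose branching forces entropy h. *)

Require Import Defs.
From mathcomp Require Import all_boot all_order all_fingroup all_algebra.
From mathcomp Require Import all_classical all_reals all_analysis.
From mathcomp Require Import complex ring lra zify.
Set Implicit Arguments.
Unset Strict Implicit.
Unset Printing Implicit Defensive.
Import Order.TTheory GRing.Theory Num.Theory.
Import numFieldNormedType.Exports.
Local Open Scope classical_set_scope.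
Local Open Scope ring_scope.

(** * Superadditive sequences *)

(** No invariant measure and no derivative of the pressure enters. The pressure is only a limit, and
    its minimiser in q need not come with a usable gradient; the tilt is therefore taken at finite
    n, where the sum over words is an explicit finite sum and minimality gives mean zero exactly.
    Interiority of alpha keeps these minimisers in a ball of radius Q independent of n, so that a
    total deviation eta n costs a factor of at most exp(d Q eta n) in the weight.

    A bridge depends on both of its neighbours, so gluing words is not injective. Padding to a
    common added length and recording which bridge was used limit the loss to a factor r per block,
    which is negligible once the blocks are long; the same factor appears in the
    supermultiplicativity of the sums, in the counting and in the tree.

    Typicality concerns the exterior powers 1, ..., d - 1; in degree d the determinant gives exact
    additivity. *)

Section Fekete.
Variable R : realType.

Lemma superadd_mul (b : nat -> R) (n q : nat) :
  (forall m n, b m + b n <= b (m + n)%N) ->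
  forall r, q%:R * b n + b r <= b (q * n + r)%N.
Proof.
move=> bD r; elim: q => [|q IH]; first by rewrite mul0r add0r mul0n add0n.
have h := bD n (q * n + r)%N.
rewrite mulSn -addnA; apply: le_trans h.
rewrite -natr1; lra.
Qed.

(** Subtracting [c] makes [a] superadditive, so the averages converge to their supremum; the linear
    bound keeps it finite, and the shift by [c] disappears after division by n. *)
Lemma fekete (a : nat -> R) (c B : R) :
  (forall m n, a m + a n <= a (m + n)%N + c) ->
  (forall n, a n <= B * n.+1%:R) ->
  cvgn (fun n : nat => n%:R^-1 * a n).
Proof.
move=> aD aB.
pose b n := a n - c.
have bD m n : b m + b n <= b (m + n)%N by have := aD m n; rewrite /b; lra.
pose S := [set x | exists2 n : nat, (0 < n)%N & x = n%:R^-1 * b n].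
have ubS : ubound S (`|B| * 2 + `|c|).
  move=> _ [n n0 ->].
  have n0' : 0 < n%:R :> R by rewrite ltr0n.
  rewrite mulrC ler_pdivrMr// /b.
  have h := aB n.
  have n1 : 1 <= n%:R :> R by rewrite ler1n.
  have h2 : B * n.+1%:R <= `|B| * 2 * n%:R.
    apply: le_trans (_ : `|B| * n.+1%:R <= _); first by rewrite ler_wpM2r ?ler_norm.
    by rewrite -mulrA ler_wpM2l// -natr1; lra.
  have h3 : - c <= `|c| * n%:R.
    apply: le_trans (_ : `|c| * 1 <= _).
      by rewrite mulr1 -normrN ler_norm.
    by apply: ler_wpM2l.
  by rewrite mulrDl; lra.
have S0 : S !=set0 by exists (1%:R^-1 * b 1%N), 1%N.
have hS : has_sup S by split=> //; exists (`|B| * 2 + `|c|).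
set s := sup S.
suff: (fun n : nat => n%:R^-1 * a n) @ \oo --> s by apply: cvgP.
apply/cvgrPdist_le => e e0.
have e2 : 0 < e / 2 by lra.
have [_ [n n0 ->] hn] : exists2 x, S x & s - e / 2 < x by apply: sup_adherent.
have n0' : 0 < n%:R :> R by rewrite ltr0n.
have {}hn : (s - e / 2) * n%:R <= b n.
  by apply: ltW; rewrite -ltr_pdivlMr// [ltRHS]mulrC.
pose m := \big[Num.max/0]_(r < n) `|b r|.
have hm (r : nat) : (r < n)%N -> - m <= b r.
  move=> rn; rewrite lerNl.
  apply: le_trans (le_bigmax 0 (fun r : 'I_n => `|b r|) (Ordinal rn)).
  by rewrite /= -normrN ler_norm.
have m0 : 0 <= m by exact: bigmax_ge_id.
(* [T] collects the errors that do not grow with [N]: the incomplete block of length below [n], and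
   [c]. *)
pose T := `|s| * n%:R + m + `|c| + e / 2 * n%:R.
have T0 : 0 <= T.
  have h1 : 0 <= e / 2 * n%:R by rewrite mulr_ge0// ltW.
  have h2 : 0 <= `|s| * n%:R by rewrite mulr_ge0.
  by have := normr_ge0 c; rewrite /T; lra.
near=> N.
have N0 : (0 < N)%N by near: N; exists 1%N.
have N0' : 0 < N%:R :> R by rewrite ltr0n.
have hT : T <= e / 2 * N%:R.
  rewrite mulrC -ler_pdivrMr//; near: N; exact: nbhs_infty_ger.
have up : N%:R^-1 * b N <= s by apply: ub_le_sup; [exact: hS.2|exists N].
have up' : b N <= s * N%:R by rewrite -ler_pdivrMr// mulrC.
have lo := superadd_mul n (N %/ n) bD (N %% n).
rewrite -divn_eq in lo.
have lor := hm _ (ltn_pmod N n0).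
have lo2 : (N %/ n)%:R * ((s - e / 2) * n%:R) <= (N %/ n)%:R * b n.
  by apply: ler_wpM2l.
set Q : R := (N %/ n)%:R in lo lo2.
have NE : N%:R = Q * n%:R + (N %% n)%:R :> R.
  by rewrite /Q -natrM -natrD -divn_eq.
have r1 : (N %% n)%:R <= n%:R :> R by rewrite ler_nat ltnW// ltn_pmod.
have r0 : 0 <= (N %% n)%:R :> R by [].
have cc : - `|c| <= c <= `|c| by rewrite -ler_norml.
have ss : (N %% n)%:R * s <= n%:R * `|s|.
  apply: le_trans (ler_norm _) _; rewrite normrM; apply: ler_pM => //.
  by rewrite ger0_norm.
have ee : 0 <= (N %% n)%:R * (e / 2) by rewrite mulr_ge0// ltW.
rewrite distrC mulrC.
have -> : a N / N%:R - s = (a N - s * N%:R) / N%:R.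
  by rewrite mulrBl mulfK// gt_eqF.
rewrite normrM normfV (ger0_norm (ltW N0')) ler_pdivrMr// ler_norml.
move: cc => /andP[c1 c2].
have en : 0 <= e * n%:R by rewrite mulr_ge0// ltW.
have sn : 0 <= `|s| * n%:R by rewrite mulr_ge0.
apply/andP; split.
  rewrite {1}/b in lo; rewrite /T in hT.
  have : Q * ((s - e / 2) * n%:R) =
      s * N%:R - e/2 * N%:R - (N %% n)%:R * s + (N %% n)%:R * (e/2).
    by rewrite NE; ring.
  move: hT lo lo2 lor ss ee; rewrite /b; lra.
move: up' hT; rewrite /b /T; lra.
Unshelve. all: by end_near.
Qed.
End Fekete.

(** * Quasi-additive functions of words *)

Section MatrixNorm.
Variable R : realType.

Lemma entry_le_norm m n (M : 'M[R]_(m, n)) i j : `|M i j| <= `|M|.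
Proof.
rewrite [leRHS]/Num.norm/= mx_normrE.
exact: (le_bigmax 0 (fun ij : 'I_m * 'I_n => `|M ij.1 ij.2|) (i, j)).
Qed.

Lemma norm_le_entry m n (M : 'M[R]_(m, n)) c :
  0 <= c -> (forall i j, `|M i j| <= c) -> `|M| <= c.
Proof.
move=> c0 h; rewrite [leLHS]/Num.norm/= mx_normrE.
by apply/bigmax_le => //= -[i j] _; exact: h.
Qed.

Variable d : nat.
Implicit Types q u v : 'rV[R]_d.

Lemma innerDr q u v : inner q (u + v) = inner q u + inner q v.
Proof. by rewrite /inner -big_split/=; apply: eq_bigr => i _; rewrite mxE mulrDr. Qed.

Lemma innerDl q u v : inner (q + u) v = inner q v + inner u v.
Proof. by rewrite /inner -big_split/=; apply: eq_bigr => i _; rewrite mxE mulrDl. Qed.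

Lemma innerZr q c u : inner q (c *: u) = c * inner q u.
Proof. by rewrite /inner mulr_sumr; apply: eq_bigr => i _; rewrite mxE mulrCA. Qed.

Lemma innerZl q c u : inner (c *: q) u = c * inner q u.
Proof. by rewrite /inner mulr_sumr; apply: eq_bigr => i _; rewrite mxE mulrA. Qed.

Lemma innerBr q u v : inner q (u - v) = inner q u - inner q v.
Proof. by rewrite innerDr -scaleN1r innerZr mulN1r. Qed.

Lemma innerBl q u v : inner (q - u) v = inner q v - inner u v.
Proof. by rewrite innerDl -scaleN1r innerZl mulN1r. Qed.

Lemma inner0l v : inner 0 v = 0.
Proof. by rewrite -(scale0r 0) innerZl mul0r. Qed.

Lemma inner0r v : inner v 0 = 0.
Proof. by rewrite -(scale0r 0) innerZr mul0r. Qed.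

Lemma inner_norm q v : `|inner q v| <= d%:R * `|q| * `|v|.
Proof.
apply: le_trans (ler_norm_sum _ _ _) _.
rewrite -mulrA mulr_natl -[X in _ *+ X]card_ord -sumr_const.
by apply: ler_sum => i _; rewrite normrM ler_pM// entry_le_norm.
Qed.

Lemma inner_le q v c : `|v| <= c -> inner q v <= d%:R * `|q| * c.
Proof.
move=> h; apply: le_trans (ler_norm _) _.
by apply: le_trans (inner_norm _ _) _; rewrite ler_wpM2l ?mulr_ge0.
Qed.

End MatrixNorm.

Lemma big_rcons_tuple (V : nmodType) (S : finType) n (f : seq S -> V) :
  \sum_(I : n.+1.-tuple S) f I = \sum_(I : n.-tuple S) \sum_(a : S) f (rcons I a).
Proof.
rewrite pair_big/=.
pose h (Ia : n.-tuple S * S) : n.+1.-tuple S := [tuple of rcons Ia.1 Ia.2].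
rewrite (reindex h)//=.
pose g (J : n.+1.-tuple S) : n.-tuple S * S :=
  ([tuple of belast (thead J) (behead J)], last (thead J) (behead J)).
exists g => [[I a] _|J _].
  rewrite /g /h; congr pair.
    apply: val_inj => /=; case: I => -[|b s] i //=.
    by rewrite /thead (tnth_nth a)/= belast_rcons.
  rewrite /thead (tnth_nth a)/=; case: (tval I) => //= b s.
  by rewrite last_rcons.
apply: val_inj => /=; rewrite -lastI.
by case: J => -[|b s] i //=; rewrite /thead (tnth_nth b).
Qed.

Section WordSums.
Variables (R : realType) (k : nat).

(** On a fibre of [key] the map [h] is injective into the words of length [N], so each fibre
    contributes at most the full sum on the right. *)
Lemma sum_words_le (S X : finType) (h : S -> seq 'I_k) (key : S -> X) N
    (f : seq 'I_k -> R) :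
  (forall w, 0 <= f w) -> (forall a, size (h a) = N) ->
  (forall a b, key a = key b -> h a = h b -> a = b) ->
  \sum_a f (h a) <= #|X|%:R * \sum_(I : N.-tuple 'I_k) f I.
Proof.
move=> f0 hN inj.
have hN' a : size (h a) == N by rewrite hN.
pose h' a : N.-tuple 'I_k := Tuple (hN' a).
rewrite (partition_big key predT)//= mulr_natl -sumr_const.
apply: ler_sum => x _.
rewrite (eq_bigr (fun a => f (h' a)))//.
have -> : \sum_(i | key i == x) f (h' i) = \sum_(i in [set a | key a == x]%SET) f (h' i).
  by apply: eq_bigl => a; rewrite inE.
have -> : \sum_(i in [set a | key a == x]%SET) f (h' i) =
    \sum_(I in [set h' a | a in [set a | key a == x]%SET]%SET) f I.
  rewrite big_imset//= => a b; rewrite !inE => /eqP ka /eqP kb /(congr1 val) /= hab.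
  by apply: inj => //; rewrite ka kb.
by rewrite [leRHS](bigID (mem [set h' a | a in [set a | key a == x]%SET]%SET))/=
  lerDl sumr_ge0.
Qed.

End WordSums.

Section QuasiAdditive.
Variables (R : realType) (k d : nat) (lam : seq 'I_k -> 'rV[R]_d).

(* [ext u v] models u, followed by a bridge word, followed by v and a padding
   that makes the added length [L] constant; [key u v] is the index of the
   bridge, so [ext u] is injective on words of one length up to [r] choices. *)
Record quasi_additive (C : R) (L r : nat)
    (ext : seq 'I_k -> seq 'I_k -> seq 'I_k)
    (key : seq 'I_k -> seq 'I_k -> 'I_r) : Prop := QuasiAdditive {
  qa_nil : `|lam [::]| <= C;
  qa_rcons : forall w a, `|lam (rcons w a) - lam w| <= C;
  qa_ext : forall u v, `|lam (ext u v) - lam u - lam v| <= C;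
  qa_size : forall u v, size (ext u v) = (size u + size v + L)%N;
  qa_take : forall u v, take (size u) (ext u v) = u;
  qa_inj : forall u v v', size v = size v' -> key u v = key u v' ->
    ext u v = ext u v' -> v = v' }.

Section Rcons.
Variable C : R.
Hypothesis lam_nil : `|lam [::]| <= C.
Hypothesis lam_rcons : forall w a, `|lam (rcons w a) - lam w| <= C.

Lemma lam_cat u v : `|lam (u ++ v) - lam u| <= C * (size v)%:R.
Proof using lam_rcons.
elim/last_ind: v => [|v a IH]; first by rewrite cats0 subrr normr0 mulr0.
rewrite -rcons_cat size_rcons -natr1 mulrDr mulr1.
have -> : lam (rcons (u ++ v) a) - lam u =
  (lam (u ++ v) - lam u) + (lam (rcons (u ++ v) a) - lam (u ++ v)).
  by rewrite [RHS]addrC subrKA.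
by apply: le_trans (ler_normD _ _) _; exact: lerD.
Qed.

Lemma lam_size u : `|lam u| <= C * (size u).+1%:R.
Proof using lam_rcons lam_nil.
have := lam_cat [::] u; rewrite cat0s => h.
rewrite -(subrK (lam [::]) (lam u)) -natr1 mulrDr mulr1.
by apply: le_trans (ler_normD _ _) _; exact: lerD.
Qed.

End Rcons.

(** Copies of [a0] bring all bridges to the length of the longest one, at a bounded cost in [lam].
    Two extensions with the same bridge index share bridge and padding, which then cancel. *)
Lemma bridges_quasi_additive (C : R) (r : nat) (K : 'I_r -> seq 'I_k)
    (a0 : 'I_k) :
  `|lam [::]| <= C -> (forall w a, `|lam (rcons w a) - lam w| <= C) ->
  (forall u v, exists i, `|lam (u ++ K i ++ v) - lam u - lam v| <= C) ->
  exists C' L ext (key : seq 'I_k -> seq 'I_k -> 'I_r),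
    quasi_additive C' L ext key.
Proof.
move=> C1 C2 C3.
have C0 : 0 <= C by apply: le_trans C1.
have /boolp.choice[key keyP] : forall uv : seq 'I_k * seq 'I_k, exists i,
    `|lam (uv.1 ++ K i ++ uv.2) - lam uv.1 - lam uv.2| <= C.
  by move=> -[u v]; exact: C3.
pose L := \max_i size (K i).
pose ext u v := (u ++ K (key (u, v)) ++ v) ++ nseq (L - size (K (key (u, v)))) a0.
exists (C + C * L%:R), L, ext, (fun u v => key (u, v)).
have CL : C <= C + C * L%:R by rewrite lerDl mulr_ge0.
split.
- by apply: le_trans CL.
- by move=> w a; apply: le_trans CL.
- move=> u v; set w := u ++ K (key (u, v)) ++ v.
  have -> : lam (ext u v) - lam u - lam v =
     (lam w - lam u - lam v) + (lam (ext u v) - lam w).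
    rewrite [RHS]addrC addrA; congr (_ - _); rewrite addrA; congr (_ - _).
    by rewrite subrK.
  apply: le_trans (ler_normD _ _) _; apply: lerD; first exact: (keyP (u, v)).
  apply: le_trans (lam_cat C2 _ _) _.
  by rewrite size_nseq ler_wpM2l// ler_nat leq_subr.
- move=> u v; rewrite /ext !size_cat size_nseq.
  have : (size (K (key (u, v))) <= L)%N by exact: leq_bigmax.
  lia.
- by move=> u v; rewrite /ext -catA take_size_cat.
- move=> u v v' sv ke /eqP; rewrite /ext ke !eqseq_cat ?size_cat ?sv//.
  by case/andP => /andP[_ /andP[_ /eqP]].
Qed.

Definition Zsum (q : 'rV[R]_d) n :=
  \sum_(I : n.-tuple 'I_k) expR (inner q (lam I)).

Section Pressure.
Variables (C : R) (L r : nat) (ext : seq 'I_k -> seq 'I_k -> seq 'I_k)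
  (key : seq 'I_k -> seq 'I_k -> 'I_r).
Hypothesis qa : quasi_additive C L ext key.
Variable a0 : 'I_k.

Lemma qa_ge0 : 0 <= C.
Proof using qa. by apply: le_trans (qa_nil qa). Qed.

Lemma Zsum_gt0 q n : 0 < Zsum q n.
Proof using a0.
rewrite /Zsum (bigD1 (nseq_tuple n a0))//= ltr_pwDl ?expR_gt0//.
by rewrite sumr_ge0// => i _; exact: expR_ge0.
Qed.

Lemma Zsum_rcons q n :
  Zsum q n.+1 <= k%:R * expR (d%:R * `|q| * C) * Zsum q n.
Proof using qa.
rewrite /Zsum (big_rcons_tuple _ (fun w => expR (inner q (lam w)))) mulr_sumr.
apply: ler_sum => I _.
rewrite -mulrA mulr_natl -[X in _ *+ X]card_ord -sumr_const.
apply: ler_sum => a _; rewrite -expRD ler_expR.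
have := inner_le q (qa_rcons qa I a); rewrite innerBr; lra.
Qed.

Lemma Zsum_addL q n m :
  Zsum q (n + m) <= (k%:R * expR (d%:R * `|q| * C)) ^+ m * Zsum q n.
Proof using qa.
elim: m => [|m IH]; first by rewrite addn0 expr0 mul1r.
rewrite addnS exprS -mulrA; apply: le_trans (Zsum_rcons _ _) _.
by rewrite ler_wpM2l// mulr_ge0// expR_ge0.
Qed.

(** Gluing by [ext] is at most [r]-to-one, by [qa_take] and [qa_inj], and it changes the exponent by
    a bounded amount. *)
Lemma Zsum_mul q n m :
  Zsum q n * Zsum q m <= expR (d%:R * `|q| * C) * r%:R * Zsum q (n + m + L).
Proof using qa.
rewrite /Zsum mulr_suml.
under eq_bigr do rewrite mulr_sumr.
rewrite pair_big/=.
apply: (@le_trans _ _ (\sum_(p : n.-tuple 'I_k * m.-tuple 'I_k)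
    expR (d%:R * `|q| * C) * expR (inner q (lam (ext p.1 p.2))))).
  apply: ler_sum => -[I J] _; rewrite /= -!expRD ler_expR.
  have := qa_ext qa I J; rewrite -normrN => /(inner_le q).
  rewrite -scaleN1r innerZr !innerBr; lra.
rewrite -mulr_sumr -[leRHS]mulrA ler_wpM2l ?expR_ge0//.
have := @sum_words_le R k (n.-tuple 'I_k * m.-tuple 'I_k)%type 'I_r
  (fun p => ext p.1 p.2) (fun p => key p.1 p.2) (n + m + L)%N
  (fun w => expR (inner q (lam w))).
rewrite card_ord => H.
apply: H => [w||]; first exact: expR_ge0.
  by move=> -[I J]; rewrite (qa_size qa) !size_tuple.
move=> [I J] [I' J'] /= ke ee.
have II : I = I'.
  apply: val_inj => /=; rewrite -(qa_take qa I J) -(qa_take qa I' J').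
  by rewrite ee !size_tuple.
subst I'; congr pair; apply: val_inj.
by apply: (qa_inj qa _ ke ee); rewrite !size_tuple.
Qed.

Lemma key_ord : (0 < r)%N.
Proof using key. exact: leq_ltn_trans (leq0n _) (ltn_ord (key [::] [::])). Qed.

Lemma Zsum_supermul q :
  exists c, forall n m, ln (Zsum q n) + ln (Zsum q m) <= ln (Zsum q (n + m)) + c.
Proof using qa a0.
(* The last factor pays for removing the [L] added letters through [Zsum_addL]. *)
pose M := expR (d%:R * `|q| * C) * r%:R * (k%:R * expR (d%:R * `|q| * C)) ^+ L.
have k0 : 0 < k%:R :> R by rewrite ltr0n; exact: leq_ltn_trans (leq0n _) (ltn_ord a0).
have M0 : 0 < M.
  rewrite /M mulr_gt0 ?exprn_gt0 ?mulr_gt0 ?expR_gt0// ltr0n.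
  exact: key_ord.
exists (ln M) => n m.
have ZP j := Zsum_gt0 q j.
have ZZ : 0 < Zsum q n * Zsum q m by exact: mulr_gt0.
have ZM : 0 < Zsum q (n + m) * M by exact: mulr_gt0.
rewrite -lnM ?posrE// -lnM ?posrE// ler_ln ?posrE//.
apply: le_trans (Zsum_mul _ _ _) _.
rewrite [leRHS]mulrC /M -[leRHS]mulrA; apply: ler_wpM2l.
  by rewrite mulr_ge0// expR_ge0.
exact: Zsum_addL.
Qed.

Lemma Zsum_ge q n w : size w = n -> expR (inner q (lam w)) <= Zsum q n.
Proof using Type.
move=> sw; rewrite /Zsum (bigD1 (Tuple (introT eqP sw)))//= lerDl.
by rewrite sumr_ge0// => i _; exact: expR_ge0.
Qed.

Definition press q := limn (fun n : nat => n%:R^-1 * ln (Zsum q n)).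

Lemma press_cvg q : (fun n : nat => n%:R^-1 * ln (Zsum q n)) @ \oo --> press q.
Proof using qa a0.
suff: cvgn (fun n : nat => n%:R^-1 * ln (Zsum q n)) by [].
have [c hc] := Zsum_supermul q.
pose M := k%:R * expR (d%:R * `|q| * C).
have k1 : 1 <= k%:R :> R by rewrite ler1n; exact: leq_ltn_trans (leq0n _) (ltn_ord a0).
have M1 : 1 <= M.
  rewrite -[1]mulr1 ler_pM// -expR0 ler_expR !mulr_ge0//; exact: qa_ge0.
have M0 : 0 < M by exact: lt_le_trans M1.
apply: (@fekete _ _ c (ln M + `|ln (Zsum q 0)|)) => // n.
have := Zsum_addL q 0 n; rewrite add0n -/M => h.
apply: (@le_trans _ _ (ln (M ^+ n * Zsum q 0))).
  by rewrite ler_ln ?posrE ?mulr_gt0 ?exprn_gt0 ?Zsum_gt0.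
rewrite lnM ?posrE ?exprn_gt0 ?Zsum_gt0// lnXn// -[X in X + _]mulr_natr mulrDl.
apply: lerD; first by rewrite ler_wpM2l ?ln_ge0// ler_nat.
apply: le_trans (ler_norm _) _.
by rewrite -[leLHS]mulr1 ler_wpM2l// ler1n.
Qed.

End Pressure.
End QuasiAdditive.

(** * Exponential tilting *)

Section Tilt.
Variable R : realType.

(** From [1 - y <= expR (- y)] the exponential is at most 1/(1 - y), and (1 - y)(1 + y + 2y^2) = 1 +
    y^2 (1 - 2y). *)
Lemma expR_le_quadratic (y : R) : y <= 1 / 2 -> expR y <= 1 + y + 2 * y ^+ 2.
Proof.
move=> y2.
have h : 0 < 1 - y by lra.
have h1 : expR y <= (1 - y)^-1.
  rewrite -[expR y]invrK lef_pV2 ?posrE ?invr_gt0 ?expR_gt0//.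
  by rewrite -expRN; exact: expR_ge1Dx.
apply: le_trans h1 _; rewrite -[leLHS]mul1r ler_pdivrMr//.
have : 0 <= y ^+ 2 * (1 - 2 * y) by rewrite mulr_ge0 ?sqr_ge0//; lra.
rewrite !expr2; nra.
Qed.

Variable d : nat.

Lemma inner_continuous (v : 'rV[R]_d) : continuous (fun q : 'rV[R]_d => inner q v).
Proof.
rewrite /inner.
apply: continuous_big => [|i _ q]; first exact: add_continuous.
apply: (@cvgM _ _ _ _ (fun x : 'rV[R]_d => x 0 i) (fun=> v 0 i)).
- exact: nbhs_filter.
- exact: coord_continuous.
- exact: (@cst_continuous 'rV[R]_d R (v 0 i) q).
Qed.

Lemma closed_ball_compact (Q : R) : compact [set q : 'rV[R]_d | `|q| <= Q].
Proof.
apply: bounded_closed_compact.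
  by exists Q; split=> [|x Qx q /= /le_trans]; [exact: num_real|apply; exact: ltW].
rewrite (_ : mkset _ = (fun q : 'rV[R]_d => `|q|) @^-1` [set x | x <= Q]); last by [].
apply: preimage_closed; last exact: closed_le.
by move=> q _; exact: norm_continuous.
Qed.

(** The sum [g] is at least exp(rho |q|) and equals the cardinality of [S] at 0, which confines a
    minimiser. The mean-zero identity is the first-order condition there, obtained from a quadratic
    upper bound in place of a derivative. *)
Lemma tilt (S : finType) (X : S -> 'rV[R]_d) (rho : R) :
  0 < rho -> (forall q, exists a, rho * `|q| <= inner q (X a)) ->
  exists q, rho * `|q| <= ln #|S|%:R /\
    forall i, \sum_a expR (inner q (X a)) * X a 0 i = 0.
Proof.
move=> rho0 coer.
pose g q := \sum_a expR (inner q (X a)).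
have gge q a : expR (inner q (X a)) <= g q.
  by rewrite /g (bigD1 a)//= lerDl sumr_ge0// => b _; exact: expR_ge0.
have gpos q : 0 < g q.
  by have [a _] := coer q; apply: lt_le_trans (gge q a); exact: expR_gt0.
have g0E : g 0 = #|S|%:R.
  rewrite /g (eq_bigr (fun=> 1)) ?sumr_const// => a _.
  by rewrite inner0l expR0.
have gcoer q : rho * `|q| <= ln (g q).
  have [a ha] := coer q; apply: le_trans ha _.
  by rewrite -ler_expR lnK ?posrE.
have lnS : 0 <= ln #|S|%:R :> R by rewrite -g0E; apply: le_trans (gcoer 0); rewrite normr0 mulr0.
(* The extra 1 leaves room for perturbing the minimiser inside the ball on which it is minimal. *)
pose Q := ln #|S|%:R / rho + 1.
have Q0 : 0 <= Q by rewrite /Q addr_ge0// divr_ge0// ltW.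
have gc : {within [set q : 'rV[R]_d | `|q| <= Q], continuous g}.
  apply: continuous_subspaceT; rewrite /g.
  apply: continuous_big => [|a _ q]; first exact: add_continuous.
  apply: (@continuous_comp _ _ _ (fun q => inner q (X a)) (@expR R)).
    exact: inner_continuous.
  exact: continuous_expR.
have [|c cQ cmin] := compact_EVT_min _ (@closed_ball_compact Q) gc.
  by exists 0; rewrite /= normr0.
exists c.
have cS : rho * `|c| <= ln #|S|%:R.
  apply: le_trans (gcoer c) _; rewrite -g0E ler_ln ?posrE//.
  by apply: cmin; rewrite inE/= normr0.
split=> // i; set D := (LHS).
pose K := \sum_a expR (inner c (X a)) * (X a 0 i) ^+ 2.
have K0 : 0 <= K by rewrite sumr_ge0// => a _; rewrite mulr_ge0 ?expR_ge0 ?sqr_ge0.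
pose B := \big[Num.max/1]_a `|X a|.
have B1 : 1 <= B by exact: bigmax_ge_id.
have XB a : `|X a 0 i| <= B.
  by apply: le_trans (entry_le_norm _ _ _) _; exact: (le_bigmax _ (fun a => `|X a|) a).
(* The right-hand side bounds the increase of [g] along coordinate [i]; the restriction on [s] keeps
   the exponents in the range of [expR_le_quadratic]. *)
have key s : `|s| <= 1 / (2 * B) -> 0 <= s * D + 2 * s ^+ 2 * K.
  move=> sB.
  have s2 : `|s| <= 1.
    apply: le_trans sB _; rewrite ler_pdivrMr; lra.
  have h : g c <= g (c + s *: delta_mx 0 i).
    apply: cmin; rewrite inE/=.
    apply: le_trans (ler_normD _ _) _; rewrite /Q lerD//.
      by rewrite ler_pdivlMr// mulrC.
    rewrite normrZ -[1]mulr1 ler_pM//.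
    apply: norm_le_entry => // a b; rewrite mxE.
    by case: (_ && _); rewrite ?normr1 ?normr0.
  have inn a : inner (c + s *: delta_mx 0 i) (X a) = inner c (X a) + s * X a 0 i.
    rewrite innerDl innerZl; congr (_ + _ * _).
    rewrite /inner (bigD1 i)//= big1 ?addr0 => [|j ji].
      by rewrite mxE !eqxx mul1r.
    by rewrite mxE eqxx (negbTE ji) mul0r.
  have : g (c + s *: delta_mx 0 i) <= g c + (s * D + 2 * s ^+ 2 * K).
    rewrite /g /D /K !mulr_sumr -!big_split/=; apply: ler_sum => a _.
    rewrite inn expRD.
    have y2 : s * X a 0 i <= 1 / 2.
      apply: le_trans (ler_norm _) _; rewrite normrM.
      apply: (@le_trans _ _ (1 / (2 * B) * B)); first by rewrite ler_pM.
      have : B != 0 by lra.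
      by move=> B0; rewrite le_eqVlt; apply/orP; left; apply/eqP; field.
    apply: le_trans (ler_wpM2l (expR_ge0 _) (expR_le_quadratic y2)) _.
    rewrite le_eqVlt; apply/orP; left; apply/eqP; ring.
  lra.
apply/eqP/contraT => D0.
have D0' : 0 < `|D| by rewrite normr_gt0.
(* A step [t] against the sign of [D] gains t |D|, which by this choice exceeds the quadratic loss 2
   t^2 K. *)
pose t := Num.min (1 / (2 * B)) (`|D| / (2 * (2 * K + 1))).
have t0 : 0 < t by rewrite /t lt_min !divr_gt0//; lra.
have t1 : t <= 1 / (2 * B) by rewrite /t ge_min lexx.
have t2 : t * (2 * (2 * K + 1)) <= `|D|.
  rewrite -ler_pdivlMr; last lra.
  by rewrite /t ge_min lexx orbT.
have sgD : Num.sg D * D = `|D| by rewrite normrEsg.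
have := key (- t * Num.sg D).
rewrite normrM normrN normr_sg D0 mulr1 (ger0_norm (ltW t0)) => /(_ t1).
have -> : - t * Num.sg D * D = - (t * `|D|) by rewrite !mulNr -mulrA sgD.
rewrite exprMn sqr_sg D0 mulr1 sqrrN expr2 => h.
have : t * (2 * (2 * K + 1)) * t <= `|D| * t by rewrite ler_pM2r.
have : 0 < t * t by rewrite mulr_gt0.
have : 0 <= t * t * K by rewrite !mulr_ge0// ltW.
have tD : 0 < t * `|D| by exact: mulr_gt0.
move: h; nra.
Qed.

End Tilt.

Section GrowthSet.
Variables (R : realType) (k d : nat) (lam : seq 'I_k -> 'rV[R]_d).

Definition pref (x : Sigma k) (n : nat) : seq 'I_k := [seq x i%:Z | i <- iota 0 n].

Lemma size_pref x n : size (pref x n) = n.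
Proof. by rewrite size_map size_iota. Qed.

Definition growth_set (alpha : 'rV[R]_d) : set (Sigma k) :=
  [set x | forall e : R, 0 < e -> \forall n \near \oo,
     `|lam (pref x n) - n%:R *: alpha| <= e * n%:R].

Lemma norm1_ge (q : 'rV[R]_d) : `|q| <= \sum_i `|q 0 i|.
Proof.
apply: norm_le_entry => [|i j]; first by rewrite sumr_ge0.
by rewrite (bigD1 j)//= ord1 lerDl sumr_ge0.
Qed.

Lemma inner_norm1 (q v : 'rV[R]_d) : `|inner q v| <= (\sum_i `|q 0 i|) * `|v|.
Proof.
apply: le_trans (ler_norm_sum _ _ _) _; rewrite mulr_suml.
by apply: ler_sum => i _; rewrite normrM ler_wpM2l// entry_le_norm.
Qed.

(* The point growing at the rate [alpha] shifted by [e/2] in the direction of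
   the signs of [q] witnesses the coercivity at [q]. *)
Lemma growth_coercive (alpha : 'rV[R]_d) :
  interior [set beta | growth_set beta !=set0] alpha ->
  exists2 rho : R, 0 < rho & \forall n \near \oo, forall q : 'rV[R]_d,
    exists I : n.-tuple 'I_k, rho * n%:R * `|q| <= inner q (lam I - n%:R *: alpha).
Proof.
move=> /nbhs_ballP[e /= e0 he].
exists (e / 4); first by rewrite divr_gt0.
pose sv (s : {ffun 'I_d -> bool}) : 'rV[R]_d := \row_i (-1) ^+ s i.
pose beta s := alpha + (e / 2) *: sv s.
have /boolp.choice[x xP] : forall s, exists x, growth_set (beta s) x.
  move=> s; apply: he; rewrite -ball_normE/= /beta opprD addNKr normrN normrZ.
  rewrite ger0_norm; last by rewrite divr_ge0// ltW.
  apply: (@le_lt_trans _ _ (e / 2 * 1)); last lra.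
  apply: ler_wpM2l; first by rewrite divr_ge0// ltW.
  by apply: norm_le_entry => // i j; rewrite mxE normrX normrN normr1 expr1n.
have e4 : 0 < e / 4 by rewrite divr_gt0.
have near_s : \forall n \near \oo, forall s,
    `|lam (pref (x s) n) - n%:R *: beta s| <= e / 4 * n%:R.
  by apply: filter_forall => s; exact: xP.
apply: filterS near_s => n hs q.
pose s : {ffun 'I_d -> bool} := [ffun i => q 0 i < 0].
have hn : `|lam (pref (x s) n) - n%:R *: beta s| <= e / 4 * n%:R.
  exact: hs.
exists (Tuple (introT eqP (size_pref (x s) n))); rewrite [tval _]/=.
have sq : inner q (sv s) = \sum_i `|q 0 i|.
  rewrite /inner; apply: eq_bigr => i _; rewrite mxE ffunE.
  by case: ltrP => qi; rewrite ?expr1 ?expr0 ?mulr1 ?mulrN1;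
    [rewrite ltr0_norm | rewrite ger0_norm].
have -> : lam (pref (x s) n) - n%:R *: alpha =
    (lam (pref (x s) n) - n%:R *: beta s) + (n%:R * (e / 2)) *: sv s.
  by rewrite /beta scalerDr scalerA opprD addrA subrK.
rewrite innerDr innerZr sq.
have h1 := norm1_ge q; have h2 := inner_norm1 q (lam (pref (x s) n) - n%:R *: beta s).
set T := \sum_i _ in h1 h2 *.
have T0 : 0 <= T by apply: le_trans h1.
have h3 : T * `|lam (pref (x s) n) - n%:R *: beta s| <= T * (e / 4 * n%:R).
  exact: ler_wpM2l.
have h4 : e / 4 * n%:R * `|q| <= e / 4 * n%:R * T.
  by rewrite ler_wpM2l// mulr_ge0// ltW.
move: h2; rewrite ler_norml => /andP[h2 _].
lra.
Qed.

Variables (C : R) (L r : nat) (ext : seq 'I_k -> seq 'I_k -> seq 'I_k)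
  (key : seq 'I_k -> seq 'I_k -> 'I_r).
Hypothesis qa : quasi_additive lam C L ext key.
Variable a0 : 'I_k.

(** After division by n this is a Lipschitz bound in q uniform in n, since |lam I| <= C (n + 1). *)
Lemma Zsum_lipschitz q q' n :
  ln (Zsum lam q' n) <= ln (Zsum lam q n) + d%:R * `|q' - q| * (C * n.+1%:R).
Proof using qa a0.
rewrite -[X in _ + X]expRK -lnM ?posrE ?expR_gt0 ?Zsum_gt0//.
rewrite ler_ln ?posrE ?mulr_gt0 ?expR_gt0 ?Zsum_gt0//.
rewrite /Zsum mulr_suml; apply: ler_sum => I _; rewrite -expRD ler_expR.
have := @lam_size _ _ _ _ _ (qa_nil qa) (qa_rcons qa) I; rewrite size_tuple.
move=> /(inner_le (q' - q)); rewrite innerBl; lra.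
Qed.

(** There are k^n words and the coercivity constant is rho n, so the minimisers stay in the ball of
    radius ln k / rho. The pressure converges only pointwise in q; the lower bound is therefore read
    off at a cluster point of the minimisers and carried to a nearby minimiser by the uniform
    Lipschitz bound. *)
Lemma tilted_growth (alpha : 'rV[R]_d) (h : R) :
  interior [set beta | growth_set beta !=set0] alpha ->
  (forall q, h <= press lam q - inner q alpha) ->
  exists Q : R, forall e : R, 0 < e -> forall N : nat, exists (n : nat) (q : 'rV[R]_d),
    [/\ (N <= n)%N, `|q| <= Q,
      forall i, \sum_(I : n.-tuple 'I_k) expR (inner q (lam I - n%:R *: alpha)) *
         (lam I - n%:R *: alpha) 0 i = 0 &
      n%:R * (h - e) <= ln (\sum_(I : n.-tuple 'I_k) expR (inner q (lam I - n%:R *: alpha)))].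
Proof using qa a0.
move=> /growth_coercive[rho rho0 [n0 _ n0P]] hP.
pose P n (q : 'rV[R]_d) := [/\ rho * `|q| <= ln k%:R &
   forall i, \sum_(I : n.-tuple 'I_k) expR (inner q (lam I - n%:R *: alpha)) *
         (lam I - n%:R *: alpha) 0 i = 0].
have /boolp.choice[qq qqP] : forall n, exists q, (maxn n0 1 <= n)%N -> P n q.
  move=> n; case: (leqP (maxn n0 1) n) => [|_]; last by exists 0.
  rewrite geq_max => /andP[nn0 n1].
  have nR : 0 < n%:R :> R by rewrite ltr0n.
  have rn : 0 < rho * n%:R by exact: mulr_gt0.
  have [q [q1 q2]] := tilt rn (n0P n nn0).
  exists q => _; split=> //.
  move: q1; rewrite card_tuple card_ord natrX lnXn; last first.
    by rewrite ltr0n; exact: leq_ltn_trans (leq0n _) (ltn_ord a0).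
  by rewrite mulrAC -[X in _ <= X]mulr_natr ler_pM2r.
exists (ln k%:R / rho) => e e0 N.
have [q0 [_ clq]] : ([set q : 'rV[R]_d | `|q| <= ln k%:R / rho] `&` cluster (qq @ \oo)) !=set0.
  apply: closed_ball_compact; exists (maxn n0 1) => // n /= /qqP[qn _].
  by rewrite ler_pdivlMr// mulrC.
(* A Lipschitz constant, per unit of n, for the log-sum and the inner product with [alpha] together;
   [C * 2] covers C (n + 1) / n. *)
pose M := d%:R * (C * 2 + `|alpha|) + 1.
have M0 : 0 < M.
  rewrite /M ltr_pwDr// mulr_ge0// addr_ge0// mulr_ge0//; exact: qa_ge0 qa.
have pc := @press_cvg _ _ _ _ _ _ _ _ _ qa a0 q0.
have e2 : 0 < e / 2 by lra.
move/cvgrPdist_le : pc => /(_ _ e2) [n1 _ n1P].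
pose N' := maxn N (maxn n1 (maxn n0 1)).
have [_ [[n /= nN' <-] qnear]] : ((qq @` [set n | (N' <= n)%N]) `&` ball q0 (e / 2 / M)) !=set0.
  apply: clq; first by exists N' => // n /= nN'; exists n.
  by apply: nbhsx_ballx; rewrite divr_gt0.
move: nN'; rewrite !geq_max => /and4P[nN nn1 nn0 n1'].
have [q1 q2] : P n (qq n) by apply: qqP; rewrite geq_max nn0.
exists n, (qq n); split=> //.
  by rewrite ler_pdivlMr// mulrC.
have -> : \sum_(I : n.-tuple 'I_k) expR (inner (qq n) (lam I - n%:R *: alpha)) =
    Zsum lam (qq n) n * expR (- (n%:R * inner (qq n) alpha)).
  rewrite /Zsum mulr_suml; apply: eq_bigr => I _.
  by rewrite -expRD innerBr innerZr.
rewrite lnM ?posrE ?expR_gt0 ?Zsum_gt0// expRK.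
have nR : 0 < n%:R :> R by rewrite ltr0n.
have n1R : 1 <= n%:R :> R by rewrite ler1n.
have lip := Zsum_lipschitz (qq n) q0 n.
have {}qnear : `|q0 - qq n| * M <= e / 2.
  move: qnear; rewrite -ball_normE/= => /ltW.
  by rewrite ler_pdivlMr.
have := n1P n nn1; rewrite /= ler_norml => /andP[_ hp].
have {}hp : n%:R * (press lam q0 - e / 2) <= ln (Zsum lam q0 n).
  rewrite mulrC -ler_pdivlMr// mulrC; lra.
have hq := hP q0.
have := inner_norm (q0 - qq n) alpha; rewrite innerBl ler_norml => /andP[hi _].
set dq := `|q0 - qq n| in qnear lip hi.
have dq0 : 0 <= dq by exact: normr_ge0.
have hi' : n%:R * - (d%:R * dq * `|alpha|) <= n%:R * (inner q0 alpha - inner (qq n) alpha).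
  by rewrite ler_pM2l.
have hh' : n%:R * h <= n%:R * (press lam q0 - inner q0 alpha) by rewrite ler_pM2l.
have lip' : d%:R * dq * (C * n.+1%:R) <= n%:R * (d%:R * dq * (C * 2)).
  rewrite [leRHS]mulrCA ler_wpM2l ?mulr_ge0// -natr1.
  have C0 := qa_ge0 qa; nra.
have qn' : n%:R * (dq * M) <= n%:R * (e / 2) by rewrite ler_pM2l.
have : n%:R * dq >= 0 by rewrite mulr_ge0// ltW.
move: qn'; rewrite /M; lra.
Qed.

End GrowthSet.

(** * Counting words of prescribed growth *)

Section ProductWeights.
Variables (R : realType) (S : finType).

Variables (w X : S -> R).
Hypothesis w0 : forall a, 0 <= w a.
Let G := \sum_a w a.
Let W (t : seq S) := \prod_(a <- t) w a.
Let T (t : seq S) := \sum_(a <- t) X a.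

Lemma weight_total N : \sum_(t : N.-tuple S) W t = G ^+ N.
Proof using Type.
elim: N => [|N IH].
  rewrite (eq_bigr (fun=> 1)) => [|t _]; last by rewrite tuple0 /W big_nil.
  by rewrite sumr_const card_tuple expn0.
rewrite big_rcons_tuple exprSr -IH mulr_suml; apply: eq_bigr => t _.
by rewrite mulr_sumr; apply: eq_bigr => a _; rewrite /W big_rcons/= mulrC.
Qed.

(** Under product weights the letters are independent and centred: appending a letter produces no
    cross term, so second moments add up. *)
Lemma weight_variance N (B : R) :
  \sum_a w a * X a = 0 -> (forall a, `|X a| <= B) ->
  \sum_(t : N.-tuple S) W t * (T t) ^+ 2 <= N%:R * B ^+ 2 * G ^+ N.
Proof using w0.
move=> wX XB.
have XB2 : \sum_a w a * X a ^+ 2 <= B ^+ 2 * G.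
  rewrite /G mulr_sumr; apply: ler_sum => a _; rewrite mulrC ler_wpM2r//.
  rewrite -real_normK ?num_real// lerXn2r// nnegrE//.
  exact: le_trans (XB a).
elim: N => [|N IH].
  rewrite !mul0r big1// => t _; rewrite tuple0 /T big_nil expr0n mulr0//.
rewrite (big_rcons_tuple _ (fun t => W t * T t ^+ 2)).
have E (t : N.-tuple S) : \sum_a W (rcons t a) * T (rcons t a) ^+ 2 =
    W t * T t ^+ 2 * G + W t * \sum_a w a * X a ^+ 2.
  have Wr a : W (rcons t a) = W t * w a by rewrite /W big_rcons/= mulrC.
  have Tr a : T (rcons t a) = T t + X a by rewrite /T big_rcons/= addrC.
  rewrite (eq_bigr _ (fun a _ => congr2 _ (Wr a) (congr1 (fun x => x ^+ 2) (Tr a)))).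
  move: (W t) (T t) => Wt Tt {Wr Tr}.
  have -> : Wt * Tt ^+ 2 * G + Wt * \sum_a w a * X a ^+ 2 =
     Wt * Tt ^+ 2 * G + Wt * \sum_a w a * X a ^+ 2 + Wt * Tt * 2 * \sum_a w a * X a.
    by rewrite wX mulr0 addr0.
  rewrite /G !mulr_sumr -!big_split/=; apply: eq_bigr => a _.
  by ring.
rewrite (eq_bigr _ (fun t _ => E t)) big_split/= -!mulr_suml weight_total.
have G0 : 0 <= G by rewrite sumr_ge0.
apply: (@le_trans _ _ (N%:R * B ^+ 2 * G ^+ N * G + G ^+ N * (B ^+ 2 * G))).
  by apply: lerD; [rewrite ler_wpM2r|rewrite ler_wpM2l ?exprn_ge0].
have -> : N.+1%:R = N%:R + 1 :> R by rewrite natr1.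
rewrite [G ^+ N.+1]exprSr; move: (G ^+ N) (G) => g G'.
by rewrite le_eqVlt; apply/orP; left; apply/eqP; ring.
Qed.

End ProductWeights.

(** Chebyshev in each coordinate: a sum of norm above [delta] has a coordinate above [delta], and
    each of the [d] coordinates has second moment at most N B^2 times the total mass. The hypothesis
    on [N] makes the bad part at most half. *)
Lemma weight_concentration (R : realType) (S : finType) d (w : S -> R)
    (X : S -> 'rV[R]_d) (B delta : R) N :
  (forall a, 0 <= w a) -> (forall i, \sum_a w a * X a 0 i = 0) ->
  (forall a, `|X a| <= B) -> 0 < delta ->
  d%:R * (N%:R * B ^+ 2) <= delta ^+ 2 / 2 ->
  (\sum_a w a) ^+ N / 2 <=
  \sum_(t : N.-tuple S | `|\sum_(a <- t) X a| <= delta) \prod_(a <- t) w a.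
Proof.
move=> w0 wX XB de0 hN.
have W0 (t : N.-tuple S) : 0 <= \prod_(a <- t) w a by exact: prodr_ge0.
have G0 : 0 <= \sum_a w a by rewrite sumr_ge0.
rewrite -(@weight_total R S w).
rewrite (bigID (fun t : N.-tuple S => `|\sum_(a <- t) X a| <= delta))/=.
suff : \sum_(t : N.-tuple S | ~~ (`|\sum_(a <- t) X a| <= delta)) \prod_(a <- t) w a <=
   (\sum_(t : N.-tuple S) \prod_(a <- t) w a) / 2.
  rewrite [in leRHS](bigID (fun t : N.-tuple S => `|\sum_(a <- t) X a| <= delta))/=; lra.
rewrite weight_total.
have d2 : 0 < delta ^+ 2 by rewrite exprn_gt0.
rewrite -(ler_pM2l d2) mulr_sumr.
apply: (@le_trans _ _ (\sum_(i < d) \sum_(t : N.-tuple S)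
   (\prod_(a <- t) w a) * (\sum_(a <- t) X a 0 i) ^+ 2)).
  rewrite exchange_big/= [leRHS](bigID (fun t : N.-tuple S => `|\sum_(a <- t) X a| <= delta))/=.
  apply: ler_wpDl.
    by apply: sumr_ge0 => t _; apply: sumr_ge0 => i _; rewrite mulr_ge0 ?sqr_ge0.
  apply: ler_sum => t; rewrite -ltNge => ht.
  rewrite -mulr_sumr mulrC ler_wpM2l//.
  have [i hi] : exists i, delta < `|\sum_(a <- t) X a 0 i|.
    apply: contrapT => /forallNP h; move: ht; rewrite ltNge => /negP; apply.
    apply: norm_le_entry => [|i j]; first exact: ltW.
    rewrite ord1 summxE leNgt; apply/negP; exact: h.
  rewrite (bigD1 i)//= -[leLHS]addr0; apply: lerD; last first.
    by apply: sumr_ge0 => j _; exact: sqr_ge0.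
  by rewrite -[leRHS]real_normK ?num_real// lerXn2r// ?nnegrE ltW.
apply: (@le_trans _ _ (\sum_(i < d) (N%:R * B ^+ 2 * (\sum_a w a) ^+ N))).
  apply: ler_sum => i _; apply: (@weight_variance _ _ w (fun a => X a 0 i)) => // a.
  by apply: le_trans (entry_le_norm _ _ _) _.
rewrite sumr_const card_ord -[leLHS]mulr_natl mulrA.
apply: (@le_trans _ _ (delta ^+ 2 / 2 * (\sum_a w a) ^+ N)).
  by rewrite ler_wpM2r ?exprn_ge0.
by rewrite le_eqVlt; apply/orP; left; apply/eqP; ring.
Qed.

Lemma ler_norm4 (R : realType) (V : normedZmodType R) (a b c x : V) :
  `|a + b + c + x| <= `|a| + `|b| + `|c| + `|x|.
Proof.
apply: le_trans (ler_normD _ _) _; rewrite lerD2r.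
apply: le_trans (ler_normD _ _) _; rewrite lerD2r; exact: ler_normD.
Qed.

Lemma card_set_sum (R : pzSemiRingType) (T : finType) (P : pred T) :
  #|[set x | P x]%SET|%:R = \sum_x (P x)%:R :> R.
Proof.
rewrite -sum1_card natr_sum [LHS]big_mkcond/=; apply: eq_bigr => x _.
by rewrite inE; case: (P x).
Qed.

Section Counting.
Variables (R : realType) (k d : nat) (lam : seq 'I_k -> 'rV[R]_d).
Variables (C : R) (L r : nat) (ext : seq 'I_k -> seq 'I_k -> seq 'I_k)
  (key : seq 'I_k -> seq 'I_k -> 'I_r).
Hypothesis qa : quasi_additive lam C L ext key.
Variable a0 : 'I_k.

(** Together with the glued word this list determines the blocks, once their common length is known;
    a word thus comes from at most r^N chains of N blocks. *)
Fixpoint chain_keys (u : seq 'I_k) (t : seq (seq 'I_k)) : seq 'I_r :=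
  if t is v :: t' then key u v :: chain_keys (ext u v) t' else [::].

Lemma size_chain_keys u t : size (chain_keys u t) = size t.
Proof using Type. by elim: t u => //= v t IH u; rewrite IH. Qed.

Lemma size_foldl_ext n u t : all (fun v => size v == n) t ->
  size (foldl ext u t) = (size u + size t * (n + L))%N.
Proof using qa.
elim: t u => [|v t IH] u /=; first by rewrite addn0.
by case/andP => /eqP sv st; rewrite IH// (qa_size qa) sv mulSn !addnA.
Qed.

Lemma take_foldl_ext u t : take (size u) (foldl ext u t) = u.
Proof using qa.
elim: t u => [|v t IH] u /=; first by rewrite take_size.
have h : take (size (ext u v)) (foldl ext (ext u v) t) = ext u v by exact: IH.
rewrite -[in RHS](qa_take qa u v) -[in RHS]h take_takel//.
by rewrite (qa_size qa) -addnA leq_addr.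
Qed.

Lemma foldl_ext_inj n u t t' :
  all (fun v => size v == n) t -> all (fun v => size v == n) t' ->
  size t = size t' -> chain_keys u t = chain_keys u t' ->
  foldl ext u t = foldl ext u t' -> t = t'.
Proof using qa.
elim: t t' u => [|v t IH] [|v' t'] u //= /andP[/eqP sv st] /andP[/eqP sv' st'] [ss] [kk ks] e.
have ee : ext u v = ext u v'.
  rewrite -(take_foldl_ext (ext u v) t) -(take_foldl_ext (ext u v') t') e.
  by rewrite !(qa_size qa) sv sv'.
have vv : v = v' by apply: (qa_inj qa _ kk ee); rewrite sv sv'.
subst v'; congr cons; exact: (IH _ (ext u v)).
Qed.

Lemma lam_foldl_ext u t :
  `|lam (foldl ext u t) - lam u - \sum_(v <- t) lam v| <= C * (size t)%:R.
Proof using qa.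
elim: t u => [|v t IH] u /=; first by rewrite big_nil subrr subr0 normr0 mulr0.
rewrite big_cons -natr1 mulrDr mulr1.
have -> : lam (foldl ext (ext u v) t) - lam u - (lam v + \sum_(j <- t) lam j) =
  (lam (foldl ext (ext u v) t) - lam (ext u v) - \sum_(j <- t) lam j) +
  (lam (ext u v) - lam u - lam v).
  by apply/rowP => i; rewrite !mxE; ring.
apply: le_trans (ler_normD _ _) _.
by apply: lerD; [exact: IH|exact: qa_ext qa _ _].
Qed.

(** Fix one long tilted block length n. Chains of N such blocks have total weight G^N, half of it on
    chains of small total deviation; each of these has weight at most [E], so they are numerous, and
    gluing loses at most r^N. Filling the remainder of m modulo n + L with [a0] gives the bound for
    every large m. *)
Lemma counting (alpha : 'rV[R]_d) (h : R) :
  interior [set beta | growth_set lam beta !=set0] alpha ->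
  0 <= h -> (forall q, h <= press lam q - inner q alpha) ->
  forall e : R, 0 < e -> \forall m \near \oo,
    expR (m%:R * (h - e)) <=
    #|[set I : m.-tuple 'I_k | `|lam I - m%:R *: alpha| <= e * m%:R]%SET|%:R.
Proof using qa a0.
move=> ia h0 hP e e0.
have C0 := qa_ge0 qa.
have [Q QP] := tilted_growth qa a0 ia hP.
have r0 : (0 < r)%N := key_ord key.
have Q0 : 0 <= Q by have [_ [q [_ qQ _ _]]] := QP e e0 0%N; exact: le_trans qQ.
(* From this block length on, e n / 4 absorbs the losses per block: the bridge defect, the [L] added
   letters and the factor [r]. *)
pose M1 := 4 * (C + L%:R * `|alpha| + h * L%:R + ln r%:R) / e + 1.
have lnr : 0 <= ln r%:R :> R by rewrite ln_ge0// ler1n.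
have [n1 n1P] : exists n1 : nat, M1 <= n1%:R.
  by have [n1 _ h1] := nbhs_infty_ger M1; exists n1; apply: h1 => /=.
have e4 : 0 < e / 4 by rewrite divr_gt0.
have [n [q [nn1 qQ qX qG]]] := QP (e / 4) e4 (maxn n1 1).
move: nn1; rewrite geq_max => /andP[nn1 n0].
have nR : 0 < n%:R :> R by rewrite ltr0n.
pose X (I : n.-tuple 'I_k) := lam I - n%:R *: alpha.
pose w I := expR (inner q (X I)).
pose G := \sum_I w I.
have G0 : 0 < G.
  rewrite /G (bigD1 (nseq_tuple n a0))//= ltr_pwDl ?expR_gt0//.
  by rewrite sumr_ge0// => i _; exact: expR_ge0.
have nM : C + L%:R * `|alpha| + h * L%:R + ln r%:R <= e / 4 * n%:R.
  have : M1 <= n%:R by apply: le_trans n1P _; rewrite ler_nat.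
  rewrite /M1 => hh.
  have : 4 * (C + L%:R * `|alpha| + h * L%:R + ln r%:R) / e <= n%:R by lra.
  rewrite ler_pdivrMr//; lra.
pose B := C * n.+1%:R + n%:R * `|alpha|.
have XB I : `|X I| <= B.
  apply: le_trans (ler_normB _ _) _; apply: lerD.
    by have := lam_size (qa_nil qa) (qa_rcons qa) I; rewrite size_tuple.
  by rewrite normrZ ger0_norm.
(* Both the deviation [eta] and its cost d Q eta in the weight exponent must stay below e / 4. *)
pose eta := e / (4 * (d%:R * Q + 1)).
have dQ : 0 <= d%:R * Q by rewrite mulr_ge0.
have eta0 : 0 < eta by rewrite divr_gt0//; lra.
have etaE : eta * (4 * (d%:R * Q + 1)) = e by rewrite /eta divfK//; lra.
have eta4 : eta <= e / 4 by move: etaE; nra.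
have etadQ : d%:R * Q * eta <= e / 4 by move: etaE; nra.
clearbody eta.
(* With this many blocks the variance condition of [weight_concentration] holds for the deviation
   eta n N. *)
pose Nmin := 2 * d%:R * B ^+ 2 / (eta * n%:R) ^+ 2.
(* [Kc] gathers the losses that do not grow with m: the empty starting word, the incomplete last
   block and the half lost to Chebyshev. *)
pose Kc := C + (n + L)%:R * (C + `|alpha| + h) + ln 2.
have ln20 : 0 <= ln 2 :> R by rewrite ln_ge0// ler1n.
have Kc0 : 0 <= Kc.
  by rewrite /Kc !addr_ge0// mulr_ge0// !addr_ge0.
near=> m.
pose N := (m %/ (n + L))%N; pose s := (m %% (n + L))%N.
have nL : (0 < n + L)%N by rewrite addn_gt0 n0.
have mE : m = (N * (n + L) + s)%N by exact: divn_eq.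
have sn : (s <= n + L)%N by rewrite ltnW// ltn_pmod.
have hK : Kc <= e / 4 * m%:R.
  rewrite mulrC -ler_pdivrMr//; near: m; exact: nbhs_infty_ger.
have hNmin : Nmin <= N%:R.
  have : (Nmin + 1) * (n + L)%:R <= m%:R by near: m; exact: nbhs_infty_ger.
  have nLR : 0 < (n + L)%:R :> R by rewrite ltr0n.
  have sR : s%:R <= (n + L)%:R :> R by rewrite ler_nat.
  rewrite mE [(_ + s)%:R]natrD natrM => hh.
  by rewrite -(ler_pM2r nLR); lra.
have mR : m%:R = N%:R * (n%:R + L%:R) + s%:R :> R by rewrite mE natrD natrM natrD.
have sR : s%:R <= n%:R + L%:R :> R by rewrite -natrD ler_nat.
have conc : G ^+ N / 2 <= \sum_(t : N.-tuple (n.-tuple 'I_k) |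
    `|\sum_(a <- t) X a| <= eta * n%:R * N%:R) \prod_(a <- t) w a.
  (* The allowed deviation must be positive in [weight_concentration], so the empty chain is treated
     apart. *)
  case: (posnP N) => [N0|Npos].
    have -> : N = 0%N by [].
    rewrite (eq_bigr (fun=> 1)); last by move=> t _; rewrite tuple0 big_nil.
    rewrite (bigD1 [tuple])/=; last by rewrite big_nil normr0 mulr0.
    rewrite expr0 ler_wpDr//; [exact: sumr_ge0|lra].
  have NR : 0 < N%:R :> R by rewrite ltr0n.
  apply: (@weight_concentration _ _ _ w X B) => //.
  - by move=> a; exact: expR_ge0.
  - by apply: mulr_gt0 => //; apply: mulr_gt0.
  have en : 0 < (eta * n%:R) ^+ 2 by rewrite exprn_gt0// mulr_gt0.
  move: hNmin; rewrite /Nmin ler_pdivrMr// => hNmin.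
  rewrite [(eta * n%:R * N%:R) ^+ 2]exprMn expr2.
  have : N%:R * (2 * d%:R * B ^+ 2) <= N%:R * (N%:R * (eta * n%:R) ^+ 2).
    by rewrite ler_pM2l.
  rewrite [N%:R ^+ 2]expr2; lra.
have prodE (t : seq (n.-tuple 'I_k)) : \prod_(a <- t) w a = expR (inner q (\sum_(a <- t) X a)).
  elim: t => [|a t IH]; first by rewrite !big_nil inner0r expR0.
  by rewrite !big_cons innerDr expRD IH.
pose good (t : N.-tuple (n.-tuple 'I_k)) := `|\sum_(a <- t) X a| <= eta * n%:R * N%:R.
pose E := expR (d%:R * Q * (eta * n%:R * N%:R)).
have cnt : G ^+ N / 2 <= E * \sum_(t : N.-tuple (n.-tuple 'I_k)) (good t)%:R.
  apply: le_trans conc _; rewrite mulr_sumr [leRHS](bigID good)/=.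
  rewrite [X in _ <= _ + X]big1 ?addr0 => [|t /negbTE->]; last by rewrite mulr0.
  apply: ler_sum => t; rewrite -/(good t) => gt; rewrite gt mulr1 prodE ler_expR.
  apply: le_trans (inner_le q gt) _.
  apply: ler_wpM2r; first by rewrite !mulr_ge0// ltW.
  exact: ler_wpM2l.
pose word (t : N.-tuple (n.-tuple 'I_k)) :=
  foldl ext [::] [seq val a | a <- t] ++ nseq s a0.
have alln (t : N.-tuple (n.-tuple 'I_k)) :
    all (fun v => size v == n) [seq val a | a <- t].
  by apply/allP => v /mapP[a _ ->]; rewrite size_tuple.
pose P (v : seq 'I_k) := `|lam v - m%:R *: alpha| <= e * m%:R.
have goodP t : good t -> P (word t).
  move=> gt; rewrite /P /word; set v := foldl _ _ _.
  have sv : size v = (N * (n + L))%N.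
    by rewrite /v (size_foldl_ext _ (alln t))/= size_map size_tuple.
  have h1 := lam_foldl_ext [::] [seq val a | a <- t].
  have h2 := lam_cat (qa_rcons qa) v (nseq s a0).
  rewrite -/v size_map size_tuple in h1; rewrite size_nseq in h2.
  have sX : \sum_(j <- [seq val a | a <- t]) lam j =
      \sum_(a <- t) X a + (N%:R * n%:R) *: alpha.
    rewrite big_map /X sumrB big_const_seq count_predT size_tuple iter_addr_0.
    by rewrite -scaler_nat scalerA subrK.
  rewrite sX in h1.
  have -> : lam (v ++ nseq s a0) - m%:R *: alpha =
     (lam (v ++ nseq s a0) - lam v) +
     (lam v - lam [::] - (\sum_(a <- t) X a + (N%:R * n%:R) *: alpha)) +
     lam [::] + \sum_(a <- t) X a - (N%:R * L%:R + s%:R) *: alpha.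
    apply/rowP => i; rewrite !mxE mR; ring.
  apply: le_trans (ler_normB _ _) _.
  have h3 : `|(N%:R * L%:R + s%:R) *: alpha| = (N%:R * L%:R + s%:R) * `|alpha|.
    by rewrite normrZ ger0_norm// addr_ge0// mulr_ge0.
  have h4 := ler_norm4 (lam (v ++ nseq s a0) - lam v)
     (lam v - lam [::] - (\sum_(a <- t) X a + (N%:R * n%:R) *: alpha)) (lam [::])
     (\sum_(a <- t) X a).
  have h7 := qa_nil qa.
  rewrite /good in gt; rewrite h3.
  have {}h4 := le_trans h4 (lerD (lerD (lerD h2 h1) h7) gt).
  apply: (le_trans (lerD h4 (lexx _))); clear h1 h2 h3 h4 h7 gt sX.
  have aa : 0 <= `|alpha| by [].
  have cs : C * s%:R <= C * (n%:R + L%:R) by rewrite ler_wpM2l.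
  have as_ : s%:R * `|alpha| <= (n%:R + L%:R) * `|alpha| by rewrite ler_wpM2r.
  have nM' : N%:R * (C + L%:R * `|alpha| + h * L%:R + ln r%:R) <= N%:R * (e / 4 * n%:R).
    by rewrite ler_wpM2l.
  have eN : eta * n%:R * N%:R <= e / 4 * (N%:R * n%:R).
    by rewrite -mulrA [n%:R * _]mulrC ler_wpM2r ?mulr_ge0.
  have hL : 0 <= N%:R * (h * L%:R + ln r%:R) by rewrite mulr_ge0 ?addr_ge0 ?mulr_ge0.
  have NnM : N%:R * n%:R <= m%:R :> R.
    by rewrite mR mulrDr -addrA lerDl addr_ge0 ?mulr_ge0.
  have hnL : 0 <= (n%:R + L%:R) * h by rewrite mulr_ge0// addr_ge0.
  have eNm : e / 4 * (N%:R * n%:R) <= e / 4 * m%:R by rewrite ler_wpM2l// ltW.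
  have em0 : 0 <= e * m%:R by rewrite mulr_ge0// ltW.
  move: hK; rewrite /Kc natrD; lra.
have words : \sum_(t : N.-tuple (n.-tuple 'I_k)) (good t)%:R <=
    r%:R ^+ N * \sum_(I : m.-tuple 'I_k) (P I)%:R :> R.
  apply: (@le_trans _ _ (\sum_(t : N.-tuple (n.-tuple 'I_k)) (P (word t))%:R)).
    by apply: ler_sum => t _; case gt: (good t); rewrite ?ler0n// goodP.
  have keysz (t : N.-tuple (n.-tuple 'I_k)) :
      size (chain_keys [::] [seq val a | a <- t]) == N.
    by rewrite size_chain_keys size_map size_tuple.
  have := @sum_words_le R k (N.-tuple (n.-tuple 'I_k)) (N.-tuple 'I_r) word
    (fun t => Tuple (keysz t)) m (fun v => (P v)%:R).
  rewrite card_tuple card_ord natrX => H; apply: H => // [t|t t'].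
    rewrite size_cat size_nseq (size_foldl_ext _ (alln t))/=.
    by rewrite size_map size_tuple -mE.
  move=> /(congr1 val)/= ke /eqP.
  rewrite eqseq_cat; last by rewrite !(size_foldl_ext _ (alln _)) !size_map !size_tuple.
  case/andP => /eqP we _; apply: val_inj => /=.
  apply: (inj_map val_inj); apply: (foldl_ext_inj (alln t) (alln t') _ ke we).
  by rewrite !size_map !size_tuple.
have PE : \sum_(I : m.-tuple 'I_k) (P I)%:R =
    #|[set I : m.-tuple 'I_k | `|lam I - m%:R *: alpha| <= e * m%:R]%SET|%:R :> R.
  by rewrite -card_set_sum.
rewrite -PE.
have rR : 0 < r%:R :> R by rewrite ltr0n.
rewrite -(ler_pM2l (exprn_gt0 N rR)); apply: le_trans words.
rewrite -(ler_pM2l (expR_gt0 (d%:R * Q * (eta * n%:R * N%:R)))).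
apply: le_trans cnt.
rewrite -[r%:R]lnK ?posrE// -[in leRHS](@lnK R G) ?posrE//.
rewrite -[2](@lnK R) ?posrE// -!expRM_natl -expRN -!expRD ler_expR.
have nG : N%:R * (n%:R * (h - e / 4)) <= N%:R * ln G by rewrite ler_wpM2l.
have nM' : N%:R * (C + L%:R * `|alpha| + h * L%:R + ln r%:R) <= N%:R * (e / 4 * n%:R).
  by rewrite ler_wpM2l.
have eN : d%:R * Q * (eta * n%:R * N%:R) <= e / 4 * (N%:R * n%:R).
  have -> : d%:R * Q * (eta * n%:R * N%:R) = (d%:R * Q * eta) * (N%:R * n%:R) by ring.
  by rewrite ler_wpM2r ?mulr_ge0.
have hL : 0 <= N%:R * (C + L%:R * `|alpha|) by rewrite mulr_ge0 ?addr_ge0 ?mulr_ge0.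
have NnM : N%:R * n%:R <= m%:R :> R.
  by rewrite mR mulrDr -addrA lerDl addr_ge0 ?mulr_ge0.
have eNm : e / 4 * (N%:R * n%:R) <= e / 4 * m%:R by rewrite ler_wpM2l// ltW.
have hs : h * s%:R <= h * (n%:R + L%:R) by rewrite ler_wpM2l.
have mh : m%:R * h = (N%:R * (n%:R + L%:R) + s%:R) * h by rewrite mR.
have hca : 0 <= C + (n%:R + L%:R) * (C + `|alpha|) by rewrite addr_ge0 ?mulr_ge0 ?addr_ge0.
have em0 : 0 <= e * m%:R by rewrite mulr_ge0// ltW.
move: hK; rewrite /Kc natrD; lra.
Unshelve. all: by end_near. Qed.

End Counting.

(** * Entropy from below *)

Section EventualIncrements.
Variable R : realType.

Lemma increments_ge0_bounded (v : nat -> R) :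
  (\forall i \near \oo, v i <= v i.+1) -> exists c, forall i, c <= v i.
Proof.
move=> [i0 _ h].
exists (- (\big[Num.max/0]_(i < i0.+1) `|v i|)) => i.
have low j : (j <= i0)%N -> - (\big[Num.max/0]_(i < i0.+1) `|v i|) <= v j.
  move=> ji; rewrite lerNl.
  apply: le_trans (le_bigmax 0 (fun i : 'I_i0.+1 => `|v i|) (Ordinal (ji : (j < i0.+1)%N))).
  by rewrite /= -normrN ler_norm.
case: (leqP i i0) => [/low//|i0i].
apply: le_trans (low i0 (leqnn _)) _.
rewrite -(subnKC (ltnW i0i)); elim: (i - i0)%N => [|j IH]; first by rewrite addn0.
by apply: le_trans IH _; rewrite addnS; apply: h; exact: leq_addr.
Qed.

Lemma increments_ge1_pos (v : nat -> R) :
  (\forall i \near \oo, v i + 1 <= v i.+1) -> \forall i \near \oo, 0 <= v i.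
Proof.
move=> [i0 _ h].
have grow j : v i0 + j%:R <= v (i0 + j)%N.
  elim: j => [|j IH]; first by rewrite addr0 addn0.
  rewrite addnS -natr1 addrA; apply: le_trans (h (i0 + j)%N (leq_addr _ _)).
  by rewrite lerD2r.
near=> i.
have ii : (i0 <= i)%N by near: i; exists i0.
have := grow (i - i0)%N; rewrite subnKC//; apply: le_trans.
have : i0%:R - v i0 <= i%:R by near: i; exact: nbhs_infty_ger.
rewrite natrB//; lra.
Unshelve. all: by end_near. Qed.

(** The tolerance 1/(j + 1) is adopted only after m has passed the threshold for j; [j m] is the
    largest such index up to m, and it tends to infinity. *)
Lemma eventually_diagonal (P : R -> nat -> Prop) :
  (forall e, 0 < e -> \forall m \near \oo, P e m) ->
  exists e : nat -> R, [/\ forall m, 0 < e m, e @ \oo --> 0 &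
    \forall m \near \oo, P (e m) m].
Proof.
move=> h.
have /boolp.choice[m0 m0P] : forall j, exists m0 : nat, forall m, (m0 <= m)%N -> P (j.+1%:R^-1) m.
  move=> j; have [|m0 _ hm] := h (j.+1%:R^-1); first by rewrite invr_gt0.
  by exists m0.
pose j m := \max_(i < m.+1 | (m0 i <= m)%N) (i : nat).
have jge J m : (J <= m)%N -> (m0 J <= m)%N -> (J <= j m)%N.
  move=> Jm mJ; rewrite /j.
  exact: (@leq_bigmax_cond _ (fun i : 'I_m.+1 => m0 i <= m)%N _ (Ordinal (Jm : (J < m.+1)%N))).
exists (fun m => (j m).+1%:R^-1); split.
- by move=> m; rewrite invr_gt0.
- apply/cvgrPdist_le => e e0.
  have [J _ hJ] := nbhs_infty_ger (e^-1).
  near=> m; rewrite sub0r normrN ger0_norm ?invr_ge0//.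
  rewrite -[e]invrK lef_pV2 ?posrE ?invr_gt0//.
  apply: le_trans (hJ J (leqnn J)) _; rewrite ler_nat leqW//.
  by apply: jge; near: m; [exists J|exists (m0 J)].
(* Past the threshold of 0 the maximum runs over a nonempty set, so it is attained and is not the
   default 0. *)
- exists (m0 0%N) => // m /= m0m.
  have [i hi ->] : exists2 i : 'I_m.+1, (m0 i <= m)%N & j m = i.
    have := @eq_bigmax_cond _ [pred i : 'I_m.+1 | (m0 i <= m)%N] (fun i => i : nat).
    case; first by apply/card_gt0P; exists ord0; rewrite inE.
    by move=> i; rewrite inE => hi ji; exists i => //; rewrite -ji.
  exact: m0P.
Unshelve. all: by end_near. Qed.

End EventualIncrements.

Section Tree.
Variables (R : realType) (k d : nat) (lam : seq 'I_k -> 'rV[R]_d).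
Variables (C : R) (L r : nat) (ext : seq 'I_k -> seq 'I_k -> seq 'I_k)
  (key : seq 'I_k -> seq 'I_k -> 'I_r).
Hypothesis qa : quasi_additive lam C L ext key.
Variable a0 : 'I_k.

Lemma take_pref (x : Sigma k) m n : (m <= n)%N -> take m (pref x n) = pref x m.
Proof using Type. by move=> mn; rewrite /pref -map_take take_iota (minn_idPl mn). Qed.

Lemma nth_pref (x : Sigma k) m n : (m < n)%N -> nth a0 (pref x n) m = x m%:Z.
Proof using Type.
by move=> mn; rewrite (nth_map 0%N) ?size_iota// nth_iota.
Qed.

Section Blocks.
Variables (b : nat -> nat) (G : forall i, {set (b i).-tuple 'I_k}).
Hypothesis b_gt0 : forall i, (0 < b i)%N.

Fixpoint level (i : nat) : nat := if i is j.+1 then (level j + b j + L)%N else 0%N.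

Lemma level_ge i : (i <= level i)%N.
Proof using b_gt0. by elim: i => //= i IH; have := b_gt0 i; lia. Qed.

Lemma level_mono i j : (i <= j)%N -> (level i <= level j)%N.
Proof using Type.
by move=> /subnKC <-; elim: (j - i)%N => [|m IH]; rewrite ?addn0// addnS/=; lia.
Qed.

Lemma level_find n : exists i, (level i <= n < level i.+1)%N.
Proof using b_gt0.
elim: n => [|n [i /andP[h1 h2]]].
  by exists 0%N => /=; have := b_gt0 0; lia.
case: (ltnP n.+1 (level i.+1)) => h3; first by exists i; rewrite h3 andbT; lia.
exists i.+1; rewrite h3/=.
have : level i.+1 = n.+1 by apply/eqP; rewrite eqn_leq h3.
by move=> <- /=; have := b_gt0 i.+1; lia.
Qed.

Definition branch (w : nat -> seq 'I_k) : Prop :=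
  w 0%N = [::] /\ forall i, exists2 I : (b i).-tuple 'I_k, I \in G i & w i.+1 = ext (w i) I.

Section Branch.
Variable w : nat -> seq 'I_k.
Hypothesis wb : branch w.

Lemma branch_size i : size (w i) = level i.
Proof using qa wb.
case: wb => w0 ws; elim: i => [|i IH]; first by rewrite w0.
by have [I _ ->] := ws i; rewrite (qa_size qa) IH size_tuple.
Qed.

Lemma branch_take i j : (i <= j)%N -> take (level i) (w j) = w i.
Proof using qa wb.
case: (wb) => w0 ws /subnKC <-; elim: (j - i)%N => [|m IH].
  by rewrite addn0 -branch_size take_size.
rewrite addnS -IH; have [I _ ->] := ws (i + m)%N.
rewrite -[X in _ = take _ X](qa_take qa _ I) take_takel//.
by rewrite branch_size level_mono// leq_addr.
Qed.

(** Coordinate n is read in [w n.+1], which is long enough because [level n.+1] exceeds n. The past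
    is constant: growth depends on nonnegative coordinates alone. *)
Definition branch_point : Sigma k :=
  fun l => if l is Posz n then nth a0 (w n.+1) n else a0.

Lemma pref_branch i : pref branch_point (level i) = w i.
Proof using qa wb b_gt0.
apply: (@eq_from_nth _ a0); first by rewrite size_pref branch_size.
move=> n; rewrite size_pref => ni; rewrite nth_pref//=.
have -> : nth a0 (w n.+1) n = nth a0 (w (maxn i n.+1)) n.
  by rewrite -(branch_take (leq_maxr i n.+1)) nth_take//; exact: level_ge.
by rewrite -(branch_take (leq_maxl i n.+1)) nth_take.
Qed.

Variables (alpha : 'rV[R]_d) (e : nat -> R).
Hypothesis Ge : forall i (I : (b i).-tuple 'I_k), I \in G i ->
  `|lam I - (b i)%:R *: alpha| <= (b i)%:R * e i.
Hypothesis e_cvg : e @ \oo --> 0.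
Hypothesis b_cvg : forall M : R, \forall i \near \oo, M <= (b i)%:R.
Hypothesis b_incr : forall i, (b i.+1 <= (b i).+1)%N.

Fixpoint err (i : nat) : R :=
  if i is j.+1 then err j + (b j)%:R * e j + C + L%:R * `|alpha| else C.

Lemma branch_err i : `|lam (w i) - (level i)%:R *: alpha| <= err i.
Proof using qa wb Ge.
case: (wb) => w0 ws; elim: i => [|i IH] /=.
  by rewrite w0 scale0r subr0; exact: qa_nil qa.
have [I IG ->] := ws i.
have -> : lam (ext (w i) I) - (level i + b i + L)%:R *: alpha =
   (lam (w i) - (level i)%:R *: alpha) + (lam I - (b i)%:R *: alpha) +
   (lam (ext (w i) I) - lam (w i) - lam I) + - (L%:R *: alpha).
  by apply/rowP => j; rewrite !mxE !natrD; ring.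
apply: le_trans (ler_norm4 _ _ _ _) _; rewrite normrN normrZ ger0_norm//.
by do !apply: lerD => //; [exact: Ge|exact: qa_ext qa _ _].
Qed.

(** A block contributes an error small relative to its length plus a constant, so the error at a
    level is negligible. A prefix that ends inside a block costs a multiple of that block's length,
    which is negligible too because block lengths grow by at most one per level. *)
Lemma branch_growth : growth_set lam alpha branch_point.
Proof using qa wb Ge b_gt0 e_cvg b_cvg b_incr.
move=> eps eps0.
have C0 := qa_ge0 qa.
pose K := C + `|alpha|.
have K0 : 0 <= K by rewrite addr_ge0.
(* The last term reserves room for the incomplete block; the increments of the whole expression are
   eventually at least 1. *)
have ev : \forall i \near \oo,
    0 <= eps * (level i)%:R - err i - K * (b i + L)%:R.
  apply: increments_ge1_pos; near=> i.
  have ei : e i <= eps / 2.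
    have : `|0 - e i| <= eps / 2.
      by near: i; move/cvgrPdist_le : e_cvg; apply; rewrite divr_gt0.
    by rewrite sub0r normrN; apply: le_trans; exact: ler_norm.
  have bi : (1 + C + L%:R * `|alpha| + K) <= eps / 2 * (b i)%:R.
    rewrite [leRHS]mulrC -ler_pdivrMr ?divr_gt0//; near: i; exact: b_cvg.
  have bb : K * (b i.+1)%:R <= K * ((b i)%:R + 1).
    by rewrite ler_wpM2l// natr1 ler_nat.
  have be : (b i)%:R * e i <= (b i)%:R * (eps / 2) by rewrite ler_wpM2l.
  have epsL : 0 <= eps * L%:R by rewrite mulr_ge0// ltW.
  rewrite /= !natrD; lra.
case: ev => i1 _ i1P.
exists (level i1) => // n /= n1.
have [i /andP[h1 h2]] := level_find n.
have ii : (i1 <= i)%N.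
  rewrite leqNgt; apply/negP => /level_mono h3.
  by move: (leq_trans h2 h3); rewrite ltnNge n1.
have := i1P i ii => /= h3.
have wE : pref branch_point n = w i ++ drop (level i) (pref branch_point n).
  by rewrite -(pref_branch i) -(take_pref _ h1) cat_take_drop.
have hc := lam_cat (qa_rcons qa) (w i) (drop (level i) (pref branch_point n)).
rewrite -wE size_drop size_pref in hc.
have -> : lam (pref branch_point n) - n%:R *: alpha =
   (lam (pref branch_point n) - lam (w i)) + (lam (w i) - (level i)%:R *: alpha) +
   - ((n - level i)%:R *: alpha).
  by apply/rowP => j; rewrite !mxE natrB//; ring.
apply: le_trans (ler_normD _ _) _; rewrite normrN normrZ ger0_norm//.
have h4 := ler_normD (lam (pref branch_point n) - lam (w i)) (lam (w i) - (level i)%:R *: alpha).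
have h5 := branch_err i.
have h6 : (n - level i)%:R * K <= (b i + L)%:R * K.
  by rewrite ler_wpM2r// ler_nat; move: h2 => /=; lia.
have h7 : eps * (level i)%:R <= eps * n%:R by rewrite ler_pM2l// ler_nat.
move: h3 h6; rewrite /K; lra.
Unshelve. all: by end_near. Qed.

End Branch.

(* Greedy choice of a branch: at each level the part of the cover below the
   current word shrinks by the factor [r / #|G i|], until it is too small to
   contain any cylinder of the next level. *)
Lemma branch_avoid (s kappa : R) (I : set nat) (nn : nat -> nat) (yy : nat -> Sigma k) :
  0 <= s ->
  (forall i, kappa * \prod_(j < i) (r%:R / #|G j|%:R) <= expR (- s * (level i.+1)%:R)) ->
  (forall i, (0 < #|G i|)%N) ->
  (\esum_(j in I) (expR (- s * (nn j)%:R))%:E < kappa%:E)%E ->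
  exists2 w, branch w &
    forall j, I j -> pref (branch_point w) (nn j) <> pref (yy j) (nn j).
Proof using qa b_gt0.
move=> s0 kap G0 small.
pose c j : R := expR (- s * (nn j)%:R).
have c0 j : 0 <= c j by exact: expR_ge0.
pose ind i v j : bool := (level i <= nn j)%N && (pref (yy j) (level i) == v).
pose Phi i v : \bar R := (\esum_(j in I) ((ind i v j)%:R * c j)%:E)%E.
pose kk i : R := kappa * \prod_(j < i) (r%:R / #|G j|%:R).
have r0 : 0 < r%:R :> R by rewrite ltr0n; exact: key_ord key.
have step i v : size v = level i -> (Phi i v < (kk i)%:E)%E ->
    exists u : seq 'I_k, (exists2 J : (b i).-tuple 'I_k, J \in G i & u = ext v J) /\
      (Phi i.+1 u < (kk i.+1)%:E)%E.
  move=> sv hv; apply: contrapT => /forallNP no.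
  have big J : J \in G i -> ((kk i.+1)%:E <= Phi i.+1 (ext v J))%E.
    move=> JG; rewrite leNgt; apply/negP => h; apply: (no (ext v J)).
    by split=> //; exists J.
  have : ((#|G i|%:R * kk i.+1)%:E <= \sum_(J in G i) Phi i.+1 (ext v J))%E.
    rewrite mulr_natl -sumr_const -sumEFin; apply: lee_sum => J JG; exact: big.
  have -> : #|G i|%:R * kk i.+1 = r%:R * kk i.
    have Gi : #|G i|%:R != 0 :> R by rewrite pnatr_eq0 -lt0n.
    by rewrite /kk big_ord_recr/=; field.
  apply/negP; rewrite -ltNge.
  have Phi0 : (0 <= Phi i v)%E by apply: esum_ge0 => j _; rewrite lee_fin mulr_ge0.
  have Phifin : Phi i v \is a fin_num.
    by rewrite ge0_fin_numE//; apply: lt_trans hv _; exact: ltry.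
  apply: (@le_lt_trans _ _ (\sum_(x < r) Phi i v)%E); last first.
    rewrite -(fineK Phifin) sumEFin lte_fin sumr_const card_ord -[ltLHS]mulr_natl ltr_pM2l//.
    by rewrite -lte_fin fineK.
  rewrite /Phi -esum_sum; last by move=> j J _ _; rewrite lee_fin mulr_ge0.
  rewrite -esum_sum; last by move=> j x _ _; rewrite lee_fin mulr_ge0.
  apply: le_esum => j Ij; rewrite !sumEFin lee_fin -!mulr_suml ler_wpM2r//.
  rewrite sumr_const card_ord -[leRHS]mulr_natl.
  rewrite -natr_sum -natrM ler_nat.
  case vj: (ind i v j); last first.
    rewrite muln0 leqn0 big1// => J _; apply/eqP; rewrite eqb0.
    apply: contraFN vj => /andP[h1 /eqP h2]; apply/andP; split.
      by apply: leq_trans h1; exact: level_mono.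
    rewrite -(qa_take qa v J) -h2 sv take_pref//; exact: level_mono.
  rewrite muln1.
  (* A covering cylinder below [v] passes through at most [r] extensions of [v]: its prefix and the
     key determine the block. *)
  pose A := [pred J : (b i).-tuple 'I_k | ind i.+1 (ext v J) j].
  have : (#|A| <= #|'I_r|)%N.
    apply: (@leq_card_in _ _ (fun J : (b i).-tuple 'I_k => key v J)).
    move=> J J' /andP[_ /eqP h1] /andP[_ /eqP h2] kJ.
    apply: val_inj; apply: (qa_inj qa _ kJ); first by rewrite !size_tuple.
    by rewrite -h1 -h2.
  rewrite card_ord; apply: leq_trans.
  rewrite -sum1_card [leqRHS]big_mkcond/= [leqLHS]big_mkcond/=.
  by apply: leq_sum => J _; rewrite /A inE; case: (J \in G i); case: (ind _ _ _).
have /boolp.choice[f fP] : forall iv : nat * seq 'I_k, exists u,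
   size iv.2 = level iv.1 -> (Phi iv.1 iv.2 < (kk iv.1)%:E)%E ->
   (exists2 J : (b iv.1).-tuple 'I_k, J \in G iv.1 & u = ext iv.2 J) /\
      (Phi iv.1.+1 u < (kk iv.1.+1)%:E)%E.
  move=> [i v] /=.
  have [h1|h1] := pselect (size v = level i /\ (Phi i v < (kk i)%:E)%E).
    by have [u hu] := step i v h1.1 h1.2; exists u.
  by exists [::] => a1 a2; case: h1.
pose w := fix w i := if i is j.+1 then f (j, w j) else [::].
have wP i : size (w i) = level i /\ (Phi i (w i) < (kk i)%:E)%E.
  elim: i => [|i [IH1 IH2]].
    split=> //; rewrite /kk big_ord0 mulr1; apply: le_lt_trans small.
    apply: le_esum => j _; rewrite lee_fin -[leRHS]mul1r ler_wpM2r//.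
  have [[J JG wE] h] := fP (i, w i) IH1 IH2.
  by split=> //=; rewrite wE (qa_size qa) IH1 size_tuple.
have wb : branch w.
  split=> // i; have [h1 h2] := wP i.
  by have [[J JG wE] _] := fP (i, w i) h1 h2; exists J.
exists w => // j Ij pj.
(* A cylinder met by the branch has length between two consecutive levels, and by [kap] it alone
   weighs at least what [w i] was allowed to have below it. *)
have [i /andP[h1 h2]] := level_find (nn j).
have [_] := wP i; apply/negP; rewrite -leNgt.
apply: (@le_trans _ _ (c j)%:E).
  rewrite lee_fin; apply: le_trans (kap i) _; rewrite ler_expR !mulNr lerN2.
  by rewrite ler_wpM2l// ler_nat ltnW.
have ij : ind i (w i) j.
  rewrite /ind h1/=; apply/eqP.
  by rewrite -(take_pref (yy j) h1) -pj take_pref// pref_branch.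
apply: esum_ge; exists [set j].
  by split; [exact: finite_set1|move=> _ ->].
by rewrite fsbig_set1 ij mul1r.
Qed.

End Blocks.
(** The bound is uniform over all cylinder covers: a cheaper cover would miss a branch of the tree
    built from the words found by [counting], and every branch lies in the growth set. *)
Lemma entropy_lower (alpha : 'rV[R]_d) (h s : R) :
  interior [set beta | growth_set lam beta !=set0] alpha ->
  (forall q, h <= press lam q - inner q alpha) -> 0 <= s < h ->
  exists2 kappa : R, 0 < kappa & forall (I : set nat) (nn : nat -> nat) (yy : nat -> Sigma k),
    growth_set lam alpha `<=`
      \bigcup_(j in I) [set x | pref x (nn j) = pref (yy j) (nn j)] ->
    (kappa%:E <= \esum_(j in I) (expR (- s * (nn j)%:R))%:E)%E.
Proof using qa a0.
move=> ia hP /andP[s0 sh].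
have h0 : 0 <= h by lra.
have r0 : 0 < r%:R :> R by rewrite ltr0n; exact: key_ord key.
have [e [e0 ecvg [i0 _ i0P]]] := eventually_diagonal (counting qa a0 ia h0 hP).
(* Consecutive lengths, from where [counting] applies: unbounded, with increments 1 as
   [branch_growth] demands. *)
pose b i := (i0 + i).+1.
pose G i := [set I : (b i).-tuple 'I_k |
  `|lam I - (b i)%:R *: alpha| <= e (b i) * (b i)%:R]%SET.
have cG i : expR ((b i)%:R * (h - e (b i))) <= #|G i|%:R.
  by apply: i0P; rewrite /= /b leqW// leq_addr.
have G0 i : (0 < #|G i|)%N.
  by rewrite -(ltr0n R); apply: lt_le_trans (cG i); exact: expR_gt0.
have bcvg (M : R) : \forall i \near \oo, M <= (b i)%:R.
  near=> i; apply: (@le_trans _ _ i%:R); first by near: i; exact: nbhs_infty_ger.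
  by rewrite ler_nat /b leqW// leq_addl.
have ebcvg : (fun i => e (b i)) @ \oo --> 0.
  apply: (cvg_comp b e) ecvg => P [N _ NP]; exists N => // i /= Ni; apply: NP.
  by rewrite /= /b leqW// (leq_trans Ni)// leq_addl.
(* exp(D i) is the largest [kappa] that [branch_avoid] permits at level i. As ln #|G i| is about h
   b_i with h > s, [D] is eventually nondecreasing, hence bounded below. *)
pose D i : R := \sum_(j < i) (ln #|G j|%:R - ln r%:R) - s * (level b i.+1)%:R.
have [c cD] : exists c, forall i, c <= D i.
  apply: increments_ge0_bounded; near=> i.
  have ei : e (b i) <= (h - s) / 2.
    have : `|0 - e (b i)| <= (h - s) / 2.
      near: i; move/cvgrPdist_le : ebcvg; apply; rewrite divr_gt0//; lra.
    by rewrite sub0r normrN; apply: le_trans; exact: ler_norm.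
  have bi : ln r%:R + s * (1 + L%:R) <= (h - s) / 2 * (b i)%:R.
    rewrite [leRHS]mulrC -ler_pdivrMr ?divr_gt0//; first by near: i; exact: bcvg.
    lra.
  have lnG : (b i)%:R * (h - e (b i)) <= ln #|G i|%:R.
    by rewrite -ler_expR lnK// posrE ltr0n.
  have be : (b i)%:R * e (b i) <= (b i)%:R * ((h - s) / 2) by rewrite ler_wpM2l.
  have -> : D i.+1 = D i + (ln #|G i|%:R - ln r%:R) - s * (b i.+1 + L)%:R.
    by rewrite /D big_ord_recr/= !natrD; ring.
  have -> : (b i.+1 + L)%:R = (b i)%:R + 1 + L%:R :> R.
    by rewrite natrD /b addnS -natr1.
  lra.
exists (expR c); first exact: expR_gt0.
move=> I nn yy cov; rewrite leNgt; apply/negP => small.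
have [w wb wn] : exists2 w, branch G w &
    forall j, I j -> pref (branch_point w) (nn j) <> pref (yy j) (nn j).
  apply: branch_avoid small => // i.
  have -> : \prod_(j < i) (r%:R / #|G j|%:R) =
      expR (- \sum_(j < i) (ln #|G j|%:R - ln r%:R)) :> R.
    rewrite -sumrN expR_sum; apply: eq_bigr => j _.
    by rewrite opprB expRB !lnK ?posrE ?ltr0n ?G0 ?(key_ord key).
  rewrite -expRD ler_expR mulNr; have := cD i; rewrite /D; lra.
have xE : growth_set lam alpha (branch_point w).
  apply: (@branch_growth b G _ w _ alpha (fun i => e (b i))) => //.
  - by move=> i J; rewrite inE mulrC.
  - by move=> i; rewrite /b addnS.
have [j Ij pj] := cov _ xE.
exact: (wn j Ij pj).
Unshelve. all: by end_near. Qed.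

End Tree.

(** * Entropy of growth sets *)

Section BowenBalls.
Variables (R : realType) (k : nat).
Implicit Types x y : Sigma k.

Lemma agreement_max x y : x <> y ->
  agree x y (agreement x y) /\ forall m, agree x y m -> (m <= agreement x y)%N.
Proof.
move=> xy; rewrite /agreement; case: xgetP => [m _ //|no].
have [i xyi] : exists i, x i <> y i.
  by apply: contrapT => /forallNP h; apply: xy; apply/funext => i; apply: contrapT (h i).
have ex0 : exists m, `[< agree x y m >] by exists 0%N; apply/asboolP => j; lia.
have bnd m : `[< agree x y m >] -> (m <= `|i|%N)%N.
  move=> /asboolP am; rewrite leqNgt; apply/negP => im; apply: xyi; apply: am.
  by rewrite -abszE ltz_nat.
have [m /asboolP am mmax] := ex_maxnP ex0 bnd.
by case: (no m); split=> // m' /asboolP /mmax.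
Qed.

Lemma sdist_le x y b : agree x y b -> sdist R x y <= 2 ^- b.
Proof.
move=> ab; rewrite /sdist; case: (pselect (x = y)) => [e|xy] /=.
  by rewrite invr_ge0 exprn_ge0.
have [_ /(_ _ ab) h] := agreement_max xy.
by rewrite lef_pV2 ?posrE ?exprn_gt0// ler_weXn2l// ler1n.
Qed.

Lemma sdist_lt1 x y : sdist R x y < 1 -> x 0 = y 0.
Proof.
have [->//|xy] := pselect (x = y).
rewrite /sdist; case: (pselect (x = y)) => [//|ne] /= lt1.
have [h _] := agreement_max xy; apply: h.
rewrite normr0 ltz_nat lt0n; apply: contraTneq lt1 => ->.
by rewrite expr0 invr1 ltxx.
Qed.

(** Distance below 1 already forces the symbols at 0 to agree, so every scale up to 1 gives prefix
    cylinders, which is all the lower bound uses. *)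
Lemma bowen_ball_pref n x y (eps : R) : eps <= 1 ->
  bowen_ball n y eps x -> pref x n = pref y n.
Proof.
move=> eps1 /=; rewrite /bowen_ball/= => h.
apply/eq_in_map => i; rewrite mem_iota add0n/= => ilt.
have : sdist R (sshift i%:Z y) (sshift i%:Z x) < 1.
  apply: lt_le_trans eps1; apply: le_lt_trans h.
  exact: (le_bigmax 0 (fun j : 'I_n => sdist R (sshift j%:Z y) (sshift j%:Z x)) (Ordinal ilt)).
by move=> /sdist_lt1; rewrite /sshift add0r.
Qed.

(** In the two-sided shift a small ball also sees coordinates before 0 and after n, so a cover by
    balls is built from cylinders over an enlarged window. *)
Lemma bowen_ball_window b n x y (eps : R) : 2 ^- b < eps ->
  (forall l : int, - b%:Z < l < n%:Z + b%:Z -> x l = y l) -> bowen_ball n y eps x.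
Proof.
move=> beps xy; rewrite /bowen_ball/=; apply: le_lt_trans beps.
apply/bigmax_le => [|i _]; first by rewrite invr_ge0 exprn_ge0.
apply: sdist_le => j jb; rewrite /sshift; apply/esym/xy.
by have := ltn_ord i; lia.
Qed.

End BowenBalls.

Lemma inner_ge (R : realType) d (q v : 'rV[R]_d) c :
  `|v| <= c -> - (d%:R * `|q| * c) <= inner q v.
Proof.
rewrite -normrN => /(inner_le q); rewrite -scaleN1r innerZr; lra.
Qed.

(** * Covers of growth sets and the bound from above *)

Section UpperBound.
Variables (R : realType) (k d : nat) (lam : seq 'I_k -> 'rV[R]_d).

Lemma uniq_words_sum (f : seq 'I_k -> R) (U : seq (seq 'I_k)) (P : pred (seq 'I_k)) M :
  (forall u, 0 <= f u) -> uniq U -> all P U -> all (fun u => size u < M)%N U ->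
  \sum_(u <- U) f u <= \sum_(n < M) \sum_(I : n.-tuple 'I_k | P I) f I.
Proof.
move=> f0 uU PU UM.
have -> : \sum_(u <- U) f u = \sum_(n < M) \sum_(u <- U | size u == n) f u.
  rewrite (exchange_big_dep xpredT)//= big_seq [RHS]big_seq; apply: eq_bigr => u uin.
  have uM : (size u < M)%N by exact: (allP UM).
  rewrite (bigD1 (Ordinal uM))//= big1 ?addr0// => i /andP[/eqP su /eqP []].
  by apply: val_inj.
apply: ler_sum => n _.
have -> : \sum_(u <- U | size u == n) f u =
    \sum_(I <- pmap (insub : seq 'I_k -> option (n.-tuple 'I_k)) U) f I.
  elim: U {uU PU UM} => [|u U IH]; first by rewrite !big_nil.
  rewrite big_cons [pmap _ (u :: U)]/=; case: insubP => [I su uI|/negbTE su] /=.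
    by rewrite su big_cons uI IH.
  by rewrite su IH.
rewrite big_uniq ?pmap_sub_uniq//=.
rewrite [leRHS]big_mkcond/= [leLHS]big_mkcond/=; apply: ler_sum => I _.
case: ifP => // IU; last by case: ifP.
rewrite (_ : P I)//; apply: (allP PU).
by move: IU; rewrite mem_pmap_sub.
Qed.

Lemma geometric_tail (rho : R) N M : 0 <= rho < 1 ->
  \sum_(n < M | (N <= n)%N) rho ^+ n <= rho ^+ N / (1 - rho).
Proof.
move=> /andP[r0 r1]; rewrite ler_pdivlMr; last lra.
suff : (\sum_(n < M | (N <= n)%N) rho ^+ n) * (1 - rho) <= rho ^+ N - rho ^+ maxn N M.
  by move=> h; apply: le_trans h _; rewrite gerBl exprn_ge0.
elim: M => [|M IH]; first by rewrite big_ord0 mul0r maxn0 subrr.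
rewrite big_mkcond big_ord_recr -big_mkcond/= mulrDl.
case: (leqP N M) => NM.
  move: IH; rewrite (maxn_idPr NM) (maxn_idPr (leqW NM)) exprS; lra.
move: IH; rewrite (maxn_idPl (ltnW NM)) (maxn_idPl NM); lra.
Qed.

Variables (C : R) (L r : nat) (ext : seq 'I_k -> seq 'I_k -> seq 'I_k)
  (key : seq 'I_k -> seq 'I_k -> 'I_r).
Hypothesis qa : quasi_additive lam C L ext key.
Variable a0 : 'I_k.

Section Window.
Variables (b : nat).

Definition window (x : Sigma k) n : seq 'I_k :=
  [seq x (j%:Z - b%:Z) | j <- iota 0 (n + 2 * b)].

Definition core_word (u : seq 'I_k) : seq 'I_k := take (size u - 2 * b) (drop b u).

Lemma core_window x n : core_word (window x n) = pref x n.
Proof using Type.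
rewrite /core_word /window size_map size_iota addnK -map_drop -map_take.
rewrite drop_iota take_iota add0n (minn_idPl _); last by lia.
rewrite /pref -[X in iota X _]addn0 iotaDl -map_comp.
apply: eq_map => j /=; congr (x _); lia.
Qed.

(** A centre for the cylinder of a window; its values outside the window are arbitrary and never
    consulted. *)
Definition extend (u : seq 'I_k) : Sigma k :=
  fun l => nth a0 u (absz (l + b%:Z)%R).

Lemma window_extend x n (l : int) : - b%:Z < l < n%:Z + b%:Z ->
  x l = extend (window x n) l.
Proof using Type.
move=> lb; rewrite /extend (nth_map 0%N) ?size_iota; last lia.
rewrite nth_iota; last lia.
congr (x _); lia.
Qed.

(** A window is determined by its core and the 2b letters around it, which serve as the key in
    [sum_words_le]. *)
Lemma core_word_sum n (P : pred (seq 'I_k)) (c : R) : 0 <= c ->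
  \sum_(I : (n + 2 * b).-tuple 'I_k | P (core_word I)) c <=
  (k ^ (2 * b))%:R * (\sum_(I : n.-tuple 'I_k) (P I)%:R * c).
Proof using Type.
move=> c0.
have sz (I : (n + 2 * b).-tuple 'I_k) : size (core_word I) = n.
  by rewrite /core_word size_take_min size_drop size_tuple; lia.
have k1 (I : (n + 2 * b).-tuple 'I_k) : size (take b I) == b.
  by rewrite size_take_min size_tuple; apply/eqP; lia.
have k2 (I : (n + 2 * b).-tuple 'I_k) : size (drop (b + n) I) == b.
  by rewrite size_drop size_tuple; apply/eqP; lia.
have := @sum_words_le R k _ (b.-tuple 'I_k * b.-tuple 'I_k)%type
  (fun I : (n + 2 * b).-tuple 'I_k => core_word I) (fun I => (Tuple (k1 I), Tuple (k2 I)))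
  n (fun w => (P w)%:R * c).
rewrite card_prod card_tuple card_ord -expnD addnn -mul2n => H.
apply: le_trans (H _ _ _) => //.
- rewrite big_mkcond/=; apply: ler_sum => I _.
  by case: (P _); rewrite ?mul1r ?mul0r.
- by move=> w; rewrite mulr_ge0.
- move=> I J [e1 e2]; rewrite /core_word !size_tuple !addnK => e3.
  apply: val_inj => /=; rewrite -(cat_take_drop b I) -(cat_take_drop b J) e1.
  congr (_ ++ _); rewrite -(cat_take_drop n (drop b I)) -(cat_take_drop n (drop b J)).
  by rewrite e3 !drop_drop ![(n + b)%N]addnC e2.
Qed.

End Window.

(** The prefixes of a single point of the growth set already contribute exp(n <q, alpha> + o(n)) to
    [Zsum]. Nonnegativity matters because Bowen's exponents range over s >= 0. *)
Lemma growth_press_ge0 (alpha : 'rV[R]_d) q :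
  growth_set lam alpha !=set0 -> 0 <= press lam q - inner q alpha.
Proof using qa a0.
move=> [x xP]; rewrite subr_ge0.
apply/ler_addgt0Pr => e e0.
pose M := d%:R * `|q| + 1.
have M0 : 0 < M by rewrite ltr_wpDl// mulr_ge0.
have e2 : 0 < e / 2 / M by rewrite !divr_gt0.
have /cvgrPdist_le/(_ (e / 2)) pc := @press_cvg _ _ _ _ _ _ _ _ _ qa a0 q.
have /filter_ex [n [[n0 h1] h2]] : \forall n \near \oo, ((0 < n)%N /\
    `|press lam q - n%:R^-1 * ln (Zsum lam q n)| <= e / 2) /\
    `|lam (pref x n) - n%:R *: alpha| <= e / 2 / M * n%:R.
  near=> n; split; [split|].
  - by near: n; exists 1%N.
  - by near: n; apply: pc; rewrite divr_gt0.
  - by near: n; exact: xP.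
have nR : 0 < n%:R :> R by rewrite ltr0n.
have := Zsum_ge lam q (size_pref x n) => h3.
have {h3}: inner q (lam (pref x n)) <= ln (Zsum lam q n).
  by rewrite -ler_expR lnK// posrE (Zsum_gt0 _ a0).
move: h1; rewrite ler_norml => /andP[h1 _] h3.
have {}h1 : n%:R^-1 * ln (Zsum lam q n) <= press lam q + e / 2 by lra.
rewrite mulrC ler_pdivrMr// in h1.
move: h2 => /(inner_ge q); rewrite innerBr innerZr => h2.
rewrite -(ler_pM2r nR).
have h4 : d%:R * `|q| * (e / 2 / M * n%:R) <= e / 2 * n%:R.
  rewrite mulrA ler_pM2r// mulrA -[leRHS]mulr1 [leLHS](_ : _ = e / 2 * (d%:R * `|q| / M)); last by ring.
  by rewrite ler_pM2l ?divr_gt0// ler_pdivrMr// mul1r lerDl.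
lra.
Unshelve. all: by end_near. Qed.

(** The cover consists of all long windows whose core has growth within eta n of n alpha. Such a
    core satisfies exp <q, lam - n alpha> >= exp(- n gap / 4), so up to the side letters at most
    exp(n (s - gap / 2)) windows have core length n, and their total weight decays geometrically
    with ratio [rho]. *)
Lemma growth_cover (alpha : 'rV[R]_d) q (s delta : R) (b N : nat) :
  press lam q - inner q alpha < s -> 0 < delta ->
  exists (I : set nat) (nn : nat -> nat) (yy : nat -> Sigma k),
    [/\ forall j, I j -> (N <= nn j)%N,
        growth_set lam alpha `<=` \bigcup_(j in I)
           [set x | forall l : int, - b%:Z < l < (nn j)%:Z + b%:Z -> x l = yy j l] &
        (\esum_(j in I) (expR (- s * (nn j)%:R))%:E <= delta%:E)%E].
Proof using qa a0.
move=> hs de0.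
set gap := s - (press lam q - inner q alpha).
have gap0 : 0 < gap by rewrite subr_gt0.
pose M := d%:R * `|q| + 1.
have M0 : 0 < M by rewrite ltr_wpDl// mulr_ge0.
pose eta := gap / 4 / M.
have eta0 : 0 < eta by rewrite !divr_gt0.
have etaM : d%:R * `|q| * eta <= gap / 4.
  rewrite /eta [leLHS](_ : _ = gap / 4 * (d%:R * `|q| / M)); last by ring.
  by rewrite -[leRHS]mulr1 ler_pM2l ?divr_gt0// ler_pdivrMr// mul1r lerDl.
have [n1 n1P] : exists n1, forall n, (n1 <= n)%N -> (0 < n)%N ->
    ln (Zsum lam q n) <= n%:R * (press lam q + gap / 4).
  have := @press_cvg _ _ _ _ _ _ _ _ _ qa a0 q.
  move/cvgrPdist_le => /(_ (gap / 4)) []; first by rewrite divr_gt0.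
  move=> n1 _ h; exists n1 => n nn1 n0.
  have := h n nn1; rewrite /= ler_norml => /andP[h1 _].
  by rewrite mulrC -ler_pdivrMr ?ltr0n// mulrC; lra.
pose rho : R := expR (- (gap / 2)).
have rho01 : 0 <= rho < 1 by rewrite expR_ge0 expR_lt1; lra.
pose K : R := (k ^ (2 * b))%:R.
have [N' [NN' n1N' N'0 tail]] : exists N', [/\ (N <= N')%N, (n1 <= N')%N, (0 < N')%N &
    K * (rho ^+ N' / (1 - rho)) <= delta].
  have r1 : 0 < 1 - rho by move: rho01 => /andP[_]; lra.
  have cv : (rho ^+ n) @[n --> \oo] --> 0.
    by apply: cvg_expr; rewrite ger0_norm; case/andP: rho01.
  have K0 : 0 <= K by [].
  have d1 : 0 < delta * (1 - rho) / (K + 1) by rewrite divr_gt0 ?mulr_gt0// ltr_wpDl.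
  move/cvgrPdist_le : cv => /(_ _ d1) [N1 _ hN1].
  exists (maxn (maxn N n1) (maxn 1 N1)); split; rewrite ?leq_max ?leqnn ?orbT//.
  set N' := maxn _ _.
  have N1N' : (N1 <= N')%N by rewrite /N' !leq_max leqnn !orbT.
  have := hN1 N' N1N'; rewrite /= sub0r normrN.
  rewrite ger0_norm ?exprn_ge0 ?expR_ge0// ler_pdivlMr; last by rewrite ltr_wpDl.
  move=> h; rewrite mulrA ler_pdivrMr//; apply: le_trans h.
  rewrite mulrC ler_wpM2l ?exprn_ge0 ?expR_ge0//; lra.
pose P (u : seq 'I_k) := `|lam u - (size u)%:R *: alpha| <= eta * (size u)%:R.
pose G (u : seq 'I_k) := (N' + 2 * b <= size u)%N && P (core_word b u).
(* Words are countable through [pickle], so codes index the cover; on [I] the default word is never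
   met. *)
pose dec j := odflt [::] (unpickle j : option (seq 'I_k)).
pose I : set nat := [set j | exists2 u : seq 'I_k, G u & j = pickle u].
have decK u : dec (pickle u) = u by rewrite /dec pickleK.
exists I, (fun j => size (dec j) - 2 * b)%N, (fun j => extend b (dec j)).
split.
- by move=> _ [u /andP[h _] ->]; rewrite decK; lia.
- move=> x xP; have /filter_ex [n [nN' hn]] : \forall n \near \oo, (N' <= n)%N /\
      `|lam (pref x n) - n%:R *: alpha| <= eta * n%:R.
    by near=> n; split; near: n; [exists N'|exact: xP].
  have sw : size (window b x n) = (n + 2 * b)%N by rewrite size_map size_iota.
  exists (pickle (window b x n)).
    exists (window b x n) => //; rewrite /G sw leq_add2r nN'/=.
    by rewrite core_window /P size_pref.
  move=> l; rewrite decK sw addnK; exact: window_extend.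
(* The infinite sum is the supremum over finite index sets, so a bound uniform in [X] suffices. *)
rewrite /esum; apply: ge_ereal_sup => _ [X [finX XI] <-].
pose f (u : seq 'I_k) : R := expR (- s * (size u - 2 * b)%:R).
have f0 u : 0 <= f u by exact: expR_ge0.
pose U := [seq dec j | j <- finmap.enum_fset (fset_set X)].
have mX j : j \in finmap.enum_fset (fset_set X) -> X j.
  move=> jX; have : j \in X by rewrite -(in_fset_set finX j); exact: jX.
  by rewrite inE.
have -> : (\sum_(j \in X) (expR (- s * (size (dec j) - 2 * b)%:R))%:E)%E =
    (\sum_(u <- U) f u)%:E.
  by rewrite fsbig_finite//= sumEFin /U big_map.
rewrite lee_fin.
have UG : all G U.
  apply/allP => _ /mapP[j jX ->]; have := mX _ jX.
  by move=> /XI[u Gu ->]; rewrite decK.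
have Uuniq : uniq U.
  rewrite map_inj_in_uniq ?finmap.fset_uniq// => i j.
  by move=> /mX/XI[u _ ->] /mX/XI[v _ ->]; rewrite !decK => ->.
pose mx := (\max_(u <- U) size u).+1.
have Umx : all (fun u => size u < mx)%N U.
  by apply/allP => u uU; rewrite ltnS; exact: leq_bigmax_seq.
apply: le_trans (uniq_words_sum f0 Uuniq UG Umx) _.
have bound n : (N' <= n)%N ->
    \sum_(J : (n + 2 * b).-tuple 'I_k | G J) f J <= K * rho ^+ n.
  move=> nN'.
  have nn1 : (n1 <= n)%N by exact: leq_trans nN'.
  have n0 : (0 < n)%N by exact: leq_trans nN'.
  apply: (@le_trans _ _ (\sum_(J : (n + 2 * b).-tuple 'I_k | P (core_word b J)) expR (- s * n%:R))).
    rewrite (eq_bigl (fun J : (n + 2 * b).-tuple 'I_k => P (core_word b J))); last first.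
      by move=> J; rewrite /G size_tuple leq_add2r nN'.
    by apply: ler_sum => J _; rewrite /f size_tuple addnK.
  apply: le_trans (@core_word_sum b n P (expR (- s * n%:R)) (expR_ge0 _)) _.
  rewrite ler_wpM2l//.
  apply: (@le_trans _ _ (Zsum lam q n * expR (- (n%:R * inner q alpha) +
      d%:R * `|q| * (eta * n%:R) - s * n%:R))).
    rewrite /Zsum mulr_suml; apply: ler_sum => J _; rewrite -expRD.
    case PJ: (P J); last by rewrite mul0r expR_ge0.
    rewrite mul1r ler_expR; move: PJ; rewrite /P size_tuple => /(inner_ge q).
    rewrite innerBr innerZr; lra.
  rewrite -[Zsum _ _ _]lnK ?posrE ?(Zsum_gt0 _ a0)// -expRD -expRM_natl ler_expR.
  have := n1P n nn1 n0.
  have : n%:R * (d%:R * `|q| * eta) <= n%:R * (gap / 4) by rewrite ler_wpM2l.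
  rewrite /gap; lra.
have rho0 : 0 < rho ^+ (2 * b) by rewrite exprn_gt0// expR_gt0.
(* Here m = n + 2b is the length of the whole window; the division by rho^(2b) undoes this shift,
   and shorter words do not occur. *)
apply: (@le_trans _ _ (\sum_(m < mx | (N' + 2 * b <= m)%N) K / rho ^+ (2 * b) * rho ^+ m)).
  rewrite [leRHS]big_mkcond/=; apply: ler_sum => m _; case: leqP => hm.
    have mE : (val m = (m - 2 * b) + 2 * b)%N by rewrite subnK// (leq_trans (leq_addl _ _) hm).
    have := bound (m - 2 * b)%N; rewrite -mE => h.
    apply: le_trans (h _) _; first by rewrite -(leq_add2r (2 * b)) -mE.
    rewrite [in leRHS]mE exprD mulrA mulrAC divfK// gt_eqF//.
  by rewrite big1// => J /andP[]; rewrite size_tuple leqNgt hm.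
rewrite -mulr_sumr; apply: le_trans tail.
apply: le_trans (ler_wpM2l _ (geometric_tail _ _ rho01)) _.
  by rewrite divr_ge0// ltW.
have r1 : 1 - rho != 0 by case/andP: rho01 => _ h; rewrite gt_eqF// subr_gt0.
rewrite exprD le_eqVlt; apply/orP; left; apply/eqP.
move: (rho ^+ (2 * b)) rho0 (rho ^+ N') => u /lt0r_neq0 u0 v.
by field; rewrite u0 r1.
Unshelve. all: by end_near. Qed.

End UpperBound.

Section HtopGrowth.
Variables (R : realType) (k d : nat) (lam : seq 'I_k -> 'rV[R]_d).
Variables (C : R) (L r : nat) (ext : seq 'I_k -> seq 'I_k -> seq 'I_k)
  (key : seq 'I_k -> seq 'I_k -> 'I_r).
Hypothesis qa : quasi_additive lam C L ext key.
Variable a0 : 'I_k.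
Variable alpha : 'rV[R]_d.
Hypothesis ia : interior [set beta | growth_set lam beta !=set0] alpha.
Local Open Scope ereal_scope.

Lemma bowen_S_N_ge0 (Y : set (Sigma k)) (s eps : R) N : 0 <= bowen_S_N Y s N eps.
Proof using Type.
apply: le_ereal_inf_tmp => _ [I [n [y [_ ->]]]].
by apply: esum_ge0 => j _; rewrite lee_fin expR_ge0.
Qed.

Lemma bowen_S_upper q (s eps : R) : (0 < eps)%R ->
  (press lam q - inner q alpha < s)%R -> bowen_S (growth_set lam alpha) s eps = 0.
Proof using qa a0.
move=> eps0 hs.
have [b hb] : exists b : nat, ((2 : R) ^- b < eps)%R.
  have := @cvg_expr R (2^-1); rewrite ger0_norm// invf_lt1// ltr1n => /(_ isT).
  move/cvgrPdist_lt => /(_ eps eps0) [b _ h]; exists b.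
  have := h b (leqnn b); rewrite sub0r normrN ger0_norm ?exprn_ge0// exprVn//.
rewrite /bowen_S (_ : (fun N => _) = cst 0); first exact: lim_cst.
apply/funext => N /=; apply/eqP; rewrite eq_le bowen_S_N_ge0 andbT.
apply/lee_addgt0Pr => del del0; rewrite add0e.
have [I [nn [yy [h1 h2 h3]]]] := growth_cover qa a0 b N hs del0.
apply: le_trans h3; apply: ereal_inf_lbound; exists I, nn, yy; split=> //; split=> //.
move=> x /h2 [j Ij hj]; exists j => //; exact: bowen_ball_window hb hj.
Qed.

Lemma bowen_S_lower (h s eps : R) : (eps <= 1)%R ->
  (forall q, h <= press lam q - inner q alpha)%R -> (0 <= s < h)%R ->
  bowen_S (growth_set lam alpha) s eps != 0.
Proof using qa a0 ia.
move=> eps1 hP hs.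
have [kappa k0 hk] := entropy_lower qa a0 ia hP hs.
have ge N : kappa%:E <= bowen_S_N (growth_set lam alpha) s N eps.
  apply: le_ereal_inf_tmp => _ [I [n [y [[_ cov] ->]]]]; apply: hk.
  by move=> x /cov [j Ij hj]; exists j => //; exact: bowen_ball_pref hj.
have : kappa%:E <= bowen_S (growth_set lam alpha) s eps.
  apply: lime_ge; last by apply: nearW => N; exact: ge.
  apply: ereal_nondecreasing_is_cvgn => N M NM.
  apply: ereal_inf_le_tmp => _ [I [n [y [[h1 h2] ->]]]].
  by exists I, n, y; split=> //; split=> // i /h1; exact: leq_trans.
by move=> h'; rewrite gt_eqF//; apply: lt_le_trans h'; rewrite lte_fin.
Qed.

(** At every scale in (0, 1] the entropy already equals the infimum [V], so the limit in eps is that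
    of an eventually constant function. *)
Theorem htop_growth_set : htop R (growth_set lam alpha) =
  ereal_inf [set (press lam q - inner q alpha)%:E | q in [set: 'rV[R]_d]].
Proof using qa a0 ia.
set V := ereal_inf _.
have ne : growth_set lam alpha !=set0 by exact: (interior_subset ia).
have V0 : 0 <= V.
  apply: le_ereal_inf_tmp => _ [q _ <-]; rewrite lee_fin.
  exact: (growth_press_ge0 qa a0 q ne).
have V1 : V <= (press lam 0 - inner 0 alpha)%:E by apply: ereal_inf_lbound; exists 0%R.
have Vfin : V \is a fin_num by rewrite ge0_fin_numE//; apply: le_lt_trans V1 _; exact: ltry.
have E (eps : R) : (0 < eps)%R -> (eps <= 1)%R ->
    htop_eps (growth_set lam alpha) eps = V.
  move=> eps0 eps1; apply/eqP; rewrite eq_le; apply/andP; split.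
    apply: le_ereal_inf_tmp => _ [q _ <-].
    apply/lee_addgt0Pr => e e0; apply: ereal_inf_lbound.
    exists (press lam q - inner q alpha + e)%R => //; split.
      by rewrite addr_ge0 ?(ltW e0)//; exact: (growth_press_ge0 qa a0 q ne).
    by apply: (bowen_S_upper eps0 (q := q)); rewrite ltrDl.
  apply: le_ereal_inf_tmp => _ [s [s0 sS] <-]; rewrite leNgt; apply/negP => sV.
  have : bowen_S (growth_set lam alpha) s eps != 0.
    apply: (@bowen_S_lower (fine V)) => // [q|].
      by rewrite -lee_fin fineK//; apply: ereal_inf_lbound; exists q.
    by rewrite s0/= -lte_fin fineK.
  by rewrite sS eqxx.
rewrite /htop; apply/cvg_lim => //.
apply: cvg_near_cst; near=> eps; apply: E; near: eps.
  exact: nbhs_right_gt.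
exact: nbhs_right_le.
Unshelve. all: by end_near. Qed.

End HtopGrowth.

(** * Real spectral theorem and singular values *)

Section RealSpectral.
Variable R : realType.

(** Over the complex numbers the matrix is hermitian, so its spectral values are real; a real root
    of the complexified characteristic polynomial is a root over R and yields a real eigenvector. *)
Lemma symmetric_eigenvector n (S : 'M[R]_n.+1) : S^T = S ->
  exists a (v : 'rV[R]_n.+1), v != 0 /\ v *m S = a *: v.
Proof.
move=> Ssym; pose f := real_complex R.
pose Sc := map_mx f S.
have Sherm : Sc \is hermsymmx.
  apply: realsym_hermsym.
    apply/is_hermitianmxP; rewrite expr0 scale1r map_mx_id//.
    by apply/matrixP => i j; rewrite !mxE -{1}Ssym mxE.
  by apply/mxOverP => i j; rewrite mxE complex_real.
have Dreal := hermitian_spectral_diag_real Sherm.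
have /orthomx_spectralP E := hermitian_normalmx Sherm.
set P := spectralmx Sc in E; set D := spectral_diag Sc in E Dreal.
have PE : P *m Sc = diag_mx D *m P by rewrite {1}E mulmxA mulKVmx// spectral_unit.
have ev : eigenvalue Sc (D 0 0).
  apply/eigenvalueP; exists (row 0 P).
    by rewrite -row_mul PE row_mul row_diag_mx -scalemxAl -rowE.
  apply/negP => /eqP r0; have : row 0 (P *m invmx P) = 0 by rewrite row_mul r0 mul0mx.
  rewrite mulmxV ?spectral_unit// => /rowP/(_ 0); rewrite !mxE eqxx => /eqP.
  by rewrite oner_eq0.
have [a aE] : exists a, D 0 0 = f a.
  exists (complex.Re (D 0 0)); apply/esym/RRe_real.
  by move/mxOverP : Dreal; exact.
move: ev; rewrite aE eigenvalue_root_char -map_char_poly fmorph_root -eigenvalue_root_char.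
by move=> /eigenvalueP[v vS v0]; exists a, v.
Qed.

Lemma sqnorm_gt0 n (v : 'rV[R]_n) : v != 0 -> 0 < (v *m v^T) 0 0.
Proof.
move=> v0; rewrite mxE.
have [j vj] : exists j, v 0 j != 0.
  by apply/existsP; apply: contraNT v0; rewrite negb_exists => /forallP h;
     apply/eqP/rowP => j; rewrite mxE; apply/eqP; rewrite -[_ == _]negbK h.
rewrite (bigD1 j)//= ltr_pwDl//; last first.
  by rewrite sumr_ge0// => i _; rewrite mxE -expr2 sqr_ge0.
by rewrite mxE -expr2 exprn_even_gt0//= vj.
Qed.

(* Householder reflection exchanging [v] and the first basis vector. *)
Lemma orthogonal_with_first_row n (v : 'rV[R]_n.+1) : v *m v^T = 1%:M ->
  exists H : 'M[R]_n.+1, H *m H^T = 1%:M /\ delta_mx 0 0 *m H = v.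
Proof.
move=> vv; pose e : 'rV[R]_n.+1 := delta_mx 0 0.
have [->|ve] := eqVneq v e.
  by exists 1%:M; rewrite trmx1 !mulmx1.
have [w wE] : exists w, w = v - e by exists (v - e).
have w0 : w != 0 by rewrite wE subr_eq0.
have ee : e *m e^T = 1%:M.
  by rewrite trmx_delta mul_delta_mx; apply/matrixP => i j; rewrite !ord1 !mxE.
have ev : e *m v^T = (v 0 0)%:M.
  by apply/matrixP => i j; rewrite !ord1 -rowE !mxE.
have ve' : v *m e^T = (v 0 0)%:M by rewrite -[LHS]trmxK trmx_mul trmxK ev tr_scalar_mx.
pose c := 2 * (1 - v 0 0).
have ew : e *m w^T = (v 0 0 - 1)%:M.
  by rewrite wE linearB/= mulmxBr ev ee -raddfB.
have ww : w *m w^T = c%:M.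
  rewrite wE linearB/= mulmxBr !mulmxBl vv ee ev ve' -!raddfB/=; congr (_%:M).
  rewrite /c; ring.
have c0 : c != 0.
  have := sqnorm_gt0 w0; rewrite ww mxE eqxx => h; exact: lt0r_neq0.
exists (1%:M - (2 / c) *: (w^T *m w)); split.
  have -> : (1%:M - (2 / c) *: (w^T *m w))^T = 1%:M - (2 / c) *: (w^T *m w).
    by rewrite linearB/= [in LHS]linearZ/= trmx_mul trmxK trmx1.
  have [p pE] : exists p, p = w^T *m w by exists (w^T *m w).
  have pp : p *m p = c *: p.
    by rewrite pE mulmxA -[_ *m w *m w^T]mulmxA ww mul_mx_scalar -scalemxAl.
  rewrite -pE mulmxBl !mulmxBr !mul1mx mulmx1 -!scalemxAr -!scalemxAl pp !scalerA.
  rewrite (_ : 2 / c * (2 / c) * c = 2 / c + 2 / c); last by move: (c) c0 => c' c'0; field.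
  by rewrite scalerDl opprB addrK subrK.
rewrite mulmxBr mulmx1 -scalemxAr mulmxA ew mul_scalar_mx scalerA.
rewrite (_ : 2 / c * (v 0 0 - 1) = -1); first by rewrite scaleN1r opprK addrC wE subrK.
have : c = 2 * (1 - v 0 0) by [].
move: c0; move: (c) => c' c'0 c'E; rewrite (_ : v 0 0 - 1 = - (c' / 2)); last by rewrite c'E; field.
by field.
Qed.

(** Deflation: an orthogonal matrix moves a unit eigenvector to the first basis vector, and symmetry
    then splits off a smaller symmetric block. *)
Lemma real_spectral n (S : 'M[R]_n) : S^T = S ->
  exists (Q : 'M[R]_n) (D : 'rV[R]_n), Q *m Q^T = 1%:M /\ Q *m S *m Q^T = diag_mx D.
Proof.
elim: n S => [|n IH] S Ssym.
  by exists 1%:M, 0; split; apply/matrixP => -[].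
have [a [v [v0 vS]]] := symmetric_eigenvector Ssym.
have vv0 := sqnorm_gt0 v0; set c := (v *m v^T) 0 0 in vv0.
pose u := (Num.sqrt c)^-1 *: v.
have uu : u *m u^T = 1%:M.
  rewrite /u linearZ/= -scalemxAr -scalemxAl scalerA -invfM -expr2 sqr_sqrtr ?ltW//.
  by rewrite [v *m v^T]mx11_scalar -/c scale_scalar_mx mulVf// gt_eqF.
have uS : u *m S = a *: u by rewrite /u -scalemxAl vS !scalerA mulrC.
have [H [HH eH]] := orthogonal_with_first_row uu.
have [T defT] : exists T : 'M[R]_(1 + n), T = H *m S *m H^T by exists (H *m S *m H^T).
have Tsym : T^T = T by rewrite defT !trmx_mul trmxK Ssym mulmxA.
have rT : delta_mx 0 0 *m T = a *: (delta_mx 0 0 : 'rV_(1 + n)).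
  by rewrite defT !mulmxA eH uS -scalemxAl -eH -mulmxA HH mulmx1.
have T0 j : T 0 j = a * (j == 0)%:R.
  by have /rowP/(_ j) := rT; rewrite -rowE !mxE eqxx.
have Dsym : (drsubmx T)^T = drsubmx T by rewrite trmx_drsub Tsym.
have [Q' [D' [QQ QS]]] := IH _ Dsym.
have TE : T = block_mx a%:M 0 0 (drsubmx T).
  rewrite -[LHS]submxK; congr block_mx.
  - by apply/matrixP => i j; rewrite !ord1 !mxE lshift0 T0 !eqxx mulr1.
  - apply/matrixP => i j; rewrite !ord1 !mxE lshift0 T0.
    by rewrite (_ : rshift 1 j == 0 = false) ?mulr0.
  - apply/matrixP => i j; rewrite !ord1 !mxE -[T]Tsym mxE lshift0 T0.
    by rewrite (_ : rshift 1 i == 0 = false) ?mulr0.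
pose B : 'M[R]_(1 + n) := block_mx 1%:M 0 0 Q'.
have BT : B^T = block_mx 1%:M 0 0 Q'^T :> 'M[R]_(1 + n).
  by rewrite /B (@tr_block_mx _ 1 n 1 n) !trmx0 trmx1.
exists (B *m H), (row_mx a%:M D' : 'rV_(1 + n)); split.
  rewrite trmx_mul mulmxA -[B *m H *m _]mulmxA HH mulmx1 BT.
  rewrite (@mulmx_block _ 1 n 1 n 1 n) !mulmx0 !mul0mx !addr0 add0r mulmx1 QQ.
  by rewrite -scalar_mx_block.
rewrite trmx_mul (_ : B *m H *m S *m (H^T *m B^T) = B *m T *m B^T); last first.
  by rewrite defT !mulmxA.
rewrite TE BT !(@mulmx_block _ 1 n 1 n 1 n).
rewrite !mulmx0 !mul0mx !addr0 !add0r !mul1mx !mulmx1 QS.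
have E : diag_mx (row_mx (a%:M : 'rV[R]_1) D') =
    block_mx (diag_mx (a%:M : 'rV[R]_1)) 0 0 (diag_mx D').
  exact: diag_mx_row.
rewrite (_ : diag_mx (a%:M : 'rV[R]_1) = a%:M) in E; last first.
  by apply/matrixP => i j; rewrite !ord1 !mxE.
rewrite [X in block_mx _ X]mul0mx.
by rewrite -E.
Qed.

End RealSpectral.

Section SVD.
Variable R : realType.

Lemma real_spectral_sorted n (S : 'M[R]_n) : S^T = S ->
  exists (Q : 'M[R]_n) (D : 'rV[R]_n), [/\ Q *m Q^T = 1%:M, Q *m S *m Q^T = diag_mx D &
    forall i j : 'I_n, (i <= j)%N -> D 0 j <= D 0 i].
Proof.
move=> /real_spectral[Q [D [QQ QS]]].
pose t := [tuple D 0 i | i < n].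
have /tuple_permP[p tp] : perm_eq (sort (fun x y : R => y <= x) t) t by rewrite perm_sort.
have conjp (X : 'M[R]_n) : (row_perm p Q *m X *m (row_perm p Q)^T) =
    \matrix_(i, j) (Q *m X *m Q^T) (p i) (p j).
  rewrite tr_row_perm (_ : row_perm p Q *m X = row_perm p (Q *m X)); last first.
    by rewrite !row_permE mulmxA.
  by apply/matrixP => i j; rewrite !mxE; apply: eq_bigr => l _; rewrite !mxE.
exists (row_perm p Q), (\row_i D 0 (p i)); split.
- have := conjp 1%:M; rewrite !mulmx1 => ->; rewrite QQ.
  by apply/matrixP => i j; rewrite !mxE (inj_eq perm_inj).
- rewrite conjp QS; apply/matrixP => i j.
  by rewrite !mxE (inj_eq perm_inj).
- move=> i j ij; rewrite !mxE.
  have st : sorted (fun x y : R => y <= x) (sort (fun x y : R => y <= x) t).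
    by apply: sort_sorted => x y; exact: le_total.
  have nthE (l : 'I_n) : nth 0 (sort (fun x y : R => y <= x) t) l = D 0 (p l).
    by rewrite tp -tnth_nth !tnth_mktuple.
  rewrite -!nthE.
  apply: (sorted_leq_nth _ _ _ st) => //.
  - by move=> x y z; move=> h1 h2; exact: le_trans h2 h1.
  - by rewrite inE size_sort size_tuple.
  - by rewrite inE size_sort size_tuple.
Qed.

Lemma char_poly_conj n (Q Q' S : 'M[R]_n) : Q *m Q' = 1%:M ->
  char_poly (Q *m S *m Q') = char_poly S.
Proof.
move=> QQ; rewrite /char_poly.
have -> : char_poly_mx (Q *m S *m Q') =
   map_mx polyC Q *m char_poly_mx S *m map_mx polyC Q'.
  rewrite /char_poly_mx mulmxBr mulmxBl -!map_mxM/=; congr (_ - _).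
  rewrite -mulmxA mul_scalar_mx -scalemxAr -map_mxM/= QQ map_mx1.
  by rewrite scalemx1.
rewrite !det_mulmx mulrAC -det_mulmx -map_mxM/= QQ map_mx1 det1 mul1r//.
Qed.

(** The squares are the roots with multiplicity of one polynomial; the order and the nonnegativity
    determine the rest. *)
Lemma singular_values_unique n (M : 'M[R]_n) s s' :
  is_singular_values M s -> is_singular_values M s' -> s = s'.
Proof.
move=> [s0 sd sP] [s'0 s'd s'P].
have pe : perm_eq [tuple s 0 i ^+ 2 | i < n] [tuple s' 0 i ^+ 2 | i < n].
  apply: prod_XsubC_eq; rewrite !big_tuple; transitivity (char_poly (M^T *m M)).
    by rewrite sP; apply: eq_bigr => i _; rewrite tnth_mktuple.
  by rewrite s'P; apply: eq_bigr => i _; rewrite tnth_mktuple.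
have srt (u : 'rV[R]_n) : (forall i, 0 <= u 0 i) ->
    (forall i j : 'I_n, (i <= j)%N -> u 0 j <= u 0 i) ->
    sorted (fun x y : R => y <= x) [tuple (u 0 i) ^+ 2 | i < n].
  move=> u0 ud; apply/(sortedP 0) => i; rewrite size_tuple => h.
  have h' : (i < n)%N by exact: ltnW.
  have e (l : 'I_n) : nth 0 [tuple (u 0 i) ^+ 2 | i < n] l = u 0 l ^+ 2.
    by rewrite -tnth_nth tnth_mktuple.
  rewrite (e (Ordinal h)) (e (Ordinal h')) lerXn2r// ?nnegrE//.
  by apply: ud => /=.
have tr : transitive (fun x y : R => y <= x) by move=> y x z h1 h2; exact: le_trans h2 h1.
have an : antisymmetric (fun x y : R => y <= x) by move=> x y; rewrite andbC; exact: le_anti.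
have /val_inj E := sorted_eq tr an (srt _ s0 sd) (srt _ s'0 s'd) pe.
apply/rowP => i; apply/eqP; rewrite -(@eqrXn2 _ 2)//.
by have := congr1 (fun t => tnth t i) E; rewrite !tnth_mktuple => ->.
Qed.

(** [V] diagonalises M^T M, [s] holds the square roots of its eigenvalues, positive because [M] is
    invertible, and M V^T diag(1/s) is then orthogonal. *)
Lemma svd n (M : 'M[R]_n) : M \in unitmx ->
  exists (U V : 'M[R]_n) (s : 'rV[R]_n), [/\ U *m U^T = 1%:M, V *m V^T = 1%:M,
    M = U *m diag_mx s *m V, forall i, 0 < s 0 i &
    forall i : 'I_n, sigma M i = s 0 i].
Proof.
move=> Mu; pose S := M^T *m M.
have Ssym : S^T = S by rewrite /S trmx_mul trmxK.
have [V [D [VV VS Dd]]] := real_spectral_sorted Ssym.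
have VTV : V^T *m V = 1%:M by exact: mulmx1C.
have D0 i : 0 < D 0 i.
  have -> : D 0 i = ((row i V *m M^T) *m (row i V *m M^T)^T) 0 0.
    rewrite trmx_mul trmxK mulmxA -[_ *m M^T *m M]mulmxA -/S -row_mul tr_row.
    rewrite -[row i _ *m _]row_mul -colE || idtac.
    have -> : row i (V *m S) *m col i V^T = col i (row i (V *m S *m V^T)).
      by apply/matrixP => a b; rewrite !mxE; apply: eq_bigr => l _; rewrite !mxE.
    by rewrite VS !mxE eqxx mulr1n.
  apply: sqnorm_gt0; apply/negP => /eqP r0.
  have : row i V = 0 by rewrite -[LHS](mulmxK (_ : M^T \in unitmx)) ?unitmx_tr// r0 mul0mx.
  move=> /(congr1 (mulmx^~ V^T)); rewrite -row_mul VV mul0mx => /rowP/(_ i).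
  by rewrite !mxE eqxx => /eqP; rewrite oner_eq0.
have [s sqE] : exists s : 'rV[R]_n, forall i, s 0 i = Num.sqrt (D 0 i).
  by exists (\row_i Num.sqrt (D 0 i)) => i; rewrite mxE.
have s0 i : 0 < s 0 i by rewrite sqE sqrtr_gt0.
have s2 i : s 0 i ^+ 2 = D 0 i by rewrite sqE sqr_sqrtr// ltW.
pose si : 'rV[R]_n := \row_i (s 0 i)^-1.
have sis : diag_mx si *m diag_mx s = 1%:M.
  rewrite mulmx_diag; apply/matrixP => i j; rewrite !mxE.
  by rewrite mulVf// gt_eqF.
have sD : diag_mx s *m diag_mx s = diag_mx D.
  by rewrite mulmx_diag; congr diag_mx; apply/rowP => i; rewrite mxE -expr2 s2.
pose U := M *m V^T *m diag_mx si.
have svs : is_singular_values M s.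
  split=> [i|i j ij|]; first exact: ltW.
    by rewrite !sqE; apply: ler_wsqrtr; exact: Dd.
  rewrite -/S -(char_poly_conj _ VV) VS char_poly_trig ?diag_mx_is_trig//.
  by apply: eq_bigr => i _; rewrite s2 mxE eqxx mulr1n.
have UTU : U^T *m U = 1%:M.
  rewrite /U !trmx_mul trmxK tr_diag_mx !mulmxA.
  rewrite -[diag_mx si *m V *m M^T *m M]mulmxA -/S -[diag_mx si *m V *m S]mulmxA.
  rewrite -[diag_mx si *m (V *m S) *m V^T]mulmxA VS -sD mulmxA sis mul1mx.
  by apply: mulmx1C.
exists U, V, s; split=> //; first exact: mulmx1C.
  by rewrite /U -[_ *m diag_mx si *m _]mulmxA sis mulmx1 -mulmxA VTV mulmx1.
move=> i; rewrite /sigma; case: xgetP => [s' _ s'P|/(_ s)[]//].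
by rewrite (singular_values_unique s'P svs).
Qed.

Lemma sigma_gt0 n (M : 'M[R]_n) i : M \in unitmx -> 0 < sigma M i.
Proof. by move=> /svd[U [V [s [_ _ _ s0 ->]]]]. Qed.

Lemma sigma_anti n (M : 'M[R]_n) (i j : 'I_n) : M \in unitmx ->
  (i <= j)%N -> sigma M j <= sigma M i.
Proof.
move=> Mu ij; rewrite /sigma; case: xgetP => [s _ [_ sd _]|_]; first exact: sd.
by rewrite !mxE.
Qed.

Lemma prod_sigma_det n (M : 'M[R]_n) : M \in unitmx ->
  \prod_(i < n) sigma M i = `|\det M|.
Proof.
move=> /svd[U [V [s [UU VV -> s0 sE]]]].
have nrm (X : 'M[R]_n) : X *m X^T = 1%:M -> `|\det X| = 1.
  move=> /(congr1 determinant); rewrite det_mulmx det_tr det1 => h.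
  apply/eqP; rewrite -(@eqrXn2 _ 2)// expr1n real_normK ?num_real// expr2 h.
  by [].
under eq_bigr do rewrite sE.
rewrite !det_mulmx !normrM (nrm _ UU) (nrm _ VV) mul1r mulr1 det_diag.
by rewrite ger0_norm// prodr_ge0// => i _; exact: ltW.
Qed.

End SVD.

(** * Exterior powers and products of singular values *)

Section ExtPower.
Variable R : realType.
Variables t d : nat.

Lemma ext_powerM (M N : 'M[R]_d) : ext_power t (M *m N) = ext_power t M *m ext_power t N.
Proof.
apply/matrixP => I J; rewrite mxE.
have -> : (fun b : 'I_t => col (tnth (enum_val J) b) (M *m N)) =
    (fun b => M *m col (tnth (enum_val J) b) N).
  by apply/funext => b; rewrite !colE mulmxA.
rewrite -ext_power_wedge !mxE; apply: eq_bigr => l _.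
by rewrite [ext_power t N l J]mxE.
Qed.

Lemma ext_powerE (M : 'M[R]_d) I J : ext_power t M I J =
  \det (\matrix_(a < t, b < t) M (tnth (enum_val I) a) (tnth (enum_val J) b)).
Proof. by rewrite !mxE; congr (\det _); apply/matrixP => a b; rewrite !mxE. Qed.

Lemma ext_index_sorted (I : 'I_(ext_dim t d)) : sorted ltn (map val (enum_val I)).
Proof. by have := enum_valP I; rewrite inE. Qed.

Lemma ext_index_inj (I : 'I_(ext_dim t d)) : injective (tnth (enum_val I)).
Proof.
apply/tuple_uniqP; have := sorted_uniq ltn_trans ltnn (ext_index_sorted I).
exact: map_uniq.
Qed.

(** Off the diagonal, two distinct increasing tuples of equal length differ as sets, so some index
    of [I] is missing from [J] and the minor has a zero row. *)
Lemma ext_power_diag (s : 'rV[R]_d) : ext_power t (diag_mx s) =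
  diag_mx (\row_I \prod_(a < t) s 0 (tnth (enum_val I) a)).
Proof.
apply/matrixP => I J; rewrite ext_powerE [RHS]mxE.
have [<-|IJ] := eqVneq I J.
  rewrite mulr1n [RHS]mxE.
  transitivity (\det (diag_mx (\row_a s 0 (tnth (enum_val I) a)))).
    congr (\det _); apply/matrixP => a b.
    by rewrite !mxE (inj_eq (@ext_index_inj I)).
  by rewrite det_diag; apply: eq_bigr => a _; rewrite mxE.
rewrite mulr0n.
have [a ha] : exists a, forall b, tnth (enum_val I) a != tnth (enum_val J) b.
  apply: contrapT => /forallNP h; move/eqP: IJ; apply; apply: enum_val_inj.
  have sub : {subset enum_val I <= enum_val J}.
    move=> x /tnthP[a ->]; have /existsNP[b /negP] := h a.
    by rewrite negbK => /eqP ->; exact: mem_tnth.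
  have uI : uniq (enum_val I) by apply/tuple_uniqP; exact: ext_index_inj.
  have szle : (size (enum_val J) <= size (enum_val I))%N by rewrite !size_tuple.
  have [_ eqm] := uniq_min_size uI sub szle.
  apply: val_inj; apply: (inj_map val_inj).
  apply: (irr_sorted_eq ltn_trans ltnn (ext_index_sorted I) (ext_index_sorted J)).
  exact: eq_mem_map.
rewrite (expand_det_row _ a) big1// => b _.
by rewrite mxE [diag_mx _ _ _]mxE (negbTE (ha b)) mulr0n mul0r.
Qed.

(** This stands in for the operator norm of the exterior power: it is submultiplicative, and the
    constants by which it differs are harmless for quasi-additivity. *)
Definition ext_norm (M : 'M[R]_d) : R := \sum_I \sum_J `|ext_power t M I J|.

Lemma ext_norm_ge0 M : 0 <= ext_norm M.
Proof. by rewrite sumr_ge0// => I _; rewrite sumr_ge0. Qed.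

Lemma ext_norm_entry M I J : `|ext_power t M I J| <= ext_norm M.
Proof.
rewrite /ext_norm (bigD1 I)//= (bigD1 J)//= -addrA lerDl addr_ge0 ?sumr_ge0// => i _.
by rewrite sumr_ge0.
Qed.

Lemma ext_normM M N : ext_norm (M *m N) <= ext_norm M * ext_norm N.
Proof.
rewrite /ext_norm mulr_suml; apply: ler_sum => I _; rewrite mulr_suml.
apply: (@le_trans _ _ (\sum_J \sum_K `|ext_power t M I K| * `|ext_power t N K J|)).
  apply: ler_sum => J _; rewrite ext_powerM mxE; apply: le_trans (ler_norm_sum _ _ _) _.
  by apply: ler_sum => K _; rewrite normrM.
rewrite exchange_big/=; apply: ler_sum => K _; rewrite -mulr_sumr ler_wpM2l//.
by rewrite [leRHS](bigD1 K)//= lerDl sumr_ge0// => i _; rewrite sumr_ge0.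
Qed.

Lemma orthogonal_entry (U : 'M[R]_d) i j : U *m U^T = 1%:M -> `|U i j| <= 1.
Proof.
move=> UU; have := congr1 (fun M : 'M[R]_d => M i i) UU; rewrite !mxE eqxx => h.
rewrite -(@ler_pXn2r _ 2)// ?nnegrE// expr1n real_normK ?num_real//.
rewrite -[leRHS]/(true%:R) -h.
rewrite (bigD1 j)//= mxE -expr2 lerDl sumr_ge0// => l _.
by rewrite mxE -expr2 sqr_ge0.
Qed.

Lemma ext_norm_orthogonal (U : 'M[R]_d) : U *m U^T = 1%:M ->
  ext_norm U <= (ext_dim t d * ext_dim t d * t`!)%:R.
Proof.
move=> UU; rewrite /ext_norm.
apply: (@le_trans _ _ (\sum_(I < ext_dim t d) \sum_(J < ext_dim t d) (t`!)%:R)).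
  apply: ler_sum => I _; apply: ler_sum => J _; rewrite ext_powerE /determinant.
  apply: le_trans (ler_norm_sum _ _ _) _.
  rewrite -card_Sn -[#|_|]sum1_card natr_sum; apply: ler_sum => s _.
  rewrite normrM normrX normrN1 expr1n mul1r normr_prod.
  by apply: prodr_ile1 => a _; rewrite mxE normr_ge0/= orthogonal_entry.
by rewrite !sumr_const !card_ord -mulrnA -[leLHS]mulr_natr -natrM mulnC.
Qed.

(** Since singular values decrease, this makes the first t indices the tuple with the largest
    product. *)
Lemma ext_index_ge (I : 'I_(ext_dim t d)) (a : 'I_t) : (a <= tnth (enum_val I) a)%N.
Proof.
have srt := ext_index_sorted I.
have sz : size (map val (enum_val I)) = t by rewrite size_map size_tuple.
have h (i : nat) : (i < t)%N -> (i <= nth 0%N (map val (enum_val I)) i)%N.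
  elim: i => // i IH ilt; apply: leq_ltn_trans (IH (ltnW ilt)) _.
  by apply: (sorted_ltn_nth ltn_trans _ srt) => //; rewrite inE sz// ltnW.
have := h a (ltn_ord a).
rewrite (nth_map (tnth (enum_val I) a)) ?size_tuple//.
by rewrite -tnth_nth.
Qed.

Hypothesis td : (t <= d)%N.

Lemma ext_top_subproof : [tuple widen_ord td a | a < t] \in ext_index t d.
Proof.
rewrite inE -map_comp (_ : map _ _ = iota 0 t) ?iota_ltn_sorted//.
by rewrite -[RHS]val_enum_ord; apply: eq_map.
Qed.

Definition ext_top : 'I_(ext_dim t d) :=
  enum_rank_in ext_top_subproof [tuple widen_ord td a | a < t].

Lemma ext_topE a : tnth (enum_val ext_top) a = widen_ord td a.
Proof. by rewrite /ext_top enum_rankK_in ?ext_top_subproof// tnth_mktuple. Qed.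

Definition sigma_prod (M : 'M[R]_d) : R := \prod_(i < d | (i < t)%N) sigma M i.

Lemma sigma_prod_gt0 M : M \in unitmx -> 0 < sigma_prod M.
Proof. by move=> Mu; apply: prodr_gt0 => i _; exact: sigma_gt0. Qed.

(** A singular value decomposition reduces both bounds to a diagonal matrix, because t-minors of
    orthogonal matrices are at most t! in absolute value. *)
Lemma sigma_prod_ext_norm (K : R) : K = (ext_dim t d * ext_dim t d * t`!)%:R ->
  forall M : 'M[R]_d, M \in unitmx ->
  sigma_prod M <= K ^+ 2 * ext_norm M /\
  ext_norm M <= K ^+ 2 * (ext_dim t d)%:R * sigma_prod M.
Proof.
move=> KE M Mu; have K0 : 0 <= K by rewrite KE.
have [U [V [s [UU VV ME s0 sE]]]] := svd Mu.
have UTU : U^T *m U = 1%:M by exact: mulmx1C.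
have VTV : V^T *m V = 1%:M by exact: mulmx1C.
have oN (X : 'M[R]_d) : X *m X^T = 1%:M -> ext_norm X <= K.
  by rewrite KE; exact: ext_norm_orthogonal.
have sp : sigma_prod M = ext_power t (diag_mx s) ext_top ext_top.
  rewrite ext_power_diag !mxE eqxx mulr1n /sigma_prod (big_ord_narrow td)/=.
  by apply: eq_bigr => a _; rewrite sE ext_topE.
have sU : diag_mx s = U^T *m M *m V^T.
  by rewrite ME !mulmxA UTU mul1mx -mulmxA VV mulmx1.
split.
  rewrite sp; apply: le_trans (ler_norm _) _; apply: le_trans (ext_norm_entry _ _ _) _.
  rewrite sU; apply: le_trans (ext_normM _ _) _.
  rewrite expr2 -mulrA [K * (K * _)]mulrC.
  apply: ler_pM; rewrite ?ext_norm_ge0//; last by apply: oN; rewrite trmxK.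
  apply: le_trans (ext_normM _ _) _; rewrite ler_wpM2r ?ext_norm_ge0//.
  by apply: oN; rewrite trmxK.
have sn : ext_norm (diag_mx s) <= (ext_dim t d)%:R * sigma_prod M.
  rewrite /ext_norm ext_power_diag mulr_natl -[X in _ *+ X]card_ord -sumr_const.
  apply: ler_sum => I _; rewrite (bigD1 I)//= big1 ?addr0 => [|J JI]; last first.
    by rewrite mxE eq_sym (negbTE JI) mulr0n normr0.
  rewrite !mxE eqxx mulr1n ger0_norm; last by rewrite prodr_ge0// => a _; exact: ltW.
  rewrite /sigma_prod (big_ord_narrow td)/=; apply: ler_prod => a _.
  by rewrite ltW//= -!sE sigma_anti//= ext_index_ge.
rewrite {1}ME; apply: le_trans (ext_normM _ _) _.
rewrite expr2 -!mulrA mulrC [leRHS]mulrC -[leRHS]mulrA || idtac.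
apply: (@le_trans _ _ (K * (K * ext_norm (diag_mx s)))); last first.
  by rewrite [leRHS](_ : _ = K * (K * ((ext_dim t d)%:R * sigma_prod M))); [rewrite !ler_wpM2l|ring].
rewrite ler_pM ?ext_norm_ge0//; first exact: oN.
apply: le_trans (ext_normM _ _) _; rewrite ler_wpM2r ?ext_norm_ge0//; exact: oN.
Qed.

End ExtPower.

(** * Transversality of bridges *)

Section Dominance.
Variables (R : realType) (D : nat).
Implicit Types (M W : 'M[R]_D).

Lemma free_sum_eq0 (vT : vectType R) (T : eqType) (s : seq T) (f : T -> vT) (c : T -> R) :
  free [seq f i | i <- s] -> \sum_(i <- s) c i *: f i = 0 -> forall i, i \in s -> c i = 0.
Proof.
elim: s => // x s IH; rewrite /= free_cons => /andP[nx fs].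
rewrite big_cons => sum0.
have cx : c x = 0.
  apply/eqP; apply: contraNT nx => cx.
  have -> : f x = - (c x)^-1 *: \sum_(i <- s) c i *: f i.
    rewrite scaleNr; apply/eqP; rewrite eq_sym eqr_oppLR; apply/eqP.
    apply: (scalerI cx); rewrite scalerA mulfV// scale1r scalerN.
    by apply/eqP; rewrite -addr_eq0 addrC; apply/eqP.
  rewrite memvZ// big_seq memv_suml// => i si; rewrite memvZ//.
  by apply: memv_span; exact: map_f.
move: sum0; rewrite cx scale0r add0r => /(IH fs) h i.
by rewrite inE => /predU1P[->//|]; exact: h.
Qed.

(** Two instances of general position suffice. With I empty and J full, the eigenvectors form a
    basis. With I = {j} and J the complement of {i}, the vector W v_j is outside the span of the
    other v_l, so its i-th coordinate is nonzero. *)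
Lemma general_position_spectral M W :
  M \in unitmx -> eigenvalues_simple_moduli M -> eigenvectors_in_general_position M W ->
  exists (V : 'M[R]_D) (a : 'I_D -> R), [/\ V \in unitmx,
    M *m V = V *m diag_mx (\row_i a i), (forall i, a i != 0),
    (forall i j, `|a i| = `|a j| -> i = j) &
    forall i j, (invmx V *m W *m V) i j != 0].
Proof.
move=> Mu [_ smod] [a [v [ainj va vfree]]].
pose V : 'M[R]_D := \matrix_(i, j) v j i 0.
have colV j : col j V = v j by apply/colP => i; rewrite !mxE.
have mulV (c : 'cV[R]_D) : V *m c = \sum_j c j 0 *: v j.
  apply/colP => i; rewrite summxE mxE; apply: eq_bigr => j _.
  by rewrite !mxE mulrC.
have Vu : V \in unitmx.
  rewrite -unitmx_tr -row_free_unit; apply: inj_row_free => u uV.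
  have Vu0 : V *m u^T = 0 by rewrite -[LHS]trmxK trmx_mul trmxK uV trmx0.
  have fr : free [seq v j | j <- enum [set: 'I_D]%SET].
    have := vfree finset.set0 [set: 'I_D]%SET; rewrite cards0 cardsT card_ord add0n => /(_ (leqnn _)).
    by rewrite enum_set0.
  apply/rowP => j; rewrite [RHS]mxE.
  apply: (free_sum_eq0 fr _ (_ : j \in _)); last by rewrite mem_enum inE.
  rewrite big_enum/= -[RHS]Vu0 mulV; apply: eq_big => [i|i _]; first by rewrite inE.
  by rewrite mxE.
have MV : M *m V = V *m diag_mx (\row_i a i).
  apply/matrixP => i j; have := congr1 (fun c : 'cV[R]_D => c i 0) (va j).2.
  rewrite mul_mx_diag !mxE mulrC => <-.
  by apply: eq_bigr => l _; rewrite !mxE.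
have a0 i : a i != 0.
  apply/negP => /eqP ai0; have [vi0 Mvi] := va i.
  move: vi0; rewrite -[v i](mulKmx Mu) Mvi ai0 scale0r mulmx0 eqxx//.
have ME : M = V *m diag_mx (\row_i a i) *m invmx V by rewrite -MV mulmxK.
have aroot i : root (char_poly (map_mx (real_complex R) M)) (real_complex R (a i)).
  rewrite -map_char_poly fmorph_root ME char_poly_conj ?mulmxV//.
  rewrite char_poly_trig ?diag_mx_is_trig// rootE horner_prod; apply/eqP.
  by rewrite (bigD1 i)//= !mxE eqxx mulr1n hornerXsubC subrr mul0r.
exists V, a; split=> // [i j aij|i j].
  apply: ainj; apply: (fmorph_inj (real_complex R)).
  apply: (smod _ _ (aroot i) (aroot j)).
  by move/eqP: aij; rewrite eqr_norm2 => /orP[/eqP->|/eqP->]//; rewrite rmorphN normrN.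
apply/negP => /eqP W0.
have := vfree [set j]%SET (~: [set i])%SET.
rewrite cards1 cardsC1 card_ord add1n prednK ?(leq_ltn_trans (leq0n i) (ltn_ord i))//.
move=> /(_ (leqnn _)); rewrite enum_set1/= free_cons => /andP[/negP nW _]; apply: nW.
have -> : W *m v j = \sum_l (invmx V *m W *m V) l j *: v l.
  rewrite -colV !colE.
  have -> : W *m (V *m (delta_mx j 0 : 'cV[R]_D)) =
      V *m (invmx V *m W *m V *m (delta_mx j 0 : 'cV[R]_D)).
    by rewrite !mulmxA mulmxV// mul1mx.
  by rewrite mulV; apply: eq_bigr => l _; rewrite -colE mxE.
rewrite (bigD1 i)//= W0 scale0r add0r memv_suml// => l li.
rewrite memvZ//; apply: memv_span; apply: map_f.
by rewrite mem_enum !inE.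
Qed.

Definition mxpow (M : 'M[R]_D) n := iter n (mulmx M) 1%:M.

Lemma mxpowD M m n : mxpow M (m + n) = mxpow M m *m mxpow M n.
Proof. by elim: m => [|m IH]; rewrite ?mul1mx// addSn /= IH mulmxA. Qed.

Lemma mxpow_diag M (V : 'M[R]_D) (a : 'I_D -> R) n : M *m V = V *m diag_mx (\row_i a i) ->
  mxpow M n *m V = V *m diag_mx (\row_i a i ^+ n).
Proof.
move=> MV; elim: n => [|n IH].
  rewrite mul1mx (_ : diag_mx _ = 1%:M) ?mulmx1//.
  by apply/matrixP => i j; rewrite !mxE expr0.
rewrite /= -mulmxA IH mulmxA MV -mulmxA mulmx_diag; congr (_ *m diag_mx _).
by apply/rowP => i; rewrite !mxE exprS.
Qed.

Lemma max_modulus (f a : 'I_D -> R) i0 : f i0 != 0 ->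
  exists2 i, f i != 0 & forall j, f j != 0 -> `|a j| <= `|a i|.
Proof.
move=> f0; have := @Order.TotalTheory.arg_maxP _ _ _ i0 (fun i => f i != 0) (fun i => `|a i|) f0.
by case=> i fi h; exists i.
Qed.

(* In the eigenbasis the product is a sum of terms [c_ij (a_i a_j)^n]; the pair
   of largest moduli occurring in [psi] and [u] dominates. *)
Lemma eventually_transverse M W (psi : 'rV[R]_D) (u : 'cV[R]_D) :
  M \in unitmx -> eigenvalues_simple_moduli M -> eigenvectors_in_general_position M W ->
  psi != 0 -> u != 0 ->
  \forall n \near \oo, (psi *m mxpow M n *m W *m mxpow M n *m u) 0 0 != 0.
Proof.
move=> Mu sm gp psi0 u0.
have [V [a [Vu MV a0 amod w0]]] := general_position_spectral Mu sm gp.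
have [w wE] : exists w, w = invmx V *m W *m V by exists (invmx V *m W *m V).
rewrite -wE in w0.
have [x xE] : exists x, x = psi *m V by exists (psi *m V).
have [y yE] : exists y, y = invmx V *m u by exists (invmx V *m u).
have [i0 xi0] : exists i, x 0 i != 0.
  have : x != 0 by apply: contra psi0 => /eqP x0; rewrite -[psi](mulmxK Vu) -xE x0 mul0mx.
  by move=> /rV0Pn.
have [j0 yj0] : exists j, y j 0 != 0.
  have : y != 0 by apply: contra u0 => /eqP y0; rewrite -[u](mulKVmx Vu) -yE y0 mulmx0.
  by move=> /cV0Pn.
have [i1 xi1 imax] := max_modulus a xi0.
have [j1 yj1 jmax] := max_modulus a (f := fun j => y j 0) yj0.
have powE n : mxpow M n = V *m diag_mx (\row_i a i ^+ n) *m invmx V.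
  by rewrite -(mxpow_diag n MV) mulmxK.
pose c (ij : 'I_D * 'I_D) := x 0 ij.1 * w ij.1 ij.2 * y ij.2 0.
pose rr (ij : 'I_D * 'I_D) := a ij.1 * a ij.2 / (a i1 * a j1).
have sumE n : (psi *m mxpow M n *m W *m mxpow M n *m u) 0 0 =
    \sum_ij c ij * (a ij.1 * a ij.2) ^+ n.
  have -> : psi *m mxpow M n *m W *m mxpow M n *m u =
      (x *m diag_mx (\row_i a i ^+ n)) *m w *m (diag_mx (\row_i a i ^+ n) *m y).
    by rewrite powE xE wE yE !mulmxA.
  rewrite mxE; under eq_bigr do rewrite mxE mulr_suml.
  rewrite exchange_big pair_big/=; apply: eq_bigr => -[i j] _ /=.
  rewrite mul_mx_diag mul_diag_mx !mxE /c/= exprMn; ring.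
have den : a i1 * a j1 != 0 by rewrite mulf_neq0.
have cvg : (fun n => \sum_ij c ij * rr ij ^+ n) @ \oo --> \sum_ij c ij * (ij == (i1, j1))%:R.
  apply: cvg_big => [|[i j] _]; first exact: add_continuous.
  (* The ratio [rr] need not be at most 1 in modulus for pairs outside the supports of [x] and [y],
     but there the coefficient vanishes. *)
  have [c0|c0] := eqVneq (c (i, j)) 0.
    by rewrite c0 mul0r; under eq_fun do rewrite mul0r; exact: cvg_cst.
  apply: cvgMl_tmp.
  have [[-> ->]|ne] := eqVneq (i, j) (i1, j1).
    rewrite (_ : rr (i1, j1) = 1); last by rewrite /rr/= mulfV.
    by apply: cvg_near_cst; apply: nearW => n; rewrite expr1n.
  apply: cvg_expr; rewrite /rr/= normrM normfV !normrM ltr_pdivrMr; last first.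
    by rewrite mulr_gt0 ?normr_gt0.
  move: c0; rewrite /c/= !mulf_eq0 !negb_or => /andP[/andP[xi _] yj].
  rewrite mul1r; have hi := imax i xi; have hj := jmax j yj.
  have [ii|ii] := eqVneq i i1.
    rewrite ii ltr_pM2l ?normr_gt0// lt_neqAle hj andbT.
    apply/negP => /eqP /amod jj; move/eqP: ne; apply; by rewrite ii jj.
  have {}hi : `|a i| < `|a i1|.
    by rewrite lt_neqAle hi andbT; apply: contra ii => /eqP /amod ->.
  apply: (@le_lt_trans _ _ (`|a i| * `|a j1|)); first by rewrite ler_wpM2l.
  by rewrite ltr_pM2r ?normr_gt0.
have limE : \sum_ij c ij * (ij == (i1, j1))%:R = c (i1, j1).
  rewrite (bigD1 (i1, j1))//= eqxx mulr1 big1 ?addr0// => ij /negbTE ->.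
  by rewrite mulr0.
have c10 : 0 < `|c (i1, j1)| by rewrite normr_gt0 /c/= !mulf_neq0.
rewrite limE in cvg; move/cvgrPdist_lt : cvg => /(_ _ c10).
apply: filterS => n hn; rewrite sumE; apply/negP => /eqP s0.
have : \sum_ij c ij * rr ij ^+ n = 0.
  transitivity ((\sum_ij c ij * (a ij.1 * a ij.2) ^+ n) * (a i1 * a j1) ^- n).
    by rewrite mulr_suml; apply: eq_bigr => ij _; rewrite /rr exprMn exprVn mulrA.
  by rewrite s0 mul0r.
by move=> e; move: hn; rewrite e subr0 ltxx.
Qed.

End Dominance.

(** * Products along words *)

Section WordProducts.
Variables (R : realType) (k D : nat) (B : 'I_k -> 'M[R]_D).
Hypothesis Bu : forall i, B i \in unitmx.
Implicit Types x p z : Sigma k.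

Definition wprod (w : seq 'I_k) : 'M[R]_D := foldl (fun M i => B i *m M) 1%:M w.

Lemma wprod_cat u v : wprod (u ++ v) = wprod v *m wprod u.
Proof using Type.
rewrite /wprod foldl_cat; move: (foldl _ _ u) => M.
elim/last_ind: v => [|v a IH]; first by rewrite mul1mx.
by rewrite !foldl_rcons IH mulmxA.
Qed.

Lemma wprod_rcons w a : wprod (rcons w a) = B a *m wprod w.
Proof using Type. by rewrite /wprod foldl_rcons. Qed.

Lemma wprod_cons w a : wprod (a :: w) = wprod w *m B a.
Proof using Type. by rewrite -cat1s wprod_cat /wprod/= mulmx1. Qed.

Lemma wprod_unit w : wprod w \in unitmx.
Proof using Bu.
elim/last_ind: w => [|w a IH]; first exact: unitmx1.
by rewrite wprod_rcons unitmx_mul Bu.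
Qed.

Definition seg x (m : int) n : seq 'I_k := [seq x (m + j%:Z) | j <- iota 0 n].

Lemma segD x m a b : seg x m (a + b) = seg x m a ++ seg x (m + a%:Z) b.
Proof using Type.
rewrite /seg iotaD map_cat; congr (_ ++ _).
rewrite add0n -[X in iota X _]addn0 iotaDl -map_comp; apply: eq_map => j /=.
by rewrite PoszD addrA.
Qed.

Lemma seg_pref x n : seg x 0 n = pref x n.
Proof using Type. by apply: eq_map => j; rewrite add0r. Qed.

Lemma eq_seg x y m m' n : (forall j, (j < n)%N -> x (m + j%:Z) = y (m' + j%:Z)) ->
  seg x m n = seg y m' n.
Proof using Type.
by move=> h; apply/eq_in_map => j; rewrite mem_iota add0n => /andP[_]; exact: h.
Qed.

Lemma cocycle_posE n x : cocycle_pos B n x = wprod (pref x n).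
Proof using Type.
elim: n => //= n ->; rewrite -!seg_pref -addn1 segD cats1 wprod_rcons.
by rewrite /one_step /sshift addr0.
Qed.

Lemma invmx_mul (M N : 'M[R]_D) : M \in unitmx -> N \in unitmx ->
  invmx (M *m N) = invmx N *m invmx M.
Proof using Type.
move=> Mu Nu; have MNu : M *m N \in unitmx by rewrite unitmx_mul Mu.
by rewrite -[RHS](mulmxK MNu) -!mulmxA (mulKmx Mu) !mulmxA mulVmx// mul1mx.
Qed.

Lemma cocycle_negE n x : cocycle_neg B n x = invmx (wprod (seg x (- n%:Z) n)).
Proof using Bu.
elim: n => [|n IH]; first by rewrite /seg/= invmx1.
rewrite [LHS]/= IH -[in RHS]add1n segD [seg _ _ 1]/= cat1s wprod_cons.
rewrite invmx_mul ?wprod_unit//; congr (invmx _ *m invmx (wprod (seg _ _ _))).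
by lia.
Qed.

Lemma cocycle_opp n x : cocycle B (- n%:Z) x = invmx (wprod (seg x (- n%:Z) n)).
Proof using Bu.
by rewrite -cocycle_negE; case: n.
Qed.

Lemma limn_eventually (f : nat -> 'M[R]_D) N c : (forall n, (N <= n)%N -> f n = c) ->
  limn f = c.
Proof using Type.
move=> h; apply/cvg_lim => //.
by apply: cvg_near_cst; exists N.
Qed.

Section Loop.
Variables (p z : Sigma k) (n0 a : nat).
Hypothesis p_per : forall l, p (l + n0%:Z) = p l.
Let N := (a * n0)%N.
Hypothesis z_right : forall l, N%:Z <= l -> z l = p l.
Hypothesis z_left : forall l, l < - N%:Z -> z l = p l.
Let P := wprod (pref p n0).

Lemma periodic_shift b l : p (l + (b * n0)%N%:Z) = p l.
Proof using p_per.
elim: b l => [|b IH] l; first by rewrite addr0.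
by rewrite mulSn PoszD addrA IH p_per.
Qed.

Lemma wprod_period b : wprod (pref p (b * n0)) = mxpow P b.
Proof using p_per.
elim: b => // b IH; rewrite mulSnr -seg_pref segD wprod_cat seg_pref IH /=.
congr (wprod _ *m _); rewrite -seg_pref; apply: eq_seg => j _.
by rewrite !add0r addrC periodic_shift.
Qed.

Lemma loop_stable : Hs B p z = invmx (wprod (pref p N)) *m wprod (pref z N).
Proof using Bu z_right.
apply: (@limn_eventually _ N) => n Nn.
rewrite /cocycle !cocycle_posE -(subnKC Nn) -!seg_pref !segD !wprod_cat add0r.
have -> : seg z N%:Z (n - N) = seg p N%:Z (n - N).
  by apply: eq_seg => j _; apply: z_right; rewrite lerDl.
by rewrite invmx_mul ?wprod_unit// -mulmxA mulKmx ?wprod_unit.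
Qed.

Lemma loop_unstable :
  Hu B z p = wprod (seg z (- N%:Z) N) *m invmx (wprod (seg p (- N%:Z) N)).
Proof using Bu z_left.
apply: (@limn_eventually _ N) => n Nn.
have nE : n = ((n - N) + N)%N by rewrite subnK.
rewrite !cocycle_opp [X in seg _ _ X]nE [in X in _ *m X]nE !segD.
have -> : - (n - N + N)%N%:Z + (n - N)%N%:Z = - N%:Z by lia.
have -> : - n%:Z + (n - N)%N%:Z = - N%:Z by lia.
rewrite !wprod_cat.
have -> : seg z (- n%:Z) (n - N) = seg p (- (n - N + N)%N%:Z) (n - N).
  by rewrite -nE; apply: eq_seg => j jn; apply: z_left; lia.
by rewrite invmxK invmx_mul ?wprod_unit// mulmxA mulmxK ?wprod_unit.
Qed.

(** The excursion window extends over [a] periods on each side, so the loop equals P^(-a) Z P^(-a)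
    with Z the product along the excursion; hence P^j Z P^j has exponent j + a around the loop. *)
Lemma bridge_product j :
  wprod (pref p (j * n0) ++ seg z (- N%:Z) (N + N) ++ pref p (j * n0)) =
  mxpow P (j + a) *m holonomy_loop B p z *m mxpow P (j + a).
Proof using Bu p_per z_right z_left.
have Pu b : mxpow P b \in unitmx by rewrite -wprod_period wprod_unit.
rewrite /holonomy_loop loop_stable loop_unstable.
have -> : seg p (- N%:Z) N = pref p N.
  rewrite -seg_pref; apply: eq_seg => l _; rewrite -(periodic_shift a).
  by congr p; lia.
rewrite !wprod_cat segD (_ : - N%:Z + N%:Z = 0); last by rewrite addNr.
have PN : wprod (pref p N) = mxpow P a by exact: wprod_period.
have eR : mxpow P (j + a) = mxpow P a *m mxpow P j by rewrite addnC mxpowD.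
rewrite wprod_cat seg_pref PN wprod_period [X in _ = _ *m X]eR.
rewrite [in RHS]mxpowD.
by rewrite -!mulmxA mulKVmx// mulKmx.
Qed.

End Loop.
End WordProducts.

Section Transversality.
Variables (R : realType) (k d : nat) (A : 'I_k -> 'M[R]_d).
Hypothesis Au : forall i, A i \in unitmx.

Lemma ext_power1 t : ext_power t (1%:M : 'M[R]_d) = 1%:M.
Proof using Type.
rewrite -[X in ext_power _ X]diag_const_mx ext_power_diag -[RHS]diag_const_mx; congr diag_mx.
by apply/rowP => I; rewrite !mxE big1// => a _; rewrite mxE.
Qed.

Lemma ext_power_unit t (M : 'M[R]_d) : M \in unitmx -> ext_power t M \in unitmx.
Proof using Type.
move=> Mu; have : ext_power t M *m ext_power t (invmx M) = 1%:M.
  by rewrite -ext_powerM mulmxV// ext_power1.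
by move=> /mulmx1_unit[].
Qed.

Lemma wprod_ext t w : wprod (fun i => ext_power t (A i)) w = ext_power t (wprod A w).
Proof using Type.
elim/last_ind: w => [|w a IH]; first by rewrite /wprod/= ext_power1.
by rewrite !wprod_rcons IH ext_powerM.
Qed.

Lemma per_period (p : Sigma k) : Defs.periodic p -> periods p (per p).
Proof using Type.
move=> [n pn]; rewrite /per; case: xgetP => [m _ []//|no].
have ex0 : exists m, `[< periods p m >] by exists n; apply/asboolP.
have [m /asboolP pm mmin] := ex_minnP ex0.
by case: (no m); split=> // m' /asboolP /mmin.
Qed.

(** Because one pair (p, z) serves all exterior powers, one sequence of bridge words works for every
    t. *)
Lemma typical_transverse : typical A -> exists w : nat -> seq 'I_k,
  forall (t : nat) (psi : 'rV[R]_(ext_dim t d)) (u : 'cV[R]_(ext_dim t d)),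
    (1 <= t <= d.-1)%N -> psi != 0 -> u != 0 ->
    \forall j \near \oo, (psi *m ext_power t (wprod A (w j)) *m u) 0 0 != 0.
Proof using Au.
move=> [p [z [pper [zp [[m m0 mW] [m' m'0 mW']]] typ]]].
have [n0_gt0 pn0] := per_period pper; set n0 := per p in n0_gt0 pn0.
have p_per l : p (l + n0%:Z) = p l by rewrite -[in RHS]pn0.
(* With this many periods the window contains all coordinates where z and p may differ. *)
pose a := (`|m| + `|m'|)%N.
have aN : (a <= a * n0)%N by rewrite leq_pmulr.
have zr l : (a * n0)%N%:Z <= l -> z l = p l.
  by move=> h; have := mW (l - m); rewrite /sshift subrK; apply; lia.
have zl l : l < - (a * n0)%N%:Z -> z l = p l.
  by move=> h; have := mW' (l - m'); rewrite /sshift subrK; apply; lia.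
exists (fun j => pref p (j * n0) ++ seg z (- (a * n0)%N%:Z) (a * n0 + a * n0) ++ pref p (j * n0)).
move=> t psi u td psi0 u0.
have [_ _ sm gp] := typ t td.
have Bu i : ext_power t (A i) \in unitmx by exact: ext_power_unit.
have cE : cocycle (fun i => ext_power t (A i)) (per p)%:Z p =
    wprod (fun i => ext_power t (A i)) (pref p n0) by exact: cocycle_posE.
rewrite cE in sm gp.
have Pu := wprod_unit Bu (pref p n0).
have [n1 _ ev] := eventually_transverse Pu sm gp psi0 u0.
exists n1 => // j /= nj; have := ev (j + a)%N; rewrite /= => h.
rewrite -wprod_ext (bridge_product Bu p_per zr zl).
move: h; move: (holonomy_loop _ _ _) => L h; rewrite !mulmxA.
by apply: h; exact: leq_trans (leq_addr _ _).
Qed.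

End Transversality.

(** * Compactness of the orthogonal group and uniform transversality *)

Section Continuity.
Variables (R : realType) (T : topologicalType).
Implicit Types f g : T -> R.

Lemma continuous_mul f g : continuous f -> continuous g -> continuous (fun x => f x * g x).
Proof. by move=> cf cg x; exact: cvgM (cf x) (cg x). Qed.

Lemma continuous_sum (I : Type) (r : seq I) (P : pred I) (F : I -> T -> R) :
  (forall i, continuous (F i)) -> continuous (fun x => \sum_(i <- r | P i) F i x).
Proof. by move=> cF; apply: continuous_big => [|i _]; [exact: add_continuous|]. Qed.

Lemma continuous_prod (I : Type) (r : seq I) (P : pred I) (F : I -> T -> R) :
  (forall i, continuous (F i)) -> continuous (fun x => \prod_(i <- r | P i) F i x).
Proof. by move=> cF; apply: continuous_big => [|i _]; [exact: mul_continuous|]. Qed.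

Lemma continuous_det n (M : T -> 'M[R]_n) :
  (forall i j, continuous (fun x => M x i j)) -> continuous (fun x => \det (M x)).
Proof.
move=> cM; apply: continuous_sum => s; apply: continuous_mul; first exact: cst_continuous.
by apply: continuous_prod => i; exact: cM.
Qed.

Lemma continuous_mulmx m n q (M : T -> 'M[R]_(m, n)) (N : T -> 'M[R]_(n, q)) :
  (forall i j, continuous (fun x => M x i j)) -> (forall i j, continuous (fun x => N x i j)) ->
  forall i j, continuous (fun x => (M x *m N x) i j).
Proof.
move=> cM cN i j; under eq_fun do rewrite mxE.
by apply: continuous_sum => l; apply: continuous_mul.
Qed.

Lemma continuous_ext_power t d (M : T -> 'M[R]_d) :
  (forall i j, continuous (fun x => M x i j)) ->
  forall I J, continuous (fun x => ext_power t (M x) I J).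
Proof.
move=> cM I J; under eq_fun do rewrite ext_powerE.
by apply: continuous_det => i j; under eq_fun do rewrite mxE; exact: cM.
Qed.

End Continuity.

Section OrthogonalPairs.
Variables (R : realType) (d : nat).

(** A pair of matrices is stored in one row vector so that compactness of balls of row vectors
    applies to it. *)
Definition fst_mx (v : 'rV[R]_(d * d + d * d)) : 'M[R]_d := vec_mx (lsubmx v).
Definition snd_mx (v : 'rV[R]_(d * d + d * d)) : 'M[R]_d := vec_mx (rsubmx v).

Lemma fst_mx_continuous i j : continuous (fun v => fst_mx v i j).
Proof. by under eq_fun do rewrite /fst_mx !mxE; exact: coord_continuous. Qed.

Lemma snd_mx_continuous i j : continuous (fun v => snd_mx v i j).
Proof. by under eq_fun do rewrite /snd_mx !mxE; exact: coord_continuous. Qed.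

Definition orthogonal_pairs : set 'rV[R]_(d * d + d * d) :=
  [set v | fst_mx v *m (fst_mx v)^T = 1%:M /\ snd_mx v *m (snd_mx v)^T = 1%:M].

Lemma orthogonal_pairs_compact : compact orthogonal_pairs.
Proof.
apply: (subclosed_compact _ (@closed_ball_compact R _ 1)); last first.
  move=> v [h1 h2] /=; apply: norm_le_entry => // i l; rewrite ord1.
  rewrite -[v]hsubmxK; case: (splitP l) => [l' e|l' e].
    rewrite (_ : l = lshift _ l'); last exact: val_inj.
    rewrite row_mxEl; case/mxvec_indexP: l' {e} => a b.
    rewrite (_ : lsubmx v 0 _ = fst_mx v a b); last by rewrite [RHS]mxE.
    exact: orthogonal_entry.
  rewrite (_ : l = rshift _ l'); last exact: val_inj.
  rewrite row_mxEr; case/mxvec_indexP: l' {e} => a b.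
  rewrite (_ : rsubmx v 0 _ = snd_mx v a b); last by rewrite [RHS]mxE.
  exact: orthogonal_entry.
have orth_closed (f : 'rV[R]_(d * d + d * d) -> 'M[R]_d) :
    (forall i j, continuous (fun v => f v i j)) ->
    closed [set v | f v *m (f v)^T = 1%:M].
  move=> cf.
  have -> : [set v | f v *m (f v)^T = 1%:M] = \bigcap_(ij in [set: 'I_d * 'I_d])
      ((fun v => (f v *m (f v)^T) ij.1 ij.2) @^-1` [set x | x = (1%:M : 'M[R]_d) ij.1 ij.2]).
    apply/seteqP; split=> v /= h; first by move=> ij _ /=; rewrite h.
    by apply/matrixP => i j; exact: (h (i, j) I).
  apply: closed_bigI => -[i j] _; apply: preimage_closed; last exact: closed_eq.
  move=> v _; move: v; apply: continuous_mulmx => // i' j'.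
  by under eq_fun do rewrite mxE; exact: cf.
rewrite (_ : orthogonal_pairs = [set v | fst_mx v *m (fst_mx v)^T = 1%:M] `&`
  [set v | snd_mx v *m (snd_mx v)^T = 1%:M])//.
apply: closedI; apply: orth_closed.
  exact: fst_mx_continuous.
exact: snd_mx_continuous.
Qed.

Lemma pair_mx (U V : 'M[R]_d) : exists v, fst_mx v = U /\ snd_mx v = V.
Proof.
exists (row_mx (mxvec U) (mxvec V)).
by rewrite /fst_mx /snd_mx row_mxKl row_mxKr !mxvecK.
Qed.

Definition top_minor (t : nat) (td : (t <= d)%N) (V X U : 'M[R]_d) : R :=
  (ext_power t V *m ext_power t X *m ext_power t U) (ext_top td) (ext_top td).

(** If it failed, for each j some orthogonal pair would make each of the first j + 1 bridges have a
    top minor below 1/(j + 1). At a cluster point of these pairs some bridge has all its top minors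
    nonzero, and by continuity this persists nearby with a fixed lower bound. *)
Lemma uniform_transverse (X : nat -> 'M[R]_d) :
  (forall (t : nat) (psi : 'rV[R]_(ext_dim t d)) (u : 'cV[R]_(ext_dim t d)),
    (1 <= t <= d.-1)%N -> psi != 0 -> u != 0 ->
    \forall j \near \oo, (psi *m ext_power t (X j) *m u) 0 0 != 0) ->
  exists (r : nat) (c : R), 0 < c /\ forall U V : 'M[R]_d,
    U *m U^T = 1%:M -> V *m V^T = 1%:M -> exists2 N : 'I_r,
      True & forall i : 'I_d, (0 < i)%N -> c <= `|top_minor (ltnW (ltn_ord i)) V (X N) U|.
Proof.
move=> HX; apply: contrapT => /forallNP no.
pose F N (i : 'I_d) v := top_minor (ltnW (ltn_ord i)) (snd_mx v) (X N) (fst_mx v).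
have cF N i : continuous (F N i).
  rewrite /F /top_minor; apply: continuous_mulmx => I J.
    apply: continuous_mulmx => I' J'; last exact: cst_continuous.
    apply: continuous_ext_power; exact: snd_mx_continuous.
  apply: continuous_ext_power; exact: fst_mx_continuous.
have /boolp.choice[v vP] : forall j : nat, exists v, orthogonal_pairs v /\
    forall N, (N <= j)%N -> exists2 i : 'I_d, (0 < i)%N & `|F N i v| < j.+1%:R^-1.
  move=> j; have /forallNP/(_ (j.+1%:R^-1)) h := no j.+1.
  apply: contrapT => /forallNP h'; apply: h; split; first by rewrite invr_gt0.
  move=> U V UU VV; have [v [vU vV]] := pair_mx U V.
  apply: contrapT => /forall2NP h; apply: (h' v); split.
    by rewrite /orthogonal_pairs/= vU vV.
  move=> N Nj; have [//|] := h (Ordinal (Nj : (N < j.+1)%N)).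
  move=> hN; apply: contrapT => hi; apply: hN => i i0.
  rewrite leNgt; apply/negP => lt_i; apply: hi; exists i => //.
  by rewrite /F vU vV.
have [w [[wU wV] clw]] : (orthogonal_pairs `&` cluster (v @ \oo)) !=set0.
  apply: orthogonal_pairs_compact; exists 0%N => // j _; exact: (vP j).1.
have ev : \forall N \near \oo, forall i : 'I_d, (0 < i)%N -> F N i w != 0.
  apply: filter_forall => i; have [i0|i0] := posnP i.
    exact: nearW.
  (* The top minor pairs the top row of the power of V with the top column of that of U;
     orthogonality makes both nonzero. *)
  have top_row : row (ext_top (ltnW (ltn_ord i))) (ext_power i (snd_mx w)) != 0.
    apply/negP => /eqP r0.
    have := congr1 (mulmx^~ (ext_power i (snd_mx w)^T)) r0.
    rewrite -row_mul -ext_powerM wV ext_power1 mul0mx => /rowP/(_ (ext_top (ltnW (ltn_ord i)))).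
    by rewrite !mxE eqxx => /eqP; rewrite oner_eq0.
  have top_col : col (ext_top (ltnW (ltn_ord i))) (ext_power i (fst_mx w)) != 0.
    apply/negP => /eqP r0.
    have := congr1 (mulmx (ext_power i (fst_mx w)^T)) r0.
    rewrite colE mulmxA -ext_powerM (mulmx1C wU) ext_power1 mul1mx mulmx0.
    move=> /colP/(_ (ext_top (ltnW (ltn_ord i)))).
    by rewrite !mxE !eqxx => /eqP; rewrite oner_eq0.
  have id : (1 <= i <= d.-1)%N by rewrite i0/=; have := ltn_ord i; lia.
  apply: filterS (HX i _ _ id top_row top_col) => N h _.
  move: h; rewrite /F /top_minor -row_mul colE !mulmxA -row_mul -colE.
  by rewrite !mxE.
have [N HN] := filter_ex ev.
have [e [e0 He]] : exists e : R, 0 < e /\ forall i : 'I_d, (0 < i)%N -> e < `|F N i w|.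
  have /filter_ex[n He] : \forall n \near \oo, forall i : 'I_d, (0 < i)%N ->
      n.+1%:R^-1 < `|F N i w|.
    apply: filter_forall => i; have [i0|i0] := posnP i; first exact: nearW.
    have Fi : 0 < `|F N i w| by rewrite normr_gt0; exact: HN.
    by apply: filterS (near_infty_natSinv_lt (PosNum Fi)) => n.
  by exists n.+1%:R^-1; split; rewrite ?invr_gt0.
have nearA : \forall v \near w, forall i : 'I_d, (0 < i)%N -> e < `|F N i v|.
  apply: (@filter_forall _ _ (fun (i : 'I_d) v => (0 < i)%N -> e < `|F N i v|) _ (nbhs_filter w)).
  move=> i; have [i0|i0] := posnP i; first exact: nearW.
  have cn : (fun v => `|F N i v|) @ w --> `|F N i w|.
    exact: cvg_norm (cF N i w).
  by apply: filterS (cvgr_gt _ cn _ (He i i0)).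
have [J _ hJ] := nbhs_infty_ger (e^-1).
have [_ [[j /= jJ <-] Aj]] : ((v @` [set j | (maxn N J <= j)%N]) `&`
    [set v | forall i : 'I_d, (0 < i)%N -> e < `|F N i v|]) !=set0.
  by apply: clw => //; exists (maxn N J) => // j jJ; exists j.
move: jJ; rewrite geq_max => /andP[Nj Jj].
have [i i0 hi] := (vP j).2 N Nj.
have := lt_trans (Aj i i0) hi; rewrite ltNge => /negP; apply.
rewrite -[leRHS]invrK lef_pV2 ?posrE ?invr_gt0//.
by apply: le_trans (hJ J (leqnn J)) _; rewrite ler_nat leqW.
Qed.

End OrthogonalPairs.

(** * Logarithms of singular values *)

Lemma finite_bound (R : realType) (I : finType) (f : I -> R) :
  exists2 c, 0 <= c & forall i, f i <= c.
Proof.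
exists (\sum_i `|f i|) => [|i]; first by rewrite sumr_ge0.
by rewrite (bigD1 i)//= -[leLHS]addr0 lerD ?ler_norm// sumr_ge0.
Qed.

Section LogEstimates.
Variable R : realType.
Implicit Types a b c x y m u v : R.

Lemma ln_le_mul a b c x : 0 < a -> 0 < b -> 0 < c -> 0 < x ->
  x <= c * (a * b) -> ln x <= ln a + ln b + ln c.
Proof.
move=> a0 b0 c0 x0 h; have ab0 : 0 < a * b by rewrite mulr_gt0.
by rewrite addrC -lnM// -lnM// ler_ln// posrE mulr_gt0.
Qed.

Lemma ln_mul_le a b c kappa x : 0 < a -> 0 < b -> 0 < c -> 0 < kappa -> 0 < x ->
  a * kappa * b <= c * x -> ln a + ln b <= ln x + ln (c / kappa).
Proof.
move=> a0 b0 c0 k0 x0 h; have ck0 : 0 < c / kappa by rewrite divr_gt0.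
rewrite -!lnM ?posrE// ler_ln ?posrE ?(mulr_gt0 a0) ?(mulr_gt0 x0)//.
by rewrite mulrA ler_pdivlMr// mulrAC [x * c]mulrC.
Qed.

Lemma norm_sub_le a b x y c e : a <= x + b + c -> b <= y + a + c ->
  `|c| + `|x| + `|y| <= e -> `|a - b| <= e.
Proof.
move=> h1 h2 h; have := ler_norm c; have := ler_norm x; have := ler_norm y.
have := normr_ge0 x; have := normr_ge0 y => *.
by rewrite ler_norml; apply/andP; split; lra.
Qed.

Lemma norm_sub2_le m u v vx x c c1 c2 c3 : vx <= v + x + c -> m <= vx + u + c ->
  v + u <= m + (c2 + c3) -> `|x| <= c3 -> `|c| <= c1 -> 0 <= c2 ->
  `|m - u - v| <= c1 + c1 + c2 + c3.
Proof.
move=> h1 h2 h3 hx hc c20; have := ler_norm c; have := ler_norm x.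
have := normr_ge0 x; have := normr_ge0 c => *.
by rewrite ler_norml; apply/andP; split; lra.
Qed.

End LogEstimates.

Section LogSigma.
Variables (R : realType) (t d : nat).
Hypothesis td : (t <= d)%N.
Implicit Types M N P Q X U V : 'M[R]_d.

Lemma sigma_prod_equiv : exists2 c : R, 1 <= c & forall M, M \in unitmx ->
  sigma_prod t M <= c * ext_norm t M /\ ext_norm t M <= c * sigma_prod t M.
Proof using td.
pose K : R := (ext_dim t d * ext_dim t d * t`!)%:R.
pose D : R := (ext_dim t d)%:R.
have KD : 0 <= K ^+ 2 * D by rewrite mulr_ge0 ?sqr_ge0 ?ler0n.
exists (K ^+ 2 + K ^+ 2 * D + 1); first by rewrite lerDr addr_ge0// sqr_ge0.
move=> M Mu; have [h1 h2] := sigma_prod_ext_norm td (erefl K) Mu.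
have sp := sigma_prod_gt0 t Mu.
split.
  apply: le_trans h1 _; rewrite ler_wpM2r ?ext_norm_ge0//.
  by rewrite -addrA lerDl addr_ge0.
apply: le_trans h2 _; rewrite ler_wpM2r ?(ltW sp)//.
by rewrite addrAC lerDr addr_ge0// sqr_ge0.
Qed.

Lemma ln_sigma_prodM : exists C : R, forall M N, M \in unitmx -> N \in unitmx ->
  ln (sigma_prod t (M *m N)) <= ln (sigma_prod t M) + ln (sigma_prod t N) + C.
Proof using td.
have [c c1 h] := sigma_prod_equiv.
have c0 : 0 < c by apply: lt_le_trans c1.
exists (ln (c * c * c)) => M N Mu Nu.
have MNu : M *m N \in unitmx by rewrite unitmx_mul Mu.
have sM := sigma_prod_gt0 t Mu; have sN := sigma_prod_gt0 t Nu.
have sMN := sigma_prod_gt0 t MNu.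
apply: ln_le_mul => //; first by rewrite !mulr_gt0.
apply: le_trans (h _ MNu).1 _.
apply: (@le_trans _ _ (c * ((c * sigma_prod t M) * (c * sigma_prod t N)))).
  rewrite ler_wpM2l ?(ltW c0)//; apply: le_trans (ext_normM _ _ _) _.
  by rewrite ler_pM ?ext_norm_ge0 ?(h _ Mu).2 ?(h _ Nu).2.
move: (sigma_prod t M) (sigma_prod t N) => x y.
by rewrite [leLHS](_ : _ = c * c * c * (x * y)); [|ring].
Qed.

(* In the bases given by the two decompositions, the (top, top) coefficient of
   the exterior power of P X Q factors through the two top singular products. *)
Lemma sigma_prod_top_minor P Q X U V U' V' (s s' : 'rV[R]_d) :
  P \in unitmx -> Q \in unitmx -> U *m U^T = 1%:M -> V' *m V'^T = 1%:M ->
  P = U *m diag_mx s *m V -> Q = U' *m diag_mx s' *m V' ->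
  (forall i, sigma P i = s 0 i) -> (forall i, sigma Q i = s' 0 i) ->
  sigma_prod t P * `|top_minor td V X U'| * sigma_prod t Q <=
  ext_norm t U^T * ext_norm t (P *m X *m Q) * ext_norm t V'^T.
Proof using Type.
move=> Pu Qu UU VV PE QE sP sQ.
have E : U^T *m (P *m X *m Q) *m V'^T = diag_mx s *m (V *m X *m U') *m diag_mx s'.
  rewrite PE QE !mulmxA (mulmx1C UU) mul1mx -!mulmxA VV mulmx1.
  by rewrite !mulmxA.
have top (r : 'rV[R]_d) M : (forall i, sigma M i = r 0 i) ->
    \prod_(a < t) r 0 (tnth (enum_val (ext_top td)) a) = sigma_prod t M.
  move=> rE; rewrite /sigma_prod (big_ord_narrow td)/=.
  by apply: eq_bigr => a _; rewrite rE ext_topE.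
apply: (@le_trans _ _ (ext_norm t (U^T *m (P *m X *m Q) *m V'^T))); last first.
  apply: le_trans (ext_normM _ _ _) _; rewrite ler_wpM2r ?ext_norm_ge0//.
  exact: ext_normM.
apply: le_trans (ext_norm_entry _ (ext_top td) (ext_top td)).
rewrite E !ext_powerM !ext_power_diag mul_mx_diag mxE mul_diag_mx !mxE.
rewrite (top _ _ sP) (top _ _ sQ) !normrM.
rewrite (ger0_norm (ltW (sigma_prod_gt0 _ Pu))) (ger0_norm (ltW (sigma_prod_gt0 _ Qu))).
by rewrite /top_minor [X in _ * `|X| * _]mxE.
Qed.

Lemma ln_sigma_prod_transverse (kappa : R) : 0 < kappa ->
  exists C, forall P Q X U V U' V' (s s' : 'rV[R]_d),
  P \in unitmx -> Q \in unitmx -> X \in unitmx ->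
  U *m U^T = 1%:M -> V' *m V'^T = 1%:M ->
  P = U *m diag_mx s *m V -> Q = U' *m diag_mx s' *m V' ->
  (forall i, sigma P i = s 0 i) -> (forall i, sigma Q i = s' 0 i) ->
  kappa <= `|top_minor td V X U'| ->
  ln (sigma_prod t P) + ln (sigma_prod t Q) <= ln (sigma_prod t (P *m X *m Q)) + C.
Proof using td.
move=> kappa0; have [c c1 h] := sigma_prod_equiv.
have c0 : 0 < c by apply: lt_le_trans c1.
have [K K0 K1] : exists2 K : R, 0 < K & forall Y : 'M[R]_d, Y *m Y^T = 1%:M ->
    ext_norm t Y^T <= K.
  exists ((ext_dim t d * ext_dim t d * t`!).+1%:R) => [|Y YY]; first by rewrite ltr0Sn.
  apply: (@le_trans _ _ (ext_dim t d * ext_dim t d * t`!)%:R); last by rewrite ler_nat.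
  by apply: ext_norm_orthogonal; rewrite trmxK (mulmx1C YY).
have e0 : 0 < K * c * K by rewrite !mulr_gt0.
exists (ln (K * c * K / kappa)) => P Q X U V U' V' s s'
  Pu Qu Xu UU VV PE QE sP sQ kX.
have Mu : P *m X *m Q \in unitmx by rewrite !unitmx_mul Pu Xu.
have sM := sigma_prod_gt0 t Mu.
have s_P := sigma_prod_gt0 t Pu; have s_Q := sigma_prod_gt0 t Qu.
apply: ln_mul_le => //.
apply: (@le_trans _ _ (sigma_prod t P * `|top_minor td V X U'| * sigma_prod t Q)).
  exact: ler_wpM2r (ltW s_Q) _ _ (ler_wpM2l (ltW s_P) kX).
apply: le_trans (sigma_prod_top_minor X Pu Qu UU VV PE QE sP sQ) _.
rewrite [leRHS](_ : _ = K * (c * sigma_prod t (P *m X *m Q)) * K); last first.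
  by rewrite mulrAC -!mulrA.
apply: ler_pM; rewrite ?mulr_ge0 ?ext_norm_ge0 ?K1//.
by apply: ler_pM; rewrite ?ext_norm_ge0 ?K1 ?(h _ Mu).2.
Qed.

End LogSigma.

Section SigmaProducts.
Variables (R : realType) (d : nat).
Implicit Types M N : 'M[R]_d.

Lemma sigma_prod0 M : sigma_prod 0 M = 1.
Proof. by rewrite /sigma_prod big_pred0. Qed.

Lemma sigma_prodS M (i : 'I_d) : sigma_prod i.+1 M = sigma_prod i M * sigma M i.
Proof.
rewrite /sigma_prod (bigD1 i)//= mulrC; congr (_ * _); apply: eq_bigl => j.
by rewrite ltnS ltn_neqAle andbC.
Qed.

Lemma ln_sigma M (i : 'I_d) : M \in unitmx ->
  ln (sigma M i) = ln (sigma_prod i.+1 M) - ln (sigma_prod i M).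
Proof.
move=> Mu; rewrite sigma_prodS lnM ?posrE ?sigma_gt0 ?sigma_prod_gt0//.
by rewrite addrC addKr.
Qed.

(** In top degree the product of singular values is |det|, which replaces the transversality
    argument there. *)
Lemma sigma_prod_topM M N : M \in unitmx -> N \in unitmx ->
  sigma_prod d (M *m N) = sigma_prod d M * sigma_prod d N.
Proof.
move=> Mu Nu; have E (X : 'M[R]_d) : X \in unitmx -> sigma_prod d X = `|\det X|.
  by move=> Xu; rewrite -prod_sigma_det//; apply: eq_bigl => i; exact: ltn_ord.
by rewrite !E ?unitmx_mul ?Mu// det_mulmx normrM.
Qed.

End SigmaProducts.

Section PartialSums.
Variables (R : realType) (T : Type) (d : nat) (lam : T -> 'rV[R]_d) (S : nat -> T -> R).
Hypothesis lamE : forall w i, lam w 0 i = S i.+1 w - S i w.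

Lemma partial_sums_sub w u C : (forall t, (t <= d)%N -> `|S t w - S t u| <= C) ->
  `|lam w - lam u| <= C + C.
Proof using lamE.
move=> SC; have C0 : 0 <= C by apply: le_trans (SC 0%N _).
apply: norm_le_entry => [|j i]; first exact: addr_ge0.
rewrite ord1 !mxE !lamE (_ : _ - _ = (S i.+1 w - S i.+1 u) - (S i w - S i u)); last by ring.
by apply: le_trans (ler_normB _ _) _; apply: lerD; apply: SC; rewrite // ltnW.
Qed.

Lemma partial_sums_sub2 w u v C :
  (forall t, (t <= d)%N -> `|S t w - S t u - S t v| <= C) ->
  `|lam w - lam u - lam v| <= C + C.
Proof using lamE.
move=> SC; have C0 : 0 <= C by apply: le_trans (SC 0%N _).
apply: norm_le_entry => [|j i]; first exact: addr_ge0.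
rewrite ord1 !mxE !lamE.
rewrite (_ : _ - _ = (S i.+1 w - S i.+1 u - S i.+1 v) - (S i w - S i u - S i v)); last by ring.
by apply: le_trans (ler_normB _ _) _; apply: lerD; apply: SC; rewrite // ltnW.
Qed.

End PartialSums.

Section CocycleGrowth.
Variables (R : realType) (k d : nat) (A : 'I_k -> 'M[R]_d).
Hypothesis Au : forall i, A i \in unitmx.

Definition log_sigma (w : seq 'I_k) : 'rV[R]_d := \row_i ln (sigma (wprod A w) i).

(** The bound from below is the same submultiplicativity, applied to the inverse of the appended
    matrix. *)
Lemma sigma_prod_rcons_bound : exists2 C : R, 0 <= C & forall t w a, (t <= d)%N ->
  `|ln (sigma_prod t (wprod A (rcons w a))) - ln (sigma_prod t (wprod A w))| <= C.
Proof using Au.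
have /boolp.choice[c cP] : forall t : 'I_d.+1, exists c : R, forall M N : 'M[R]_d,
    M \in unitmx -> N \in unitmx ->
    ln (sigma_prod t (M *m N)) <= ln (sigma_prod t M) + ln (sigma_prod t N) + c.
  by move=> t; exact: (ln_sigma_prodM _ (ltnSE (ltn_ord t))).
pose f (ta : 'I_d.+1 * 'I_k) := `|c ta.1| + `|ln (sigma_prod ta.1 (A ta.2))| +
  `|ln (sigma_prod ta.1 (invmx (A ta.2)))|.
have [C C0 fC] := finite_bound f.
exists C => // t w a td; have := fC (Ordinal (td : (t < d.+1)%N), a); rewrite /f/= => h.
have wu := wprod_unit Au w; have Iu : invmx (A a) \in unitmx by rewrite unitmx_inv.
have wau := wprod_unit Au (rcons w a).
have h1 := cP (Ordinal (td : (t < d.+1)%N)) _ _ (Au a) wu.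
have h2 := cP (Ordinal (td : (t < d.+1)%N)) _ _ Iu wau.
rewrite {1}wprod_rcons mulKmx ?Au// /= in h2.
rewrite -wprod_rcons /= in h1.
exact: norm_sub_le h1 h2 h.
Qed.

Lemma log_sigma_bridge : typical A -> exists (C : R) (r : nat) (K : 'I_r -> seq 'I_k),
  0 <= C /\ forall u v, exists i, forall t, (t <= d)%N ->
  `|ln (sigma_prod t (wprod A (u ++ K i ++ v))) - ln (sigma_prod t (wprod A u)) -
    ln (sigma_prod t (wprod A v))| <= C.
Proof using Au.
move=> /(typical_transverse Au)[w /uniform_transverse[r [kappa [kappa0 wP]]]].
have /boolp.choice[c cP] : forall t : 'I_d.+1, exists c : R, forall M N : 'M[R]_d,
    M \in unitmx -> N \in unitmx ->
    ln (sigma_prod t (M *m N)) <= ln (sigma_prod t M) + ln (sigma_prod t N) + c.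
  by move=> t; exact: (ln_sigma_prodM _ (ltnSE (ltn_ord t))).
have /boolp.choice[e eP] := fun i : 'I_d => ln_sigma_prod_transverse (ltnW (ltn_ord i)) kappa0.
have [C1 C10 fC1] := finite_bound (fun t => `|c t|).
have [C2 C20 fC2] := finite_bound (fun i => `|e i|).
have [C3 C30 fC3] := finite_bound (fun ti : 'I_d.+1 * 'I_r =>
  `|ln (sigma_prod ti.1 (wprod A (w ti.2)))|).
have shift_le (x y z C : R) : - z <= C -> y + x <= y + z + x + C by lra.
exists (C1 + C1 + C2 + C3), r, (fun i => w i); split; first by rewrite !addr_ge0.
move=> u v; have uu := wprod_unit Au u; have vu := wprod_unit Au v.
have [U1 [V1 [s1 [UU1 VV1 E1 _ S1]]]] := svd uu.
have [U2 [V2 [s2 [UU2 VV2 E2 _ S2]]]] := svd vu.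
(* Products reverse words: the matrix of [v] stands on the left, so its right factor [V2] and the
   left factor [U1] of [u] face the bridge. *)
have [N _ hN] := wP U1 V2 UU1 VV2; exists N => t td.
have xu := wprod_unit Au (w N).
have E : wprod A (u ++ w N ++ v) = wprod A v *m wprod A (w N) *m wprod A u.
  by rewrite !wprod_cat.
have td' : (t < d.+1)%N by [].
have xb := fC3 (Ordinal td', N); rewrite /= in xb.
have cb := fC1 (Ordinal td'); rewrite /= in cb.
have up1 := cP (Ordinal td') _ _ vu xu.
have vxu : wprod A v *m wprod A (w N) \in unitmx by rewrite unitmx_mul vu.
have up2 := cP (Ordinal td') _ _ vxu uu.
rewrite /= -E in up1 up2.
have low : ln (sigma_prod t (wprod A v)) + ln (sigma_prod t (wprod A u)) <=
    ln (sigma_prod t (wprod A (u ++ w N ++ v))) + (C2 + C3).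
  (* Three regimes: t = 0 is trivial, t = d uses the determinant, and the degrees between use the
     chosen bridge. *)
  have [->|t0] := posnP t; first by rewrite !sigma_prod0 ln1 !add0r addr_ge0.
  move: td; rewrite leq_eqVlt => /predU1P[tE|lt_td].
    rewrite E tE !sigma_prod_topM// !lnM ?posrE ?mulr_gt0 ?sigma_prod_gt0//.
    rewrite tE in xb; apply: shift_le.
    apply: le_trans (ler_norm _) _; rewrite normrN; apply: le_trans xb _.
    by rewrite lerDr.
  have := eP (Ordinal lt_td) _ _ _ _ _ _ _ _ _ vu uu xu UU2 VV1 E2 E1 S2 S1
    (hN (Ordinal lt_td) t0).
  rewrite /= -E => h; apply: le_trans h _; rewrite lerD2l.
  apply: le_trans (ler_norm _) _; apply: le_trans (fC2 _) _; by rewrite lerDl.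
exact: norm_sub2_le up1 up2 low xb cb C20.
Qed.

Lemma log_sigma_quasi_additive (a0 : 'I_k) : typical A ->
  exists C L r ext (key : seq 'I_k -> seq 'I_k -> 'I_r),
    quasi_additive log_sigma C L ext key.
Proof using Au.
move=> /log_sigma_bridge[C [r [K [C0 KP]]]].
have [C' C'0 rP] := sigma_prod_rcons_bound.
pose S t w := ln (sigma_prod t (wprod A w)).
have SE w i : log_sigma w 0 i = S i.+1 w - S i w.
  by rewrite mxE; exact: ln_sigma (wprod_unit Au w).
pose c := C + C + (C' + C') + `|log_sigma [::]|.
have := @bridges_quasi_additive R k d log_sigma c r K a0; case=> [|w a|u v|C1 [L [ext [key qa]]]].
- by rewrite /c lerDr !addr_ge0.
- apply: (@le_trans _ _ (C' + C')); last first.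
    by rewrite /c addrAC lerDr !addr_ge0.
  by apply: (partial_sums_sub SE) => t td; exact: rP.
- have [i iP] := KP u v; exists i.
  apply: (@le_trans _ _ (C + C)); last by rewrite /c -addrA lerDl !addr_ge0.
  by apply: (partial_sums_sub2 SE) => t td; exact: iP.
- by exists C1, L, r, ext, key.
Qed.

End CocycleGrowth.

(** * Level sets and pressure in terms of words *)

Section Translation.
Variables (R : realType) (k d : nat) (A : 'I_k -> 'M[R]_d).
Hypothesis Au : forall i, A i \in unitmx.

Lemma level_set_growth (alpha : 'rV[R]_d) : level_set A alpha = growth_set (log_sigma A) alpha.
Proof using Type.
apply/seteqP; split=> x /= h.
  move=> e e0.
  have : \forall n \near \oo, forall i : 'I_d,
      `|alpha 0 i - n%:R^-1 * ln (sigma (cocycle A n%:Z x) i)| <= e.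
    apply: filter_forall => i; have /cvgrPdist_le := h i; exact.
  apply: filterS2 (nbhs_infty_gt 0) => n n0 hn.
  have n0' : 0 < n%:R :> R by rewrite ltr0n.
  apply: norm_le_entry => [|j i]; first by rewrite mulr_ge0 ?ltW.
  rewrite ord1; have := hn i; rewrite [cocycle _ _ _]cocycle_posE => hi.
  rewrite -[e](mulfK (lt0r_neq0 n0')) divfK ?lt0r_neq0//.
  rewrite !mxE distrC.
  rewrite (_ : _ - _ = n%:R * (alpha 0 i - n%:R^-1 * ln (sigma (wprod A (pref x n)) i))).
    by rewrite normrM gtr0_norm// mulrC ler_wpM2r// ltW.
  by rewrite mulrBr mulrA mulfV ?lt0r_neq0// mul1r.
move=> i; apply/cvgrPdist_le => e e0.
have := h e e0; apply: filterS2 (nbhs_infty_gt 0) => n n0 hn.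
have n0' : 0 < n%:R :> R by rewrite ltr0n.
rewrite [cocycle _ _ _]cocycle_posE -(ler_pM2l n0') -[X in X * `|_|]gtr0_norm// -normrM.
rewrite mulrBr mulrA mulfV ?lt0r_neq0// mul1r distrC [leRHS]mulrC.
apply: le_trans hn; apply: le_trans (entry_le_norm _ 0 i).
by rewrite !mxE.
Qed.

Lemma psi_inner q (w : seq 'I_k) : psi q (wprod A w) = expR (inner q (log_sigma A w)).
Proof using Au.
rewrite /psi /inner expR_sum; apply: eq_bigr => i _.
by rewrite mxE /powR gt_eqF// sigma_gt0// wprod_unit.
Qed.

Lemma pressure_press q : pressure A q = press (log_sigma A) q.
Proof using Au.
rewrite /pressure /press.
rewrite (_ : (fun n => _) = (fun n => n%:R^-1 * ln (Zsum (log_sigma A) q n)))//.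
apply/funext => n; congr (_ * ln _).
by apply: eq_bigr => I _; exact: psi_inner.
Qed.

End Translation.

Theorem theoremA (R : realType) (k d : nat) (A : 'I_k -> 'M[R]_d) :
  (0 < d)%N ->
  (forall i : 'I_k, A i \in unitmx) ->
  typical A ->
  forall alpha : 'rV[R]_d, interior (spectrum A) alpha ->
    htop R (level_set A alpha) =
    ereal_inf [set (pressure A q - inner q alpha)%:E | q in [set: 'rV[R]_d]].
Proof.
move=> _ Au tA alpha ia.
(* The periodic point supplies a letter, so the alphabet is inhabited. *)
have [p _] := tA; have a0 : 'I_k := p 0.
have [C [L [r [ext [key qa]]]]] := log_sigma_quasi_additive Au a0 tA.
rewrite level_set_growth (htop_growth_set qa a0).
  by congr ereal_inf; apply: eq_imagel => q _; rewrite pressure_press.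
rewrite (_ : [set beta | _] = spectrum A)//.
by apply/funext => beta; rewrite /spectrum/= level_set_growth.
Qed.
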